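(* Let $S=k[x_1,\dots,x_n]$ be a polynomial ring over an infinite field $k$, and let $I\subset S$ be a proper homogeneous ideal such that $S/I$ is Cohen--Macaulay and $I$ has a linear resolution. Then $R=(S/I)_{\mathfrak m}$ is Burch, where $\mathfrak m=(x_1,\dots,x_n)$.
   Context: All rings are commutative and noetherian. An ideal $I$ of a local ring $(A,\mathfrak n)$ is a Burch ideal if $\mathfrak n I\neq\mathfrak n(I:_A\mathfrak n)$. A local ring $(R,\mathfrak m)$ of depth $t$ with completion $\widehat R$ is a Burch ring if there exist a maximal $\widehat R$-regular sequence $\boldsymbol{x}=x_1,\dots,x_t$ in $\widehat R$, a regular local ring $A$ and a Burch ideal $I$ of $A$ with $\widehat R/(\boldsymbol{x})\cong A/I$. A homogeneous ideal $I$ (with the standard grading) has a linear resolution if for some $t$ the $i$-th free module in its minimal graded free resolution is generated in degree $t+i$ for all $i\ge 0$. *)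

(* Defs.v *)
From HB Require Import structures.
From mathcomp Require Import all_boot all_order all_algebra.
From mathcomp Require Import generic_quotient ring.
From mathcomp Require Import boolp classical_sets functions cardinality.
From mathcomp Require Import mpoly.

Set Implicit Arguments.
Unset Strict Implicit.
Unset Printing Implicit Defensive.

Import GRing.Theory.
Local Open Scope ring_scope.
Local Open Scope quotient_scope.
Local Open Scope classical_set_scope.

(* Ideals are Prop-valued sets, and rings are [comPzRingType]s: the zero ring
   is not excluded by the type, so that quotients by arbitrary ideals,
   localizations and completions are total constructions. *)

Section Ideals.
Variable R : comPzRingType.
Implicit Types (I J P G W : set R) (x y : R).

Definition is_ideal I :=
  [/\ I 0, forall x y, I x -> I y -> I (x + y) & forall a x, I x -> I (a * x)].

Definition ideal_gen G : set R := smallest is_ideal G.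

Definition ideal_mul I J : set R := ideal_gen [set x * y | x in I & y in J].

Definition ideal_colon I J : set R := [set x | forall y, J y -> I (x * y)].

Fixpoint ideal_exp I n : set R :=
  if n is n'.+1 then ideal_mul I (ideal_exp I n') else setT.

Definition prime_ideal P :=
  [/\ is_ideal P, ~ P 1 & forall x y, P (x * y) -> P x \/ P y].

Definition maximal_ideal P :=
  [/\ is_ideal P, ~ P 1
    & forall J, is_ideal J -> ~ J 1 -> P `<=` J -> J `<=` P].

Definition mul_closed W := W 1 /\ forall x y, W x -> W y -> W (x * y).

Definition mul_gen W : set R := smallest mul_closed W.

Lemma ideal_genP G : is_ideal (ideal_gen G).
Proof.
split=> [|x y Gx Gy|a x Gx] J [idJ GJ]; have [J0 JD JM] := idJ; first exact: J0.
  by apply: JD; [apply: Gx|apply: Gy].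
by apply: JM; apply: Gx.
Qed.

Lemma ideal_expP I n : is_ideal (ideal_exp I n).
Proof. by case: n => [|n]; [split|apply: ideal_genP]. Qed.

Lemma mul_genP W : mul_closed (mul_gen W).
Proof.
split=> [|x y Wx Wy] J [mJ WJ]; have [J1 JM] := mJ; first exact: J1.
by apply: JM; [apply: Wx|apply: Wy].
Qed.

End Ideals.

(* The quotient of R by the ideal generated by G.  The [{ideal_quot I}] of
   ring_quotient requires I to carry a proof that it is a proper ideal. *)

Section Quotient.
Variables (R : comPzRingType) (G : set R).
Implicit Types x y z : R.

Definition quot_eq x y : bool := `[< ideal_gen G (x - y) >].

Lemma quot_eqP x y : reflect (ideal_gen G (x - y)) (quot_eq x y).
Proof. exact: asboolP. Qed.

Let idG := ideal_genP G.

Let genD x y : ideal_gen G x -> ideal_gen G y -> ideal_gen G (x + y).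
Proof. by case: idG => _ + _; apply. Qed.

Let genM x y : ideal_gen G y -> ideal_gen G (x * y).
Proof. by case: idG => _ _; apply. Qed.

Lemma quot_eq_equiv : equiv_class_of quot_eq.
Proof.
split=> [x|x y|y x z].
- by apply/quot_eqP; rewrite subrr; case: idG.
- by apply/quot_eqP/quot_eqP => /(genM (-1)); rewrite mulN1r opprB.
- move=> /quot_eqP xy /quot_eqP yz; apply/quot_eqP.
  by rewrite -[x - z](subrKA y); apply: genD.
Qed.

Canonical quot_eq_equivRel := EquivRelPack quot_eq_equiv.

Definition quot := {eq_quot quot_eq}.

HB.instance Definition _ : EqQuotient R quot_eq quot := EqQuotient.on quot.
HB.instance Definition _ := Choice.on quot.

Definition quot_pi (x : R) : quot := \pi x.

Lemma quot_piP x y : quot_pi x = quot_pi y <-> ideal_gen G (x - y).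
Proof. by split=> [/eqmodP/quot_eqP|/quot_eqP/eqmodP]. Qed.

Lemma quot_ind (P : quot -> Prop) : (forall x, P (quot_pi x)) -> forall q, P q.
Proof. by move=> Px; elim/quotW. Qed.

Let qopp (q : quot) := quot_pi (- repr q).
Let qadd (q r : quot) := quot_pi (repr q + repr r).
Let qmul (q r : quot) := quot_pi (repr q * repr r).

Let repr_piP x : ideal_gen G (repr (quot_pi x) - x).
Proof. by apply/quot_piP; rewrite /quot_pi reprK. Qed.

Let qoppE x : qopp (quot_pi x) = quot_pi (- x).
Proof.
apply/quot_piP; have /(genM (-1)) := repr_piP x.
by congr (ideal_gen G _); ring.
Qed.

Let qaddE x y : qadd (quot_pi x) (quot_pi y) = quot_pi (x + y).
Proof.
apply/quot_piP; have := genD (repr_piP x) (repr_piP y).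
by congr (ideal_gen G _); ring.
Qed.

Let qmulE x y : qmul (quot_pi x) (quot_pi y) = quot_pi (x * y).
Proof.
apply/quot_piP.
have := genD (genM (repr (quot_pi y)) (repr_piP x)) (genM x (repr_piP y)).
by congr (ideal_gen G _); ring.
Qed.

Let qaddA : associative qadd.
Proof.
by elim/quot_ind=> x; elim/quot_ind=> y; elim/quot_ind=> z; rewrite !qaddE addrA.
Qed.
Let qaddC : commutative qadd.
Proof. by elim/quot_ind=> x; elim/quot_ind=> y; rewrite !qaddE addrC. Qed.
Let qadd0 : left_id (quot_pi 0) qadd.
Proof. by elim/quot_ind=> x; rewrite !qaddE add0r. Qed.
Let qaddN : left_inverse (quot_pi 0) qopp qadd.
Proof. by elim/quot_ind=> x; rewrite qoppE !qaddE addNr. Qed.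

HB.instance Definition _ :=
  GRing.isZmodule.Build quot qaddA qaddC qadd0 qaddN.

Let qmulA : associative qmul.
Proof.
by elim/quot_ind=> x; elim/quot_ind=> y; elim/quot_ind=> z; rewrite !qmulE mulrA.
Qed.
Let qmulC : commutative qmul.
Proof. by elim/quot_ind=> x; elim/quot_ind=> y; rewrite !qmulE mulrC. Qed.
Let qmul1 : left_id (quot_pi 1) qmul.
Proof. by elim/quot_ind=> x; rewrite !qmulE mul1r. Qed.
Let qmulD : left_distributive qmul +%R.
Proof.
elim/quot_ind=> x; elim/quot_ind=> y; elim/quot_ind=> z.
rewrite -[_ + _ in LHS]/(qadd _ _) -[RHS]/(qadd _ _).
by rewrite qaddE !qmulE qaddE mulrDl.
Qed.

HB.instance Definition _ :=
  GRing.Zmodule_isComPzRing.Build quot qmulA qmulC qmul1 qmulD.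

Lemma quot_piB : zmod_morphism quot_pi.
Proof. by move=> x y; rewrite -[RHS]/(qadd _ (qopp _)) qoppE qaddE. Qed.

Lemma quot_piM : monoid_morphism quot_pi.
Proof. by split=> // x y; rewrite -[RHS]/(qmul _ _) qmulE. Qed.

HB.instance Definition _ := GRing.isZmodMorphism.Build R quot quot_pi quot_piB.
HB.instance Definition _ := GRing.isMonoidMorphism.Build R quot quot_pi quot_piM.

End Quotient.

(* The localization of R inverting the elements of W, that is, the fractions
   x / s with s in the multiplicative set generated by W. *)

Section Localization.
Variables (R : comPzRingType) (W : set R).

Definition denom := {s : R | `[< mul_gen W s >]}.
Implicit Types (x y : R) (s t : denom) (f g h : R * denom).

Definition loc_eq f g : bool :=
  `[< exists u : denom, val u * (f.1 * val g.2 - g.1 * val f.2) = 0 >].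

Lemma loc_eqP f g :
  reflect (exists u : denom, val u * (f.1 * val g.2 - g.1 * val f.2) = 0)
          (loc_eq f g).
Proof. exact: asboolP. Qed.

Fact denom1_subproof : `[< mul_gen W 1 >].
Proof. by apply/asboolP; case: (mul_genP W). Qed.

Fact denomM_subproof s t : `[< mul_gen W (val s * val t) >].
Proof.
have [_ WM] := mul_genP W.
by apply/asboolP; apply: WM; apply/asboolP; case: s t => [? ?] [].
Qed.

Definition denom1 : denom := Sub 1 denom1_subproof.
Definition denomM s t : denom := Sub (val s * val t) (denomM_subproof s t).

Lemma val_denom1 : val denom1 = 1. Proof. by []. Qed.

Lemma val_denomM s t : val (denomM s t) = val s * val t. Proof. by []. Qed.

Let denomE := (val_denom1, val_denomM).

Lemma loc_eq_equiv : equiv_class_of loc_eq.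
Proof.
split=> [f|f g|g f h].
- by apply/loc_eqP; exists denom1; rewrite subrr mulr0.
- by apply/loc_eqP/loc_eqP => -[u eu]; exists u; rewrite -opprB mulrN eu oppr0.
- move=> /loc_eqP[u eu] /loc_eqP[v ev]; apply/loc_eqP.
  exists (denomM (denomM u v) g.2); rewrite !denomE.
  transitivity (val v * val h.2 * (val u * (f.1 * val g.2 - g.1 * val f.2))
    + val u * val f.2 * (val v * (g.1 * val h.2 - h.1 * val g.2))); first by ring.
  by rewrite eu ev !mulr0 addr0.
Qed.

Canonical loc_eq_equivRel := EquivRelPack loc_eq_equiv.

Definition localization := {eq_quot loc_eq}.

HB.instance Definition _ : EqQuotient _ loc_eq localization :=
  EqQuotient.on localization.
HB.instance Definition _ := Choice.on localization.

Definition loc_frac x s : localization := \pi_localization (x, s).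

Lemma loc_fracP x s y t :
  loc_frac x s = loc_frac y t <->
  exists u : denom, val u * (x * val t - y * val s) = 0.
Proof. by split=> [/eqmodP/loc_eqP|/(loc_eqP (x, s) (y, t))/eqmodP]. Qed.

Lemma loc_ind (P : localization -> Prop) :
  (forall x s, P (loc_frac x s)) -> forall q, P q.
Proof. by move=> Px; elim/quotW => -[]. Qed.

Let lopp (q : localization) := loc_frac (- (repr q).1) (repr q).2.
Let ladd (q r : localization) :=
  loc_frac ((repr q).1 * val (repr r).2 + (repr r).1 * val (repr q).2)
           (denomM (repr q).2 (repr r).2).
Let lmul (q r : localization) :=
  loc_frac ((repr q).1 * (repr r).1) (denomM (repr q).2 (repr r).2).

Let repr_fracP x s : exists u : denom,
  val u * ((repr (loc_frac x s)).1 * val s - x * val (repr (loc_frac x s)).2) = 0.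
Proof. by apply/loc_fracP; rewrite /loc_frac -surjective_pairing reprK. Qed.

Let loppE x s : lopp (loc_frac x s) = loc_frac (- x) s.
Proof.
apply/loc_fracP; have [u eu] := repr_fracP x s; exists u.
by rewrite -[RHS]oppr0 -eu; ring.
Qed.

Let laddE x s y t : ladd (loc_frac x s) (loc_frac y t) =
  loc_frac (x * val t + y * val s) (denomM s t).
Proof.
apply/loc_fracP.
have [u] := repr_fracP x s; have [v] := repr_fracP y t.
set a := repr (loc_frac x s); set b := repr (loc_frac y t) => ev eu.
exists (denomM u v); rewrite !denomE.
transitivity (val v * val b.2 * val t * (val u * (a.1 * val s - x * val a.2))
  + val u * val a.2 * val s * (val v * (b.1 * val t - y * val b.2))); first by ring.
by rewrite eu ev !mulr0 addr0.
Qed.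

Let lmulE x s y t :
  lmul (loc_frac x s) (loc_frac y t) = loc_frac (x * y) (denomM s t).
Proof.
apply/loc_fracP.
have [u] := repr_fracP x s; have [v] := repr_fracP y t.
set a := repr (loc_frac x s); set b := repr (loc_frac y t) => ev eu.
exists (denomM u v); rewrite !denomE.
transitivity (val v * b.1 * val t * (val u * (a.1 * val s - x * val a.2))
  + val u * x * val a.2 * (val v * (b.1 * val t - y * val b.2))); first by ring.
by rewrite eu ev !mulr0 addr0.
Qed.

Let loc_fracW x s y t : x * val t = y * val s -> loc_frac x s = loc_frac y t.
Proof.
by move=> e; apply/loc_fracP; exists denom1; rewrite e subrr mulr0.
Qed.

Let laddA : associative ladd.
Proof.
elim/loc_ind=> x s; elim/loc_ind=> y t; elim/loc_ind=> z u.
by rewrite !laddE; apply: loc_fracW; rewrite !denomE; ring.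
Qed.
Let laddC : commutative ladd.
Proof.
elim/loc_ind=> x s; elim/loc_ind=> y t.
by rewrite !laddE; apply: loc_fracW; rewrite !denomE; ring.
Qed.
Let ladd0 : left_id (loc_frac 0 denom1) ladd.
Proof.
by elim/loc_ind=> x s; rewrite !laddE; apply: loc_fracW; rewrite !denomE; ring.
Qed.
Let laddN : left_inverse (loc_frac 0 denom1) lopp ladd.
Proof.
by elim/loc_ind=> x s; rewrite loppE laddE; apply: loc_fracW; rewrite !denomE; ring.
Qed.

HB.instance Definition _ :=
  GRing.isZmodule.Build localization laddA laddC ladd0 laddN.

Let lmulA : associative lmul.
Proof.
elim/loc_ind=> x s; elim/loc_ind=> y t; elim/loc_ind=> z u.
by rewrite !lmulE; apply: loc_fracW; rewrite !denomE; ring.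
Qed.
Let lmulC : commutative lmul.
Proof.
elim/loc_ind=> x s; elim/loc_ind=> y t.
by rewrite !lmulE; apply: loc_fracW; rewrite !denomE; ring.
Qed.
Let lmul1 : left_id (loc_frac 1 denom1) lmul.
Proof.
by elim/loc_ind=> x s; rewrite !lmulE; apply: loc_fracW; rewrite !denomE; ring.
Qed.
Let lmulD : left_distributive lmul +%R.
Proof.
elim/loc_ind=> x s; elim/loc_ind=> y t; elim/loc_ind=> z u.
rewrite -[_ + _ in LHS]/(ladd _ _) -[RHS]/(ladd _ _) laddE !lmulE laddE.
by apply: loc_fracW; rewrite !denomE; ring.
Qed.

HB.instance Definition _ :=
  GRing.Zmodule_isComPzRing.Build localization lmulA lmulC lmul1 lmulD.

Lemma loc_fracD x s y t :
  loc_frac x s + loc_frac y t = loc_frac (x * val t + y * val s) (denomM s t).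
Proof. exact: laddE. Qed.

Lemma loc_fracM x s y t :
  loc_frac x s * loc_frac y t = loc_frac (x * y) (denomM s t).
Proof. exact: lmulE. Qed.

End Localization.

(* For P prime, the complement of P is already multiplicatively closed. *)
Definition localization_at (R : comPzRingType) (P : set R) : comPzRingType :=
  localization (~` P).

(* The J-adic completion, i.e. the inverse limit of the R / J ^ i: a compatible
   family is given by representatives u i in R with u (i + 1) = u i modulo
   J ^ i, and two choices of representatives are identified when they agree
   modulo J ^ i for all i. *)

Section Completion.
Variables (R : comPzRingType) (J : set R).

Definition coherent : {pred nat -> R} :=
  fun u => `[< forall i, ideal_exp J i (u i.+1 - u i) >].

Fact coherent_subring_closed : subring_closed coherent.
Proof.
have cE u : reflect (forall i, ideal_exp J i (u i.+1 - u i))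
              (u \in coherent) by exact: asboolP.
split=> [|u v /cE cu /cE cv|u v /cE cu /cE cv]; apply/cE => i; have [g0 gD gM] := ideal_expP J i.
- by rewrite subrr.
- have := gD _ _ (cu i) (gM (-1) _ (cv i)).
  by congr (ideal_exp J i _); rewrite !fctE; ring.
- have := gD _ _ (gM (v i.+1) _ (cu i)) (gM (u i) _ (cv i)).
  by congr (ideal_exp J i _); rewrite !fctE; ring.
Qed.

HB.instance Definition _ :=
  GRing.isSubringClosed.Build (nat -> R) coherent coherent_subring_closed.

Definition coherent_seq := {u : nat -> R | coherent u}.

HB.instance Definition _ := SubChoice.on coherent_seq.

HB.instance Definition _ :=
  GRing.SubChoice_isSubComPzRing.Build _ _ coherent_seq (subringClosedP _).

Definition completion : comPzRingType :=
  quot [set u : coherent_seq | forall i, ideal_exp J i (val u i)].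

End Completion.

Section Rings.
Variable R : comPzRingType.
Implicit Types (m I J : set R) (x : seq R).

Definition noetherian :=
  forall I, is_ideal I -> exists x, I = ideal_gen [set` x].

Definition local_ring m :=
  [/\ noetherian, maximal_ideal m & forall J, maximal_ideal J -> J = m].

Definition prime_chain l := exists P : nat -> set R,
  (forall i, (i <= l)%N -> prime_ideal (P i)) /\
  (forall i, (i < l)%N -> P i `<` P i.+1).

Definition krull_dim d :=
  prime_chain d /\ forall l, prime_chain l -> (l <= d)%N.

Definition regular_seq x :=
  (forall i, (i < size x)%N -> forall a,
     ideal_gen [set` take i x] (x`_i * a) -> ideal_gen [set` take i x] a) /\
  ~ ideal_gen [set` x] 1.

Definition maximal_regular_seq x :=
  regular_seq x /\ forall y, ~ regular_seq (rcons x y).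

(* Meant for local rings, where regular sequences lie in the maximal ideal. *)
Definition depth t :=
  (exists2 x, size x = t & regular_seq x) /\
  forall x, regular_seq x -> (size x <= t)%N.

Definition cohen_macaulay_local :=
  exists m, local_ring m /\ exists2 d, depth d & krull_dim d.

Definition regular_local_ring m :=
  local_ring m /\
  exists2 x, m = ideal_gen [set` x] & krull_dim (size x).

Definition burch_ideal m I :=
  is_ideal I /\ ideal_mul m I <> ideal_mul m (ideal_colon I m).

End Rings.

Definition cohen_macaulay (R : comPzRingType) :=
  noetherian R /\
  forall M : set R, maximal_ideal M -> cohen_macaulay_local (localization_at M).

Definition ring_isomorphic (R R' : comPzRingType) :=
  exists f : {rmorphism R -> R'}, bijective f.

Definition burch_ring (R : comPzRingType) :=
  exists (m : set R) t, [/\ local_ring m, depth R t &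
    exists x : seq (completion m),
      [/\ size x = t, maximal_regular_seq x &
        exists (A : comPzRingType) (n I : set A),
          [/\ regular_local_ring n, burch_ideal n I &
              ring_isomorphic (quot [set` x]) (quot I)]]].

Section Graded.
Variables (k : fieldType) (n : nat).
Local Notation S := {mpoly k[n]}.

Definition irrelevant_ideal : set S := ideal_gen (range (fun i => 'X_i : S)).

Definition homogeneous_ideal (I : set S) :=
  is_ideal I /\ forall f d, I f -> I (pihomog mdeg d f).

(* A minimal graded free resolution of I by modules of finite rank:
   F_i = \bigoplus_j S(- deg i j) is the module of row vectors of length
   [rank i], whose j-th basis vector has degree [deg i j], and the maps act by
   right multiplication.  Since I lives in degrees >= 0, so do the generators
   of all the F_i. *)
Record minimal_graded_resolution (I : set S) := MinimalGradedResolution {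
  rank : nat -> nat;
  deg : forall i, 'I_(rank i) -> nat;
  aug : 'cV[S]_(rank 0);
  diff : forall i, 'M[S]_(rank i.+1, rank i);
  aug_homog : forall j, aug j 0 \is (deg j).-homog;
  diff_homog : forall i j l,
    diff i j l = 0 \/
    exists2 e, deg j = (deg l + e)%N & diff i j l \is e.-homog;
  aug_image : forall f, I f <-> exists v : 'rV_(rank 0), (v *m aug) 0 0 = f;
  aug_exact : forall v : 'rV_(rank 0),
    v *m aug = 0 <-> exists w, v = w *m diff 0;
  diff_exact : forall i (v : 'rV_(rank i.+1)),
    v *m diff i = 0 <-> exists w, v = w *m diff i.+1;
  diff_minimal : forall i j l, irrelevant_ideal (diff i j l)
}.

Definition has_linear_resolution (I : set S) :=
  exists (t : nat) (F : minimal_graded_resolution I),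
    forall i (j : 'I_(rank F i)), deg j = (t + i)%N.

End Graded.

Arguments irrelevant_ideal : clear implicits.

(* Main.v *)
Require Import Defs.
From HB Require Import structures.
From mathcomp Require Import all_boot all_order all_algebra.
From mathcomp Require Import ring zify.
From mathcomp Require Import boolp classical_sets functions cardinality.
From mathcomp Require Import mpoly.

(* For a graded quotient S/J, Koszul homology with respect to the variables
   detects everything that is needed.  The linear resolution, compared with the
   Koszul complex in a double complex, forces the Koszul homology of S/I to
   vanish in coefficient degrees >= T = max(t, 1); a regular sequence of length d
   in the local ring forces it to vanish in exterior degrees > n - d.  Dividing
   by a regular linear form l preserves the first bound and shifts the second
   one by 1.  As long as fewer than d forms have been divided out, the socle
   (top Koszul homology) is therefore zero, so that no maximal annihilator
   contains all linear forms, and a general linear form is again regular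
   because k is infinite.  After d steps the quotient S/J has dimension 0, since
   a regular element lengthens chains of primes, and no socle in degrees >= T,
   so that J contains m^T; as I lies in m^T, J = m^T + (l_1, ..., l_d).

   The elements of the completion are series of forms modulo I, whence
   (l_1, ..., l_d) is a maximal regular sequence there, with quotient
   S/J = k[y_1, ..., y_r]/(y)^T.  With A the localization of k[y] at (y), the
   ideal I_A = (y)^T is Burch, as y_1^T lies in n(I_A : n) but not in n I_A.  For
   r = 0 the quotient is k, which is presented as k[y]/(y) instead, because the
   zero ideal of a field is not Burch. *)

Set Implicit Arguments.
Unset Strict Implicit.
Unset Printing Implicit Defensive.

Import GRing.Theory.
Local Open Scope ring_scope.
Local Open Scope classical_set_scope.

(** * Ideals and noetherian rings *)

(** The degree tracked in Koszul homology is that of the coefficients, not the total degree: the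
    differential and multiplication by a linear form both raise it by one, which is why a bound on
    it survives division by a regular linear form. The constant is max(t, 1) because in exterior and
    coefficient degree 0 the homology of S/I is always k, and because I = 0 has, with all ranks
    zero, a linear resolution for every t, even t = 0. The obstacle is that depth is given in the
    local ring, where regular sequences are not homogeneous, whereas the reduction needs linear
    forms. Koszul homology is the bridge: its vanishing over S/I follows from any regular sequence
    of the localization once denominators are cleared, since a denominator acts on homology through
    its nonzero constant term. [local_model] lists the properties of the localization that enter, so
    that the same lemmas serve R, with the ideal I, and the regular ring A, with the ideal 0. In the
    completion every element is handled through polynomials that represent it modulo powers of the
    maximal ideal, because these have homogeneous components. *)

Section IdealTheory.
Variable R : comPzRingType.
Implicit Types (I J G W : set R) (a x y z : R).

Lemma ideal0 I : is_ideal I -> I 0. Proof. by case. Qed.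

Lemma idealD I x y : is_ideal I -> I x -> I y -> I (x + y).
Proof. by case=> _ + _; apply. Qed.

Lemma idealM I a x : is_ideal I -> I x -> I (a * x).
Proof. by case=> _ _; apply. Qed.

Lemma ideal_mulr I a x : is_ideal I -> I x -> I (x * a).
Proof. by move=> idI Ix; rewrite mulrC; apply: idealM. Qed.

Lemma idealN I x : is_ideal I -> I x -> I (- x).
Proof. by move=> idI /(idealM (-1) idI); rewrite mulN1r. Qed.

Lemma idealB I x y : is_ideal I -> I x -> I y -> I (x - y).
Proof. by move=> idI Ix Iy; apply: idealD => //; apply: idealN. Qed.

Lemma idealBl I x y : is_ideal I -> I x -> I (x - y) -> I y.
Proof. by move=> idI Ix Ixy; rewrite -[y](subKr x); apply: idealB. Qed.

Lemma idealBr I x y : is_ideal I -> I y -> I (x - y) -> I x.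
Proof. by move=> idI Iy Ixy; rewrite -[x](subrK y); apply: idealD. Qed.

Lemma ideal_sum I (T : Type) (r : seq T) (P : pred T) (F : T -> R) :
  is_ideal I -> (forall i, P i -> I (F i)) -> I (\sum_(i <- r | P i) F i).
Proof.
move=> idI IF; elim/big_ind: _ => //; first exact: ideal0.
by move=> x y Ix Iy; apply: idealD.
Qed.

Lemma sub_ideal_gen G : G `<=` ideal_gen G.
Proof. by move=> x Gx J [_]; apply. Qed.

Lemma ideal_gen_sub G I : is_ideal I -> G `<=` I -> ideal_gen G `<=` I.
Proof. by move=> idI GI x; apply. Qed.

Lemma ideal_gen_mono G G' : G `<=` G' -> ideal_gen G `<=` ideal_gen G'.
Proof.
move=> GG'; apply: ideal_gen_sub (ideal_genP _) _.
by apply: subset_trans GG' (@sub_ideal_gen _).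
Qed.

Lemma ideal_gen_id I : is_ideal I -> ideal_gen I = I.
Proof.
by move=> idI; apply/seteqP; split; [apply: ideal_gen_sub|apply: sub_ideal_gen].
Qed.

Lemma ideal_zero : is_ideal [set 0 : R].
Proof.
by split=> [//|x y /= -> ->|a x /= ->]; rewrite ?addr0 ?mulr0.
Qed.

Definition ideal_adjoin I a : set R := [set x | exists y, I (x - a * y)].

Lemma ideal_adjoinP I a : is_ideal I -> is_ideal (ideal_adjoin I a).
Proof.
move=> idI; split=> [|x y [u Iu] [v Iv]|b x [u Iu]].
- by exists 0; rewrite mulr0 subr0; apply: ideal0.
- exists (u + v); have := idealD idI Iu Iv.
  by congr (I _); ring.
- by exists (b * u); have := idealM b idI Iu; congr (I _); ring.
Qed.

Lemma sub_ideal_adjoin I a : is_ideal I -> I `<=` ideal_adjoin I a.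
Proof. by move=> idI x Ix; exists 0; rewrite mulr0 subr0. Qed.

Lemma mem_ideal_adjoin I a : is_ideal I -> ideal_adjoin I a a.
Proof. by move=> idI; exists 1; rewrite mulr1 subrr; apply: ideal0. Qed.

Lemma ideal_adjoin_min I J a : is_ideal J -> I `<=` J -> J a ->
  ideal_adjoin I a `<=` J.
Proof.
move=> idJ IJ Ja x [y /IJ Jy]; apply: (idealBr idJ _ Jy).
exact: ideal_mulr.
Qed.

Lemma ideal_gen_rcons (s : seq R) a :
  ideal_gen [set` rcons s a] = ideal_adjoin (ideal_gen [set` s]) a.
Proof.
have idS := ideal_genP [set` s]; apply/seteqP; split.
  apply: ideal_gen_sub; first exact: ideal_adjoinP.
  move=> x /=; rewrite mem_rcons inE => /orP[/eqP->|xs].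
    exact: mem_ideal_adjoin.
  by apply: sub_ideal_adjoin => //; apply: sub_ideal_gen.
apply: ideal_adjoin_min; first exact: ideal_genP.
  by apply: ideal_gen_mono => x /= xs; rewrite mem_rcons inE xs orbT.
by apply: sub_ideal_gen; rewrite /= mem_rcons mem_head.
Qed.

Lemma ideal_gen_nil : ideal_gen [set` [::] : seq R] = [set 0].
Proof.
apply/seteqP; split; first by apply: ideal_gen_sub ideal_zero _.
by move=> x ->; case: (ideal_genP [set` [::] : seq R]).
Qed.

Section NoetherianSequences.

(** Choice by course of values: the earlier terms are kept in a finite list and shown to [P] as a
    function padded with [t0], hence the demand that [P i] look only at values below i. *)
Lemma dependent_choice_prefix (T : Type) (t0 : T) (P : nat -> (nat -> T) -> T -> Prop) :
  (forall i f g, (forall j, (j < i)%N -> f j = g j) -> forall t, P i f t -> P i g t) ->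
  (forall i f, exists t, P i f t) ->
  exists f, forall i, P i f (f i).
Proof.
move=> Pext Pex.
have [nxt nxtP] : {nxt : nat * (nat -> T) -> T & forall p, P p.1 p.2 (nxt p)}.
  by apply: (@choice _ _ (fun p t => P p.1 p.2 t)) => p; apply: Pex.
pose next i f := nxt (i, f).
have nextP i f : P i f (next i f) by exact: (nxtP (i, f)).
pose fix seqs i := if i is i'.+1 then rcons (seqs i') (next i' (nth t0 (seqs i')))
  else [::].
have szs i : size (seqs i) = i by elim: i => //= i IH; rewrite size_rcons IH.
pose f i := next i (nth t0 (seqs i)).
have fE i j : (j < i)%N -> nth t0 (seqs i) j = f j.
  elim: i => //= i IH; rewrite ltnS nth_rcons szs leq_eqVlt => /orP[/eqP->|ji].
    by rewrite ltnn eqxx.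
  by rewrite ji IH.
by exists f => i; apply: Pext (nextP i _) => j ji; rewrite fE.
Qed.

Definition noetherian_seq := forall a : nat -> R,
  exists i, ideal_gen [set a j | j in [set j | (j < i)%N]] (a i).

Lemma noetherian_stable (a : nat -> R) : noetherian R ->
  exists N, forall i, ideal_gen [set a j | j in [set j | (j < N)%N]] (a i).
Proof.
move=> noeR.
pose A i := [set a j | j in [set j | (j < i)%N]].
have [x Ex] := noeR _ (ideal_genP (range a)).
have AS i j : (i <= j)%N -> ideal_gen (A i) `<=` ideal_gen (A j).
  move=> ij; apply: ideal_gen_mono => _ [l /= li <-].
  by exists l => //=; apply: leq_trans li ij.
have inA y : ideal_gen (range a) y -> exists i, ideal_gen (A i) y.
  apply: (@ideal_gen_sub _ [set y | exists i, ideal_gen (A i) y]) => [|_ [i _ <-]].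
    split=> [|u v [i yi] [j zj]|b u [i yi]].
    - by exists 0%N; exact: (ideal0 (ideal_genP _)).
    - exists (maxn i j); apply: (idealD (ideal_genP _)).
        exact: (AS i _ (leq_maxl _ _)).
      exact: (AS j _ (leq_maxr _ _)).
    - by exists i; apply: (idealM _ (ideal_genP _)).
  by exists i.+1; apply: sub_ideal_gen; exists i => /=.
have [N AN] : exists N, {in x, forall y, ideal_gen (A N) y}.
  have : {in x, forall y, ideal_gen (range a) y}.
    by move=> y yx; rewrite Ex; apply: sub_ideal_gen.
  elim: (x) => [|y s IHs] xa; first by exists 0%N.
  have [N AN] : exists N, {in s, forall y, ideal_gen (A N) y}.
    by apply: IHs => z zs; apply: xa; rewrite inE zs orbT.
  have [M AM] := inA y (xa _ (mem_head _ _)).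
  exists (maxn N M) => z; rewrite inE => /orP[/eqP->|zs].
    exact: (AS M _ (leq_maxr _ _)).
  exact: (AS N _ (leq_maxl _ _) _ (AN _ zs)).
exists N => i; have : ideal_gen (range a) (a i) by apply: sub_ideal_gen; exists i.
by rewrite Ex; apply: ideal_gen_sub; first exact: ideal_genP.
Qed.

Lemma noetherianP : noetherian R <-> noetherian_seq.
Proof.
split=> [noeR a|seqR I idI].
  by have [N aN] := noetherian_stable a noeR; exists N.
apply: contrapT => nfg.
(* The guard on the earlier terms makes [P] satisfiable for every prefix, as dependent choice
   demands; the first half of [P] discharges it along the sequence obtained. *)
pose P i (f : nat -> R) t :=
  I t /\ ((forall j, (j < i)%N -> I (f j)) ->
    ~ ideal_gen [set f j | j in [set j | (j < i)%N]] t).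
have [|i f|f Pf] := @dependent_choice_prefix R 0 P.
- move=> i f g fg t [It nt]; split=> // gI.
  have -> : [set g j | j in [set j | (j < i)%N]] = [set f j | j in [set j | (j < i)%N]].
    by apply/seteqP; split=> _ [j /= ji <-]; exists j => //; rewrite fg.
  by apply: nt => j ji; rewrite fg //; apply: gI.
- have [fI|fI] := pselect (forall j, (j < i)%N -> I (f j)); last first.
    by exists 0; split=> //; apply: ideal0.
  apply: contrapT => nP; apply: nfg; exists (map f (iota 0 i)).
  have fE : [set` map f (iota 0 i)] = [set f j | j in [set j | (j < i)%N]].
    apply/seteqP; split=> [_ /= /mapP[j + ->]|_ [j /= ji <-]].
      by rewrite mem_iota /= => ji; exists j.
    by apply/mapP; exists j; rewrite // mem_iota.
  rewrite fE; apply/seteqP; split=> [t It|].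
    by apply: contrapT => nt; apply: nP; exists t.
  by apply: ideal_gen_sub => // _ [j /= ji <-]; apply: fI.
have [i] := seqR f; case: (Pf i) => _; apply => j _.
by case: (Pf j).
Qed.

Lemma noetherian_maximal (F : set R -> Prop) J : noetherian R ->
    (forall I, F I -> is_ideal I) -> F J ->
  exists M, [/\ F M, J `<=` M & forall M', F M' -> M `<=` M' -> M' `<=` M].
Proof.
move=> /noetherianP seqR Fid FJ; apply: contrapT => nM.
pose T := {I : set R | F I /\ J `<=` I}.
have next (I : T) : exists I' : T, sval I `<` sval I'.
  case: I => I [FI JI] /=; apply: contrapT => nI; apply: nM; exists I; split=> //.
  move=> M FM IM; apply: contrapT => nMI; apply: nI.
  have JM : J `<=` M by apply: subset_trans IM.
  by exists (exist _ M (conj FM JM)).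
have [nx nxP] := choice next.
pose f i := iter i nx (exist _ J (conj FJ (@subset_refl _ J)) : T).
have fi i : sval (f i) `<` sval (f i.+1) by apply: nxP.
have fS i j : (i <= j)%N -> sval (f i) `<=` sval (f j).
  elim: j => [|j IHj]; first by rewrite leqn0 => /eqP->.
  rewrite leq_eqVlt => /orP[/eqP-> //|ij].
  by apply: subset_trans (IHj ij) _; case: (fi j).
have /choice[a aP] i : exists x, sval (f i.+1) x /\ ~ sval (f i) x.
  have [_ /existsNP[x /not_implyP]] := fi i; by exists x.
have [i ai] := seqR a; case: (aP i) => _; apply.
apply: (ideal_gen_sub _ _ ai) => [|_ [j /= ji <-]].
  by case: (f i) => I [FI _] /=; apply: Fid.
by apply: (fS j.+1); rewrite //; case: (aP j).
Qed.

(** An ideal maximal among those avoiding W is prime: adjoining either of two elements outside it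
    would bring in an element of W, and the product of these two elements of W would fall into the
    ideal. *)
Lemma prime_avoiding J W : noetherian R -> is_ideal J -> mul_closed W ->
    (forall x, J x -> ~ W x) ->
  exists P, [/\ prime_ideal P, J `<=` P & forall x, P x -> ~ W x].
Proof.
move=> noeR idJ [W1 WM] JW.
pose F I := is_ideal I /\ forall x, I x -> ~ W x.
have [||P [[idP PW] JP maxP]] := @noetherian_maximal F J noeR.
- by move=> I [].
- by [].
exists P; split=> //; split=> // [P1|x y Pxy]; first exact: PW P1 W1.
apply: contrapT => /not_orP[Px Py].
have adj z : ~ P z -> exists2 w, ideal_adjoin P z w & W w.
  move=> Pz; apply: contrapT => nw; apply: Pz.
  apply: (maxP (ideal_adjoin P z)); last exact: mem_ideal_adjoin.
    by split=> [|w zw Ww]; [apply: ideal_adjoinP|apply: nw; exists w].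
  exact: sub_ideal_adjoin.
have [w [u Pwu] Ww] := adj _ Px; have [v [t Pvt] Wv] := adj _ Py.
apply: (PW (w * v)); last exact: WM.
have e : w * v = (w - x * u) * v + x * u * (v - y * t) + (x * y) * (u * t) by ring.
rewrite e; apply: idealD => //; last exact: ideal_mulr.
by apply: idealD => //; [apply: ideal_mulr|apply: idealM].
Qed.

End NoetherianSequences.
End IdealTheory.

Lemma surj_noetherian (R R' : comPzRingType) (f : {rmorphism R -> R'}) :
  (forall y, exists x, f x = y) -> noetherian R -> noetherian R'.
Proof.
move=> fsurj noeR I idI.
have idJ : is_ideal (f @^-1` I).
  split=> [|x y|a x] /=; first by rewrite rmorph0; apply: ideal0.
    by rewrite rmorphD; apply: idealD.
  by rewrite rmorphM; apply: idealM.
have [x Ex] := noeR _ idJ; exists (map f x); apply/seteqP; split=> [y Iy|].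
  have [u fu] := fsurj y; rewrite -fu in Iy *.
  have : ideal_gen [set` x] u by rewrite -Ex.
  apply: (@ideal_gen_sub _ _ [set u | ideal_gen [set` map f x] (f u)]).
    have idg := ideal_genP [set` map f x].
    split=> [|a b|a b] /=; first by rewrite rmorph0; exact: (ideal0 idg).
      by rewrite rmorphD; apply: (idealD idg).
    by rewrite rmorphM; apply: (idealM _ idg).
  by move=> v /= vx; apply: sub_ideal_gen; apply: map_f.
apply: ideal_gen_sub => // _ /= /mapP[u ux ->].
have : ideal_gen [set` x] u by apply: sub_ideal_gen.
by rewrite -Ex.
Qed.

(** Hilbert's basis theorem: f i has the least size among the elements of I outside the ideal of the
    earlier terms, and a relation between leading coefficients would produce a smaller one. *)
Lemma poly_noetherian (R : comNzRingType) : noetherian R -> noetherian {poly R}.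
Proof.
move=> /noetherianP seqR I idI; apply: contrapT => nfg.
pose In (f : nat -> {poly R}) i := ideal_gen [set f j | j in [set j | (j < i)%N]].
pose P i (f : nat -> {poly R}) t := (forall j, (j < i)%N -> I (f j)) ->
  [/\ I t, ~ In f i t & forall u, I u -> ~ In f i u -> (size t <= size u)%N].
have [|i f|f Pf] := @dependent_choice_prefix _ 0 P.
- move=> i f g fg t Pf gI.
  have InE : In g i = In f i.
    congr ideal_gen.
    by apply/seteqP; split=> _ [j /= ji <-]; exists j => //; rewrite fg.
  by rewrite InE; apply: Pf => j ji; rewrite fg //; apply: gI.
- have [fI|fI] := pselect (forall j, (j < i)%N -> I (f j)); last by exists 0.
  have [u [Iu nu]] : exists u, I u /\ ~ In f i u.
    apply: contrapT => nP; apply: nfg; exists (map f (iota 0 i)).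
    have fE : [set` map f (iota 0 i)] = [set f j | j in [set j | (j < i)%N]].
      apply/seteqP; split=> [_ /= /mapP[j + ->]|_ [j /= ji <-]].
        by rewrite mem_iota /= => ji; exists j.
      by apply/mapP; exists j; rewrite // mem_iota.
    rewrite fE; apply/seteqP; split=> [t It|].
      by apply: contrapT => nt; apply: nP; exists t.
    by apply: ideal_gen_sub => // _ [j /= ji <-]; apply: fI.
  have ex : exists s, `[< exists u, [/\ I u, ~ In f i u & size u = s] >].
    by exists (size u); apply/asboolP; exists u.
  case: (ex_minnP ex) => s /asboolP[t [It nt ts]] mins.
  exists t => _; split=> // v Iv nv; rewrite ts; apply: mins.
  by apply/asboolP; exists v.
have fI i : I (f i).
  elim: i {-2}i (leqnn i) => [|i IHi] j ji.
    by move: ji; rewrite leqn0 => /eqP->; case: (Pf 0%N).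
  by case: (Pf j) => // l lj; apply: IHi; rewrite -ltnS; apply: leq_trans lj ji.
have {}Pf i : [/\ I (f i), ~ In f i (f i) &
    forall u, I u -> ~ In f i u -> (size (f i) <= size u)%N] by apply: Pf.
have szf i j : (i <= j)%N -> (size (f i) <= size (f j))%N.
  move=> ij; case: (Pf i) => _ _; apply=> // fj; case: (Pf j) => _ + _; apply.
  apply: ideal_gen_mono fj => _ [l /= li <-]; exists l => //=.
  exact: leq_trans li ij.
have [i ai] := seqR (lead_coef \o f).
(* The coefficient is read at the fixed position of the leading term of [f i], even where g is
   shorter, so that the values form an ideal. *)
pose Q a := exists2 g, In f i g & [/\ (size g <= size (f i))%N &
  g`_(size (f i)).-1 = a].
have : Q (lead_coef (f i)).
  apply: (ideal_gen_sub _ _ ai) => [|_ [j /= ji <-]].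
    have idg := ideal_genP [set f j | j in [set j | (j < i)%N]].
    split=> [|x y [g Ig [sg <-]] [h Ih [sh <-]]|x y [g Ig [sg <-]]].
    - by exists 0; [exact: (ideal0 idg)|rewrite size_poly0 coef0].
    - exists (g + h); first exact: (idealD idg).
      split; last by rewrite coefD.
      by rewrite (leq_trans (size_polyD _ _)) // geq_max sg sh.
    - exists (x%:P * g); first exact: (idealM _ idg).
      split; last by rewrite coefCM.
      rewrite mul_polyC; exact: leq_trans (size_scale_leq _ _) sg.
  have sij := szf _ _ (ltnW ji).
  have [fj0|fj0] := eqVneq (f j) 0.
    exists 0; first exact: (ideal0 (ideal_genP _)).
    by rewrite size_poly0 coef0 fj0 lead_coef0.
  exists ('X^(size (f i) - size (f j)) * f j).
    apply: (idealM _ (ideal_genP _)).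
    by apply: sub_ideal_gen; exists j.
  have sj : (0 < size (f j))%N by rewrite size_poly_gt0.
  split; first by rewrite mulrC size_mulXn // subnK.
  rewrite coefXnM ifF; last first.
    by apply/negbTE; rewrite -leqNgt; lia.
  by rewrite lead_coefE; congr (f j)`_ _; lia.
case=> g Ig [sg eg]; case: (Pf i) => Ii nIi min.
have fi0 : f i != 0.
  by apply: contra_notN nIi => /eqP->; exact: (ideal0 (ideal_genP _)).
have nIg : ~ In f i (f i - g).
  by move=> nI; apply: nIi; exact: (idealBr (ideal_genP _) Ig nI).
suff : ~ (size (f i) <= size (f i - g)%R)%N.
  apply; apply: min nIg.
  apply: idealB => //; apply: (ideal_gen_sub idI _ Ig) => _ [j _ <-].
  exact: fI.
apply/negP; rewrite -ltnNge.
have spos : (0 < size (f i))%N by rewrite size_poly_gt0.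
rewrite -[size (f i)]prednK // ltnS; apply/leq_sizeP => j.
rewrite leq_eqVlt => /orP[/eqP<-|ij].
  by rewrite coefB eg lead_coefE subrr.
have {}ij : (size (f i) <= j)%N by rewrite -[size _]prednK.
by rewrite coefB !nth_default ?subrr //; apply: leq_trans sg _.
Qed.

Lemma field_noetherian (k : fieldType) : noetherian k.
Proof.
move=> I idI; have [[x Ix x0]|nI] := pselect (exists2 x, I x & x != 0).
  exists [:: 1]; apply/seteqP; split=> [y _|].
    rewrite -[y]mulr1; apply: (idealM _ (ideal_genP _)).
    by apply: sub_ideal_gen; rewrite /= inE.
  apply: ideal_gen_sub => // y /=; rewrite inE => /eqP->.
  by rewrite -(mulVf x0); apply: idealM.
exists [::]; rewrite ideal_gen_nil; apply/seteqP; split=> [x Ix|x ->].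
  by apply: contrapT => /eqP x0; apply: nI; exists x.
exact: ideal0.
Qed.

(** Surjectivity suffices to transport noetherianity, so the univariate polynomials over k[n] are
    mapped onto k[n+1] by sending the new variable to the last one. *)
Lemma mpoly_noetherian (k : fieldType) n : noetherian {mpoly k[n]}.
Proof.
elim: n => [|n IHn].
  pose C : {rmorphism k -> {mpoly k[0]}} := @mpolyC 0 k.
  apply: (surj_noetherian (f := C)); last exact: field_noetherian.
  move=> p; exists p@_0%MM; apply/mpolyP => m; rewrite mcoeffC.
  have -> : m = 0%MM by apply/mnmP => -[].
  by rewrite eqxx mulr1.
pose f (p : {poly {mpoly k[n]}}) : {mpoly k[n.+1]} :=
  (map_poly (@mwiden n k) p).['X_ord_max].
have fB : zmod_morphism f by move=> p q; rewrite /f rmorphB hornerD hornerN.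
have fM : monoid_morphism f.
  split=> [|p q]; first by rewrite /f rmorph1 hornerC.
  by rewrite /f rmorphM hornerM.
pose Af := GRing.isZmodMorphism.Build _ _ f fB.
pose Mf := GRing.isMonoidMorphism.Build _ _ f fM.
pose F : {rmorphism {poly {mpoly k[n]}} -> {mpoly k[n.+1]}} :=
  HB.pack f Af Mf.
apply: (surj_noetherian (f := F)); last exact: poly_noetherian.
move=> p; elim/mpolyind: p => [|c m p _ _ [q <-]]; first by exists 0; rewrite rmorph0.
suff [r <-] : exists r, F r = 'X_[m].
  exists (c%:MP%:P * r + q); rewrite rmorphD rmorphM -mul_mpolyC.
  congr (_ * _ + _).
  by rewrite -[LHS]/((map_poly _ _).[_]) map_polyC hornerC /= mwidenC.
rewrite mpolyXE_id; elim/big_ind: _ => [|u v [a <-] [b <-]|i _].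
- by exists 1; rewrite rmorph1.
- by exists (a * b); rewrite rmorphM.
suff [r <-] : exists r, F r = 'X_i by exists (r ^+ m i); rewrite rmorphXn.
have [j ->|->] := unliftP ord_max i.
  exists ('X_j)%:P; rewrite -[LHS]/((map_poly _ _).[_]) map_polyC hornerC /=.
  rewrite mwidenX mnmwiden1; congr 'X_[U_(_)]; apply: val_inj => /=.
  by rewrite /bump leqNgt ltn_ord.
by exists 'X; rewrite -[LHS]/((map_poly _ _).[_]) map_polyX hornerX.
Qed.

Lemma quot_pi_eq0 (R : comPzRingType) (G : set R) x :
  quot_pi G x = 0 <-> ideal_gen G x.
Proof.
rewrite -[0](rmorph0 (quot_pi G)); split=> [/quot_piP|Gx]; last apply/quot_piP.
  by rewrite subr0.
by rewrite subr0.
Qed.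

(** * Koszul complexes *)

Section Koszul.
Variables (n : nat) (R : comPzRingType) (x : 'I_n -> R).
Implicit Types (i j : 'I_n) (A B : {set 'I_n}).

(** The number of transpositions that bring e_i to its place in the product of e_i and e_A. *)
Definition ksgn (i : 'I_n) (A : {set 'I_n}) : nat := #|[set a in A | (a < i)%N]|.

Lemma ksgnU i j A : j \notin A -> ksgn i (j |: A) = ((j < i) + ksgn i A)%N.
Proof.
move=> jA; rewrite /ksgn; have [ji|ji] := ltnP j i.
  have -> : [set a in j |: A | (a < i)%N] = j |: [set a in A | (a < i)%N].
    by apply/setP => a; rewrite !inE; case: eqVneq => // ->; rewrite ji.
  by rewrite cardsU1 inE (negbTE jA).
by apply: eq_card => a; rewrite !inE; case: eqVneq => // ->; rewrite ltnNge ji !andbF.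
Qed.

Lemma ksgnD i A : ksgn i (A :\ i) = ksgn i A.
Proof.
by apply: eq_card => a; rewrite !inE; case: eqVneq => // ->; rewrite ltnn !andbF.
Qed.

Section Operators.
Variable V : lmodType R.
Implicit Types (z w : {set 'I_n} -> V).

(* With z A the coefficient of the exterior monomial e_A, contraction by the
   i-th basis vector, and exterior multiplication by it. *)
Definition contr i z A : V := if i \in A then 0 else (-1) ^+ ksgn i A *: z (i |: A).
Definition extmul i z A : V := if i \in A then (-1) ^+ ksgn i A *: z (A :\ i) else 0.

Definition koszul z A : V := \sum_i x i *: contr i z A.

Lemma signrZK (m : nat) (v : V) : (-1) ^+ m *: ((-1) ^+ m *: v) = v.
Proof. by rewrite scalerA -exprMn mulrNN mulr1 expr1n scale1r. Qed.

Lemma contrC i j z A : contr i (contr j z) A = - contr j (contr i z) A.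
Proof.
rewrite /contr !finset.in_setU1; have [<-|ij] := eqVneq i j.
  by rewrite /=; case: ifP; rewrite ?scaler0 oppr0.
rewrite ?[j == i]eq_sym ?(negbTE ij) /=.
case: ifPn => iA; case: ifPn => jA; rewrite ?scaler0 ?oppr0 //.
rewrite !ksgnU // finset.setUCA !scalerA -scaleNr; congr (_ *: _).
rewrite !exprD; case: (ltngtP i j) ij => [||/val_inj->]; rewrite ?eqxx //= => _ _.
  by rewrite expr1 expr0; ring.
by rewrite expr1 expr0; ring.
Qed.

(** The canonical anticommutation relation: for distinct indices, inserting one and removing the
    other in the two possible orders differs by a single transposition. *)
Lemma contr_extmul i j z A :
  contr i (extmul j z) A + extmul j (contr i z) A = if i == j then z A else 0.
Proof.
rewrite /contr /extmul !finset.in_setU1; have [<-|ji] := eqVneq i j.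
  rewrite /= finset.in_setD1 eqxx; case: ifPn => iA /=.
    by rewrite add0r ksgnD signrZK finset.setD1K.
  by rewrite ksgnU // ltnn add0n signrZK finset.setU1K // addr0.
rewrite /= finset.in_setD1 ji /=.
case: ifPn => iA; case: ifPn => jA; rewrite ?scaler0 ?addr0 //.
have e : i |: A :\ j = (i |: A) :\ j.
  apply/setP => a; rewrite !inE; case: eqVneq => //= ->.
  by rewrite (negbTE ji).
have jA' : j \notin A :\ j by rewrite finset.setD11.
rewrite !ksgnU // e !scalerA -scalerDl -[A in ksgn i A](finset.setD1K jA) ksgnU //.
rewrite !exprD [X in X *: _](_ : _ = 0) ?scale0r //.
case: (ltngtP i j) ji => [||/val_inj->]; rewrite ?eqxx //= => _ _.
  by rewrite expr1 expr0; ring.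
by rewrite expr1 expr0; ring.
Qed.

Lemma contr_sum i (I : Type) (r : seq I) (P : pred I) (F : I -> {set 'I_n} -> V) A :
  contr i (fun B => \sum_(j <- r | P j) F j B) A = \sum_(j <- r | P j) contr i (F j) A.
Proof.
rewrite /contr; case: ifP => _; first by rewrite big1.
by rewrite scaler_sumr.
Qed.

Lemma extmul_sum i (I : Type) (r : seq I) (P : pred I) (F : I -> {set 'I_n} -> V) A :
  extmul i (fun B => \sum_(j <- r | P j) F j B) A = \sum_(j <- r | P j) extmul i (F j) A.
Proof.
rewrite /extmul; case: ifP => _; last by rewrite big1.
by rewrite scaler_sumr.
Qed.

Lemma contrZ i a z A : contr i (fun B => a *: z B) A = a *: contr i z A.
Proof. by rewrite /contr; case: ifP; rewrite ?scaler0 // !scalerA mulrC. Qed.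

Lemma extmulZ i a z A : extmul i (fun B => a *: z B) A = a *: extmul i z A.
Proof. by rewrite /extmul; case: ifP; rewrite ?scaler0 // !scalerA mulrC. Qed.

Lemma koszulB z w A : koszul (fun B => z B - w B) A = koszul z A - koszul w A.
Proof.
rewrite /koszul -sumrB; apply: eq_bigr => i _; rewrite -scalerBr; congr (_ *: _).
by rewrite /contr; case: ifP => _; rewrite ?subr0 // scalerBr.
Qed.

Lemma koszulD z w A : koszul (fun B => z B + w B) A = koszul z A + koszul w A.
Proof.
rewrite /koszul -big_split /=; apply: eq_bigr => i _; rewrite -scalerDr; congr (_ *: _).
by rewrite /contr; case: ifP => _; rewrite ?addr0 // scalerDr.
Qed.

Lemma koszulZ a z A : koszul (fun B => a *: z B) A = a *: koszul z A.
Proof.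
rewrite /koszul scaler_sumr; apply: eq_bigr => i _.
by rewrite contrZ !scalerA mulrC.
Qed.

Lemma koszul_sum (I : Type) (r : seq I) (F : I -> {set 'I_n} -> V) A :
  koszul (fun B => \sum_(j <- r) F j B) A = \sum_(j <- r) koszul (F j) A.
Proof.
rewrite /koszul exchange_big; apply: eq_bigr => i _.
by rewrite contr_sum scaler_sumr.
Qed.

Lemma eq_koszul z w A : (forall B, z B = w B) -> koszul z A = koszul w A.
Proof. by move=> e; congr koszul; apply: functional_extensionality_dep. Qed.

(** The diagonal has a hypothesis of its own because 2 may be a zero divisor, in which case
    antisymmetry does not make it vanish. *)
Lemma alternating_sum0 (I : Type) (r : seq I) (G : I -> I -> V) :
  (forall a, G a a = 0) -> (forall a b, G a b = - G b a) ->
  \sum_(a <- r) \sum_(b <- r) G a b = 0.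
Proof.
move=> G0 GN; elim: r => [|a r IHr]; first by rewrite big_nil.
rewrite big_cons; under [X in _ + X]eq_bigr do rewrite big_cons.
rewrite big_split /= IHr addr0 big_cons G0 add0r -big_split /=.
by apply: big1 => i _; rewrite GN addNr.
Qed.

Lemma koszul_koszul z A : koszul (koszul z) A = 0.
Proof.
rewrite /koszul; under eq_bigr do rewrite contr_sum scaler_sumr.
under eq_bigr do under eq_bigr do rewrite contrZ scalerA.
apply: alternating_sum0 => [i|i j]; last by rewrite contrC mulrC scalerN.
rewrite /contr; case: ifP => // _; first by rewrite scaler0.
by rewrite finset.setU11 !scaler0.
Qed.

(** Multiplication by x_j is null-homotopic on the Koszul complex; [koszul_homotopy] extends this to
    every polynomial without constant term. *)
Lemma koszul_extmul j z A :
  koszul (extmul j z) A + extmul j (koszul z) A = x j *: z A.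
Proof.
rewrite /koszul extmul_sum -big_split /= (bigD1 j) //= extmulZ -scalerDr.
rewrite contr_extmul eqxx big1 ?addr0 // => i ij.
by rewrite extmulZ -scalerDr contr_extmul (negbTE ij) scaler0.
Qed.

Lemma koszul0 A : koszul (fun=> 0) A = 0.
Proof.
by rewrite /koszul big1 // => i _; rewrite /contr; case: ifP; rewrite !scaler0.
Qed.

Definition extdeg p z := forall A, #|A| != p -> z A = 0.

Lemma extdeg_koszul p z : extdeg p.+1 z -> extdeg p (koszul z).
Proof.
move=> zp A Ap; rewrite /koszul big1 // => i _; rewrite /contr.
by case: ifPn => iA; rewrite ?scaler0 // zp ?scaler0 // cardsU1 iA eqSS.
Qed.

Lemma extdeg_extmul p i z : extdeg p z -> extdeg p.+1 (extmul i z).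
Proof.
move=> zp A Ap; rewrite /extmul; case: ifPn => // iA.
by rewrite zp ?scaler0 // -eqSS -[(#|A :\ i|).+1]/((true + #|A :\ i|)%N) -{1}iA -cardsD1.
Qed.

Lemma extdegB p z w : extdeg p z -> extdeg p w -> extdeg p (fun A => z A - w A).
Proof. by move=> zp wp A Ap; rewrite zp // wp // subr0. Qed.

Lemma extdeg0_koszul z A : extdeg 0 z -> koszul z A = 0.
Proof.
move=> z0; rewrite /koszul big1 // => i _; rewrite /contr.
by case: ifP => iA; rewrite ?scaler0 // z0 ?scaler0 // cardsU1 iA.
Qed.

Definition extcomp p z A := if #|A| == p then z A else 0.

Lemma extcompP p z : extdeg p (extcomp p z).
Proof. by move=> A /negbTE; rewrite /extcomp => ->. Qed.

Lemma koszul_extcomp p z A : koszul (extcomp p.+1 z) A = extcomp p (koszul z) A.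
Proof.
rewrite /koszul /extcomp; case: eqP => Ap; last first.
  rewrite big1 // => i _; rewrite /contr; case: ifPn => iA; rewrite ?scaler0 //.
  by rewrite cardsU1 iA eqSS; case: eqP => //; rewrite !scaler0.
apply: eq_bigr => i _; rewrite /contr; case: ifPn => // iA.
by rewrite cardsU1 iA Ap eqxx.
Qed.

Lemma koszul_set0 w : koszul w finset.set0 = \sum_i x i *: w (finset.set1 i).
Proof.
apply: eq_bigr => i _; rewrite /contr finset.in_set0 finset.setU0.
rewrite [ksgn _ _](_ : _ = 0%N) ?expr0 ?scale1r //.
by apply: eq_card0 => a; rewrite !inE.
Qed.

(* If the multiplications by the [x i] have compatible left inverses [D i], the
   Koszul complex is contracted one variable at a time by the maps
   [D m \o extmul m]. *)
Section Exactness.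
Variable D : 'I_n -> V -> V.
Hypothesis DB : forall m, zmod_morphism (D m).
Hypothesis Dx : forall m i v, D m (x i *: v) = if i == m then v else x i *: D m v.

Let DA m := GRing.isZmodMorphism.Build V V (D m) (DB m).
Let DD m : {additive V -> V} := HB.pack (D m) (DA m).

Let D0 m : D m 0 = 0. Proof. exact: (raddf0 (DD m)). Qed.
Let DN m v : D m (- v) = - D m v. Proof. exact: (raddfN (DD m)). Qed.
Let DaddE m (v w : V) : D m (v + w) = D m v + D m w. Proof. exact: (raddfD (DD m)). Qed.
Let Dsum m (I : Type) (r : seq I) (P : pred I) (F : I -> V) :
  D m (\sum_(j <- r | P j) F j) = \sum_(j <- r | P j) D m (F j).
Proof. exact: (raddf_sum (DD m)). Qed.
Let DZs m (s : nat) v : D m ((-1) ^+ s *: v) = (-1) ^+ s *: D m v.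
Proof.
by rewrite -signr_odd; case: odd; rewrite ?expr1 ?expr0 ?scaleN1r ?scale1r // DN.
Qed.

Lemma koszul_contraction m z A :
  koszul (fun B => D m (extmul m z B)) A + D m (extmul m (koszul z) A) =
  if m \in A then z A else x m *: D m (z A).
Proof.
have cD i : contr i (fun B => D m (extmul m z B)) A = D m (contr i (extmul m z) A).
  by rewrite /contr; case: ifP; rewrite ?D0 // DZs.
rewrite /koszul extmul_sum Dsum -big_split /= (bigD1 m) //=.
rewrite big1 ?addr0 => [|i im]; last first.
  rewrite extmulZ Dx (negbTE im) cD -scalerDr -DaddE.
  by rewrite contr_extmul (negbTE im) D0 scaler0.
rewrite extmulZ Dx eqxx cD; have := contr_extmul m m z A; rewrite eqxx.
rewrite /contr /extmul; case: ifPn => mA; last by rewrite !addr0 => ->.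
by rewrite D0 scaler0 !add0r.
Qed.

(** By [koszul_contraction], subtracting the boundary of [D m (extmul m z)] kills the components z A
    with m in A. The other components become z A - x_m D_m (z A), so those already zero stay zero,
    and after all variables only the component at the empty set is left. *)
Lemma koszul_exact z : (forall A, koszul z A = 0) ->
  exists w, forall A, A != finset.set0 -> z A = koszul w A.
Proof.
move=> dz.
have step (s : seq 'I_n) : exists w z', [/\ forall B, z' B = z B - koszul w B,
    forall A, koszul z' A = 0 & forall m A, m \in s -> m \in A -> z' A = 0].
  elim: s => [|m s [w [z' [Ez' dz' z'0]]]].
    exists (fun=> 0), z; split=> // B.
    by rewrite koszul0 subr0.
  exists (fun B => w B + D m (extmul m z' B)).
  exists (fun B => z' B - koszul (fun B => D m (extmul m z' B)) B).
  split=> [B|A|i A].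
  - by rewrite koszulD Ez' opprD addrA.
  - by rewrite koszulB koszul_koszul dz' subr0.
  have -> : koszul (fun B => D m (extmul m z' B)) A =
      if m \in A then z' A else x m *: D m (z' A).
    rewrite -koszul_contraction [extmul m (koszul z') A](_ : _ = 0) ?D0 ?addr0 //.
    by rewrite /extmul dz' scaler0; case: ifP.
  rewrite inE => /orP[/eqP->|si] iA; first by rewrite iA subrr.
  by rewrite (z'0 i) //; case: ifP; rewrite ?D0 ?scaler0 subr0.
have [w [z' [Ez' _ w0]]] := step (enum 'I_n); exists w => A /finset.set0Pn[i iA].
by apply/eqP; rewrite -subr_eq0 -Ez'; apply/eqP/(w0 i); rewrite ?mem_enum.
Qed.

Lemma koszul_exact_deg p z : extdeg p.+1 z -> (forall A, koszul z A = 0) ->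
  exists2 w, extdeg p.+2 w & forall A, z A = koszul w A.
Proof.
move=> zp /koszul_exact[w Ew]; exists (extcomp p.+2 w); first exact: extcompP.
move=> A; rewrite koszul_extcomp /extcomp; case: eqP => [Ap|/eqP/zp->//].
by apply: Ew; rewrite -finset.card_gt0 Ap.
Qed.

End Exactness.
End Operators.

Lemma koszul_lin (V W : lmodType R) (f : {linear V -> W}) (z : {set 'I_n} -> V) A :
  koszul (fun B => f (z B)) A = f (koszul z A).
Proof.
rewrite /koszul linear_sum; apply: eq_bigr => i _; rewrite linearZ /=.
by rewrite /contr; case: ifP => _; rewrite ?linear0 // [f (_ *: _)]linearZ.
Qed.

End Koszul.

(** * Orders and homogeneous components of polynomials *)

Section PolynomialOrder.
Variables (k : fieldType) (n : nat).
Local Notation S := {mpoly k[n]}.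
Implicit Types (f g h : S) (m : 'X_{1..n}) (I J : set S).

Lemma mcoeff_pihomog d f m :
  (pihomog mdeg d f)@_m = if mdeg m == d then f@_m else 0.
Proof.
rewrite pihomogE raddf_sum /= big_mkcond /=.
have -> : (if mdeg m == d then f@_m else 0) = \sum_(m' <- msupp f)
    (if mdeg m' == d then f@_m' * (m' == m)%:R else 0).
  have [mf|mf] := boolP (m \in msupp f).
    rewrite (bigD1_seq m) ?msupp_uniq //= eqxx mulr1 big1 ?addr0 // => m' m'm.
    by rewrite (negbTE m'm) mulr0 if_same.
  rewrite (memN_msupp_eq0 mf) if_same big1_seq // => m' /= m'f.
  case: (eqVneq m' m) => [e|_]; last by rewrite mulr0 if_same.
  by rewrite -e m'f in mf.
by apply: eq_bigr => m' _; case: ifP => // _; rewrite mcoeffZ mcoeffX.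
Qed.

Lemma pihomog_homogM e d f g : f \is e.-homog ->
  pihomog mdeg (e + d) (f * g) = f * pihomog mdeg d g.
Proof.
move=> fe; pose N := maxn d.+1 (msize g).
have gE : g = \sum_(i < N) pihomog mdeg i g.
  by apply: pihomog_partitionE; apply: leq_maxr.
have dN : (d < N)%N by apply: leq_maxl.
rewrite {1}gE mulr_sumr raddf_sum /= (bigD1 (Ordinal dN)) //= big1 ?addr0.
  by rewrite pihomog_dE //; apply: dhomogM fe (pihomogP _ _ _).
move=> i id; apply: pihomog_ne0 (dhomogM fe (pihomogP _ _ _)).
by rewrite eqn_add2l.
Qed.

Lemma pihomog0_const f : pihomog mdeg 0 f = (f@_0)%:MP.
Proof.
apply/mpolyP => m; rewrite mcoeff_pihomog mcoeffC mdeg_eq0.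
by case: eqP => [->|]; rewrite ?mulr1 ?mulr0.
Qed.

Lemma homogeneousP I : homogeneous_ideal I ->
  forall f, (forall d, I (pihomog mdeg d f)) -> I f.
Proof.
move=> [idI _] f fI; rewrite (pihomog_partitionE (mf := mdeg) (p := f) (leqnn _)).
by apply: ideal_sum.
Qed.

(** The i-th power of the irrelevant ideal, described by coefficients. *)
Definition ordge i f := forall m, (mdeg m < i)%N -> f@_m = 0.

Lemma ordge_ideal i : is_ideal (ordge i).
Proof.
split=> [m _|f g fi gi m mi|a f fi m mi]; first by rewrite mcoeff0.
  by rewrite mcoeffD fi // gi // addr0.
rewrite mcoeffM big1 // => -[m1 m2] /= /eqP e; rewrite fi ?mulr0 //.
by apply: leq_ltn_trans mi; have := congr1 mdeg e; rewrite mdegD; lia.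
Qed.

Lemma ordge_le i j f : (i <= j)%N -> ordge j f -> ordge i f.
Proof. by move=> ij fj m mi; apply: fj; apply: leq_trans mi ij. Qed.

Lemma ordgeM i j f g : ordge i f -> ordge j g -> ordge (i + j) (f * g).
Proof.
move=> fi gj m mij; rewrite mcoeffM big1 // => -[m1 m2] /= /eqP e.
have [m1i|im1] := ltnP (mdeg m1) i; first by rewrite fi ?mul0r.
by rewrite gj ?mulr0 //; have := congr1 mdeg e; rewrite mdegD; lia.
Qed.

Lemma ordgeX m : ordge (mdeg m) 'X_[m].
Proof. by move=> m' m'm; rewrite mcoeffX; case: eqP m'm => [->|//]; rewrite ltnn. Qed.

Lemma ordgeXU i : ordge 1 'X_i.
Proof. by have := @ordgeX U_(i)%MM; rewrite mdeg1. Qed.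

Lemma ordge_homog d f : f \is d.-homog -> ordge d f.
Proof.
move=> /dhomogP fd m md; apply: memN_msupp_eq0; apply/negP => /fd e.
by rewrite e ltnn in md.
Qed.

Lemma ordge1P f : ordge 1 f <-> f@_0 = 0.
Proof.
split=> [|f0 m]; first by apply; rewrite mdeg0.
by rewrite ltnS leqn0 mdeg_eq0 => /eqP->.
Qed.

Lemma homog_ordge_eq0 d i f : f \is d.-homog -> ordge i f -> (d < i)%N -> f = 0.
Proof.
move=> /dhomogP fd fi di; apply/mpolyP => m; rewrite mcoeff0.
have [mf|/memN_msupp_eq0//] := boolP (m \in msupp f).
by apply: fi; rewrite (fd m mf).
Qed.

Lemma ordge_pihomog i d f : ordge i f -> ordge i (pihomog mdeg d f).
Proof. by move=> fi m mi; rewrite mcoeff_pihomog fi // if_same. Qed.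

Definition truncp i f := \sum_(d < i) pihomog mdeg d f.

Lemma mcoeff_truncp i f m : (truncp i f)@_m = if (mdeg m < i)%N then f@_m else 0.
Proof.
rewrite raddf_sum /=; case: ltnP => mi.
  rewrite (bigD1 (Ordinal mi)) //= mcoeff_pihomog eqxx big1 ?addr0 // => j jm.
  by rewrite mcoeff_pihomog eq_sym ifN.
by apply: big1 => j _; rewrite mcoeff_pihomog gtn_eqF // (leq_trans (ltn_ord j)).
Qed.

Lemma ordge_truncp i f : ordge i (f - truncp i f).
Proof. by move=> m mi; rewrite mcoeffB mcoeff_truncp mi subrr. Qed.

Lemma truncp_homogeneous I i f : homogeneous_ideal I -> I f -> I (truncp i f).
Proof. by move=> [idI hI] If; apply: ideal_sum => // d _; apply: hI. Qed.

Lemma pihomog_ordge i d f : ordge i f -> (d < i)%N -> pihomog mdeg d f = 0.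
Proof.
move=> fi di; apply: homog_ordge_eq0 (pihomogP _ _ _) (ordge_pihomog d fi) di.
Qed.

Lemma ordge_ind J i f : is_ideal J ->
  (forall m, (i <= mdeg m)%N -> J 'X_[m]) -> ordge i f -> J f.
Proof.
move=> idJ JX fi; rewrite [f]mpolyE; apply: ideal_sum => // m _.
have [mi|im] := ltnP (mdeg m) i; first by rewrite fi // scale0r; apply: ideal0.
by rewrite -mul_mpolyC; apply: idealM => //; apply: JX.
Qed.

Lemma mpolyXS i m : (i < mdeg m)%N ->
  exists j m', 'X_[m] = 'X_j * 'X_[m'] :> S /\ (i <= mdeg m')%N.
Proof.
move=> im; have [j mj] : exists j, (0 < m j)%N.
  apply: contrapT => nj; suff e : m = 0%MM by rewrite e mdeg0 in im.
  apply/mnmP => j; rewrite mnm0E; apply/eqP; rewrite -leqn0 leqNgt.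
  by apply/negP => mj; case: nj; exists j.
exists j, (m - U_(j))%MM.
have e : m = (U_(j) + (m - U_(j)))%MM.
  apply/mnmP => l; rewrite mnmDE mnmBE mnm1E.
  by case: eqP => [<-|]; rewrite ?addn0 //; lia.
split; first by rewrite {1}e mpolyXD.
by move: im; rewrite {1}e mdegD mdeg1; lia.
Qed.

Lemma irrelevant_is_ideal : is_ideal (irrelevant_ideal k n).
Proof. exact: ideal_genP. Qed.

Lemma irrelevantP f : irrelevant_ideal k n f <-> f@_0 = 0.
Proof.
split=> [fI|f0].
  apply/ordge1P; apply: (ideal_gen_sub (@ordge_ideal 1) _ fI) => _ [i _ <-].
  exact: ordgeXU.
apply: (@ordge_ind (irrelevant_ideal k n) 1 _ irrelevant_is_ideal); last exact/ordge1P.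
move=> m /(@mpolyXS 0)[j [m' [-> _]]]. apply: (ideal_mulr _ irrelevant_is_ideal).
by apply: sub_ideal_gen; exists j.
Qed.

Lemma mcoeffXUM i f m : ('X_i * f)@_m = if (0 < m i)%N then f@_(m - U_(i)) else 0.
Proof.
rewrite mulrC; case: posnP => mi.
  apply: memN_msupp_eq0; rewrite (perm_mem (msuppMX _ _)).
  by apply/mapP => -[m' _ e]; move: mi; rewrite e mnmDE mnm1E eqxx.
have e : m = (U_(i) + (m - U_(i)))%MM.
  apply/mnmP => l; rewrite mnmDE mnmBE mnm1E.
  by case: eqP => [<-|]; rewrite ?addn0 //; lia.
by rewrite {1}e mcoeffMX.
Qed.

(* The quotient of [f - f|_(X_i = 0)] by [X_i]. *)
Definition divX (i : 'I_n) f : S :=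
  \sum_(m <- msupp f | (0 < m i)%N) f@_m *: 'X_[m - U_(i)].

Lemma mcoeff_divX i f m : (divX i f)@_m = f@_(m + U_(i)).
Proof.
rewrite raddf_sum /=; set m' := (m + U_(i))%MM.
have m'i : (0 < m' i)%N by rewrite mnmDE mnm1E eqxx; lia.
have sub (m1 : 'X_{1..n}) : (0 < m1 i)%N -> (m1 - U_(i) == m)%MM = (m1 == m').
  move=> m1i; apply/eqP/eqP => [e|->]; last by rewrite /m' addmK.
  by rewrite /m' -e submK //; apply/mnm_lepP => l; rewrite mnm1E; case: eqP => [<-|].
have [mf|mf] := boolP (m' \in msupp f).
  rewrite big_mkcond (bigD1_seq m') ?msupp_uniq //= m'i mcoeffZ mcoeffX.
  rewrite sub // eqxx mulr1 big1 ?addr0 // => m1 m1m; case: ifP => // m1i.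
  by rewrite mcoeffZ mcoeffX sub // (negbTE m1m) mulr0.
rewrite (memN_msupp_eq0 mf) big1_seq // => m1 /andP[m1i m1f].
rewrite mcoeffZ mcoeffX sub //; case: eqP => [e|_]; last by rewrite mulr0.
by rewrite -e m1f in mf.
Qed.

Lemma divXB i : zmod_morphism (divX i).
Proof. by move=> f g; apply/mpolyP => m; rewrite mcoeffB !mcoeff_divX mcoeffB. Qed.

Lemma divX_XM (m i : 'I_n) f : divX m ('X_i * f) = if i == m then f else 'X_i * divX m f.
Proof.
apply/mpolyP => l; rewrite mcoeff_divX mcoeffXUM mnmDE mnm1E.
case: (eqVneq i m) => [->|im].
  by rewrite addn1 /= addmK.
rewrite addn0 mcoeffXUM; case: ifP => // li.
rewrite mcoeff_divX; congr (f@_ _); apply/mnmP => j.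
rewrite !(mnmDE, mnmBE, mnm1E); case: (eqVneq i j) => [<-|]; lia.
Qed.

Lemma ordge1_sum f : ordge 1 f -> exists g : 'I_n -> S, f = \sum_i 'X_i * g i.
Proof.
apply: (@ordge_ind [set f | exists g : 'I_n -> S, f = \sum_i 'X_i * g i]).
  split=> [|x y [g ->] [h ->]|a x [g ->]].
  - by exists (fun=> 0); rewrite big1 // => i _; rewrite mulr0.
  - by exists (fun i => g i + h i); rewrite -big_split; apply: eq_bigr => i _; rewrite mulrDr.
  - by exists (fun i => a * g i); rewrite mulr_sumr; apply: eq_bigr => i _; ring.
move=> m /(@mpolyXS 0)[j [m' [-> _]]].
exists (fun i => if i == j then 'X_[m'] else 0); rewrite (bigD1 j) //= eqxx.
by rewrite big1 ?addr0 // => i /negbTE->; rewrite mulr0.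
Qed.

End PolynomialOrder.

(** * Exactness of the Koszul complex of the variables *)

Section PolynomialKoszul.
Variables (k : fieldType) (n : nat).
Local Notation S := {mpoly k[n]}.
Local Notation d := (koszul (fun i : 'I_n => 'X_i : S)).

Lemma mpoly_koszul_exact b p (z : {set 'I_n} -> 'rV[S]_b) :
  extdeg p.+1 z -> (forall A, d z A = 0) ->
  exists2 w, extdeg p.+2 w & forall A, z A = d w A.
Proof.
apply: (koszul_exact_deg (D := fun i => map_mx (divX i))) => [i u v|i j v].
  by apply/rowP => l; rewrite !mxE divXB.
apply/rowP => l; rewrite !mxE divX_XM; case: ifP => // _.
by rewrite !mxE.
Qed.

(** Exterior degree 0 is where the Koszul complex over S has homology, namely the constants; zigzags
    that end here therefore carry a positive coefficient degree. *)
Lemma extdeg0_ordge1 b (z : {set 'I_n} -> 'rV[S]_b) : extdeg 0 z ->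
  (forall l, ordge 1 (z finset.set0 0 l)) ->
  exists2 w, extdeg 1 w & forall A, z A = d w A.
Proof.
move=> z0 zm; have [g gE] := choice (fun l => ordge1_sum (zm l)).
pose w A : 'rV[S]_b := \sum_i if A == finset.set1 i then \row_l g l i else 0.
have w1 : extdeg 1 w.
  move=> A A1; rewrite /w big1 // => i _; case: (A =P finset.set1 i) => [e|//].
  by rewrite e cards1 in A1.
exists w => // A; case: (eqVneq A finset.set0) => [->|A0]; last first.
  rewrite z0 ?finset.cards_eq0 // (extdeg_koszul _ w1) ?finset.cards_eq0 //.
rewrite koszul_set0; apply/rowP => l; rewrite gE summxE; apply: eq_bigr => i _.
rewrite mxE /w summxE (bigD1 i) //= eqxx mxE big1 ?addr0 // => j ji.
case: eqP => [/finset.set1_inj e|_]; last by rewrite mxE.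
by rewrite e eqxx in ji.
Qed.

End PolynomialKoszul.

(** * Koszul homology and linear resolutions *)

Section LinearResolution.
Variables (k : fieldType) (n : nat).
Local Notation S := {mpoly k[n]}.
Local Notation d := (koszul (fun i : 'I_n => 'X_i : S)).

Lemma koszul_entry b (w : {set 'I_n} -> 'rV[S]_b) A l :
  (d w A) 0 l = d (fun B => w B 0 l : S^o) A.
Proof.
rewrite /koszul summxE; apply: eq_bigr => i _; rewrite mxE /contr.
by case: ifP => _; rewrite mxE.
Qed.

Lemma koszul_homog c (z : {set 'I_n} -> S^o) A :
  (forall B, (z B : S) \is c.-homog) -> (d z A : S) \is (1 + c).-homog.
Proof.
move=> zc; apply: rpred_sum => i _; apply: dhomogM.
  by rewrite dhomogX /= mdeg1.
rewrite /contr; case: ifP => _; first exact: rpred0.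
by rewrite -signr_odd; case: odd; rewrite ?expr1 ?expr0 ?scaleN1r ?scale1r ?rpredN.
Qed.

Lemma mpoly_koszul_exact_regular p (z : {set 'I_n} -> S^o) :
  extdeg p.+1 z -> (forall A, d z A = 0) ->
  exists2 w, extdeg p.+2 w & forall A, z A = d w A.
Proof.
apply: (@koszul_exact_deg n S (fun i => 'X_i) S^o (fun i => @divX k n i)) => [i u v|i j v].
  exact: divXB.
exact: divX_XM.
Qed.

Lemma extdeg0_ordge1_regular (z : {set 'I_n} -> S^o) :
  extdeg 0 z -> ordge 1 (z finset.set0 : S) ->
  exists2 w, extdeg 1 w & forall A, z A = d w A.
Proof.
move=> z0 zm; have [||w w1 wE] := @extdeg0_ordge1 k n 1 (fun A => const_mx (z A)).
- by move=> A /z0->; apply/rowP => l; rewrite !mxE.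
- by move=> l; rewrite mxE.
exists (fun A => w A 0 0) => [A /w1->|A]; first by rewrite mxE.
by rewrite -koszul_entry -wE mxE.
Qed.

Variables (I : set S) (F : minimal_graded_resolution I) (t : nat).
Hypothesis F_linear : forall i (j : 'I_(rank F i)), deg j = (t + i)%N.

Lemma linear_diff_homog i j l : diff F i j l \is 1.-homog.
Proof.
case: (diff_homog j l) => [->|[e de he]]; first exact: rpred0.
by move: de he; rewrite !F_linear addnS -addn1 => /addnI <-.
Qed.

Lemma linear_aug_homog j : aug F j 0 \is t.-homog.
Proof. by have := aug_homog j; rewrite F_linear addn0. Qed.

Lemma pihomog_mulmx a b e c (v : 'rV[S]_a) (M : 'M[S]_(a, b)) :
  (forall j l, M j l \is e.-homog) ->
  map_mx (pihomog mdeg (e + c)) (v *m M) = map_mx (pihomog mdeg c) v *m M.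
Proof.
move=> Me; apply/rowP => l; rewrite !mxE raddf_sum; apply: eq_bigr => j _.
by rewrite mulrC /= (pihomog_homogM _ _ (Me j l)) mulrC mxE.
Qed.

Lemma map_mx_pihomog_id b c (v : 'rV[S]_b) : (forall l, v 0 l \is c.-homog) ->
  map_mx (pihomog mdeg c) v = v.
Proof. by move=> vc; apply/rowP => l; rewrite mxE pihomog_dE. Qed.

Lemma extcomp_mulmx a b p (z : {set 'I_n} -> 'rV[S]_b) (w : {set 'I_n} -> 'rV[S]_a) M A :
  extdeg p z -> (forall B, z B = w B *m M) -> z A = extcomp p w A *m M.
Proof.
move=> zp zE; rewrite /extcomp; case: eqP => [_|/eqP/zp->]; first exact: zE.
by rewrite mul0mx.
Qed.

Lemma koszul_mulmx a b (w : {set 'I_n} -> 'rV[S]_a) (M : 'M[S]_(a, b)) A :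
  d (fun B => w B *m M) A = d w A *m M.
Proof. exact: (koszul_lin (fun i => 'X_i : S) (mulmxr M)). Qed.

Lemma koszul_row_homog b c (w : {set 'I_n} -> 'rV[S]_b) A l :
  (forall B l, w B 0 l \is c.-homog) -> (d w A) 0 l \is (1 + c).-homog.
Proof. by move=> wc; rewrite koszul_entry; apply: koszul_homog => B; apply: wc. Qed.

(* Zigzag in the double complex of the Koszul complex and the resolution: by
   linearity all the coefficients met on the way have the same degree c. *)
Lemma koszul_resolution_exact p q c (w : {set 'I_n} -> 'rV[S]_(rank F q)) :
    (0 < c)%N -> extdeg p w -> (forall A l, w A 0 l \is c.-homog) ->
    (forall A, exists u, d w A = u *m diff F q) ->
  exists2 v, extdeg p.+1 v & forall A, exists u, w A = d v A + u *m diff F q.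
Proof.
elim: p q w => [|p IHp] q w c0 wp wc dw.
  have [l|v v1 vE] := extdeg0_ordge1 wp.
    by apply: ordge_le (ordge_homog (wc _ _)).
  by exists v => // A; exists 0; rewrite mul0mx addr0.
have [w1 w1E] := choice dw.
(* The lift [w1] is arbitrary. Since d w has degree c + 1 and the entries of the differential have
   degree 1, its part of exterior degree p and coefficient degree c is again a lift. *)
pose w2 A := map_mx (pihomog mdeg c) (extcomp p w1 A).
have w2E A : d w A = w2 A *m diff F q.
  rewrite /w2 -(pihomog_mulmx _ _ (@linear_diff_homog q)).
  rewrite -(extcomp_mulmx _ (extdeg_koszul _ wp) w1E) map_mx_pihomog_id //.
  by move=> l; apply: koszul_row_homog.
have w2p : extdeg p w2.
  by move=> A /negbTE Ap; rewrite /w2 /extcomp Ap; apply/rowP => l; rewrite !mxE pihomog0.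
have [A l|A|v vp vE] := IHp q.+1 w2 c0 w2p.
- by rewrite mxE; apply: pihomogP.
- apply/diff_exact; rewrite -koszul_mulmx -(@eq_koszul _ _ _ _ (d w)) //.
  exact: koszul_koszul.
(* Modulo the image of the next differential, [w2] is d v; as that image is killed by [diff F q],
   the difference of w and v *m diff F q is a genuine cycle over S. *)
have [|A|y yp yE] := @mpoly_koszul_exact k n _ p (fun A => w A - v A *m diff F q).
- by apply: extdegB => // A /vp->; rewrite mul0mx.
- rewrite koszulB koszul_mulmx w2E; have [u ->] := vE A.
  by rewrite mulmxDl -mulmxA (_ : diff F q.+1 *m diff F q = 0) ?mulmx0 ?addr0 ?subrr //;
    apply/row_matrixP => i; rewrite row_mul row0; apply/diff_exact;
    exists (delta_mx 0 i); rewrite rowE.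
by exists y => // A; exists (v A); rewrite -yE subrK.
Qed.

(** Entry into the zigzag: d z lies in I in degree c + 1 and the generators have degree t, so its
    lift has coefficients of degree c + 1 - t, positive because t <= c. The zigzag returns y in I
    with d y = d z, and z - y is a cycle over S. In exterior degree 0, z itself has no constant term
    because c is positive. *)
Lemma linear_resolution_koszul p c (z : {set 'I_n} -> S^o) :
    is_ideal I -> (0 < c)%N -> (t <= c)%N ->
    extdeg p z -> (forall A, (z A : S) \is c.-homog) -> (forall A, I (d z A)) ->
  exists2 v, extdeg p.+1 v & forall A, I (z A - d v A).
Proof.
move=> idI c0 tc; case: p => [|p] zp zc dz.
  have [|v v1 vE] := extdeg0_ordge1_regular zp.
    by apply: ordge_le (ordge_homog (zc _)).
  by exists v => // A; rewrite vE subrr; apply: ideal0.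
have [w1 w1E] := choice (fun A => (aug_image F _).1 (dz A)).
pose w A := map_mx (pihomog mdeg (c.+1 - t)) (extcomp p w1 A).
have wE A : const_mx (d z A) = w A *m aug F.
  rewrite /w -(@pihomog_mulmx _ _ t) => [|j l]; last by rewrite ord1 linear_aug_homog.
  pose z' A : 'rV[S]_1 := const_mx (d z A).
  have z'p : extdeg p z' by move=> B /(extdeg_koszul _ zp) e; rewrite /z' e; apply/rowP=> l; rewrite !mxE.
  rewrite -(extcomp_mulmx _ z'p) ?map_mx_pihomog_id //.
    move=> l; rewrite mxE subnKC ?(leq_trans tc) //.
    exact: koszul_homog.
  by move=> B; apply/rowP => l; rewrite mxE ord1 w1E.
have wp : extdeg p w.
  by move=> A /negbTE Ap; rewrite /w /extcomp Ap; apply/rowP => l; rewrite !mxE pihomog0.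
have [|A l|A|v vp vE] := @koszul_resolution_exact p 0 (c.+1 - t) w _ wp.
- by rewrite subn_gt0.
- by rewrite mxE; apply: pihomogP.
- apply/aug_exact; rewrite -koszul_mulmx -(@eq_koszul _ _ _ _ (fun A => const_mx (d z A))) //.
  apply/rowP => l; rewrite koszul_entry mxE -[RHS](koszul_koszul (fun i => 'X_i : S) z A).
  by apply: (@eq_koszul n S _ S^o) => B; rewrite mxE.
pose y A : S^o := (v A *m aug F) 0 0.
have yI A : I (y A) by apply/(aug_image F); exists (v A).
have dy A : d z A = d y A.
  rewrite /y -(koszul_entry (fun A => v A *m aug F)) koszul_mulmx.
  have := wE A; have [u ->] := vE A.
  have -> : (d v A + u *m diff F 0) *m aug F = d v A *m aug F.
    by rewrite mulmxDl [u *m _ *m _](_ : _ = 0) ?addr0 //; apply/aug_exact; exists u.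
  by move=> <-; rewrite mxE.
have [|A|u up uE] := @mpoly_koszul_exact_regular p (fun A => z A - y A).
- by apply: extdegB => // A /vp e; rewrite /y e mul0mx mxE.
- by rewrite koszulB dy subrr.
by exists u => // A; rewrite -uE opprB addrCA subrr addr0.
Qed.

Lemma linear_resolution_ordge f : I f -> ordge t f.
Proof.
move=> /(aug_image F)[v <-]; rewrite mxE; apply: ideal_sum => [|j _].
  exact: ordge_ideal.
apply: (idealM _ (@ordge_ideal k n t)); exact: ordge_homog (linear_aug_homog j).
Qed.

End LinearResolution.

(** * Vanishing of Koszul homology: linear forms, socles and depth *)

Section KoszulVanishing.
Variables (k : fieldType) (n : nat).
Local Notation S := {mpoly k[n]}.
Local Notation d := (koszul (fun i : 'I_n => 'X_i : S)).
Implicit Types (J : set S) (z w v : {set 'I_n} -> S^o).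

Lemma ideal_signr J m (u : S) : is_ideal J -> J u -> J ((-1) ^+ m * u).
Proof. by move=> idJ; apply: idealM. Qed.

Lemma ideal_koszul J z A : is_ideal J -> (forall B, J (z B)) -> J (d z A).
Proof.
move=> idJ Jz; apply: ideal_sum => // i _; apply: (idealM _ idJ).
rewrite /contr; case: ifP => _; first exact: (ideal0 idJ).
exact: (ideal_signr _ idJ).
Qed.

Lemma ideal_extmul J i z A : is_ideal J -> (forall B, J (z B)) -> J (extmul i z A).
Proof.
move=> idJ Jz; rewrite /extmul; case: ifP => _; last exact: (ideal0 idJ).
exact: (ideal_signr _ idJ).
Qed.

(* The Koszul homology of S/J vanishes in exterior degree p and coefficient
   degree c. *)
Definition koszul_vanish J p c := forall z,
  extdeg p z -> (forall A, (z A : S) \is c.-homog) -> (forall A, J (d z A)) ->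
  exists2 v, extdeg p.+1 v & forall A, J (z A - d v A).

(** The part of v that d sends to coefficient degree c: degree c - 1, and nothing when c = 0. *)
Definition pihomog_pred c v : {set 'I_n} -> S^o :=
  fun B => if c is c'.+1 then pihomog mdeg c' (v B : S) else 0.

Lemma pihomog_koszul c v A :
  pihomog mdeg c (d v A : S) = d (pihomog_pred c v) A.
Proof.
rewrite /pihomog_pred /koszul raddf_sum /=; apply: eq_bigr => i _.
have X1 : ('X_i : S) \is 1.-homog by rewrite dhomogX /= mdeg1.
case: c => [|c]; rewrite /contr.
  rewrite (@pihomog_ordge _ _ 1) //; first by case: ifP; rewrite ?scaler0.
  apply: (ideal_mulr _ (@ordge_ideal _ _ 1)); exact: ordgeXU.
rewrite (pihomog_homogM c _ X1); congr (_ * _).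
case: ifP => _; first by rewrite pihomog0.
rewrite -signr_odd; case: odd; rewrite ?expr1 ?expr0 ?scaleN1r ?scale1r //.
exact: pihomogN.
Qed.

(** The bounding v may be taken of degree c - 1. Homogeneity is stated for l * v A, of degree c, so
    that c = 0, where v is zero, fits the same formula. *)
Lemma koszul_vanish_homog J p c : homogeneous_ideal J -> koszul_vanish J p c ->
  forall z, extdeg p z -> (forall A, (z A : S) \is c.-homog) ->
    (forall A, J (d z A)) -> forall l : S, l \is 1.-homog ->
  exists v, [/\ extdeg p.+1 v, forall A, l * v A \is c.-homog &
    forall A, J (z A - d v A)].
Proof.
move=> [idJ hJ] vJ z zp zc dz l l1; have [v vp vE] := vJ z zp zc dz.
exists (pihomog_pred c v); rewrite /pihomog_pred; split.
- by move=> A /vp->; case: (c) => // c'; rewrite pihomog0.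
- move=> A; case: (c) => [|c']; first by rewrite mulr0 rpred0.
  exact: dhomogM l1 (pihomogP _ _ _).
- move=> A; have := hJ _ c (vE A).
  by rewrite pihomogB pihomog_koszul pihomog_dE.
Qed.

Lemma koszul_vanish_adjoin0 J l c : is_ideal J ->
  koszul_vanish J 0 c -> koszul_vanish (ideal_adjoin J l) 0 c.
Proof.
move=> idJ vJ z z0 zc _; have [|v v1 vE] := vJ z z0 zc.
  by move=> A; rewrite extdeg0_koszul //; apply: (ideal0 idJ).
by exists v => // A; apply: sub_ideal_adjoin.
Qed.

(** The long exact sequence of multiplication by l. A cycle z modulo (J, l) gives d z = l w modulo
    J; w is a cycle by regularity, one exterior degree lower and of the same coefficient degree c,
    as d and l both have degree 1. If w = d v, then z - l v is a cycle modulo J. *)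
Lemma koszul_vanish_adjoin J l p c : homogeneous_ideal J -> l \is 1.-homog ->
    (forall f, J (l * f) -> J f) ->
  koszul_vanish J p.+1 c -> koszul_vanish J p c ->
  koszul_vanish (ideal_adjoin J l) p.+1 c.
Proof.
move=> hhJ l1 lreg vJ1 vJ z zp zc /choice[w1 w1E]; have [idJ hJ] := hhJ.
pose w A : S^o := pihomog mdeg c (extcomp p (w1 : _ -> S^o) A : S).
have wE A : J (d z A - l * w A).
  rewrite /w /extcomp; case: eqP => [_|/eqP/(extdeg_koszul _ zp)->].
    have := hJ _ (1 + c)%N (w1E A); rewrite pihomogB (pihomog_homogM c _ l1).
    by rewrite pihomog_dE //; apply: koszul_homog.
  by rewrite pihomog0 mulr0 subrr; apply: (ideal0 idJ).
have wp : extdeg p w by move=> A /negbTE e; rewrite /w /extcomp e pihomog0.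
have dw A : J (d w A).
  apply: lreg; have : J (d (fun B => d z B - l *: w B) A) by apply: ideal_koszul.
  rewrite koszulB koszul_koszul koszulZ sub0r => /(idealN idJ).
  by rewrite opprK.
have [v [vp lv vE]] := koszul_vanish_homog hhJ vJ wp (fun A => pihomogP _ _ _) dw l1.
have [|A|A|y yp yE] := vJ1 (fun A => z A - l * v A).
- by apply: extdegB => // A /vp->; rewrite mulr0.
- exact: (rpredB (zc A) (lv A)).
- rewrite koszulB (koszulZ _ l); have := idealB idJ (wE A) (idealM (- l) idJ (vE A)).
  have e (a b g : S) : a - l * b - - l * (b - g) = a - l * g by ring.
  by rewrite e.
by exists y => // A; exists (v A); have := yE A; rewrite addrAC.
Qed.

(** u times the top exterior monomial is a cycle, and there is nothing in exterior degree n + 1 for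
    it to bound. *)
Lemma koszul_vanish_socle J c u : is_ideal J -> koszul_vanish J n c ->
  u \is c.-homog -> (forall i, J ('X_i * u)) -> J u.
Proof.
move=> idJ vJ uc Ju; pose z A : S^o := if A == [set: 'I_n]%SET then u else 0.
have [A|A|A|v vn vE] := vJ z.
- rewrite /z; case: (A =P _) => // ->; by rewrite cardsT card_ord eqxx.
- by rewrite /z; case: ifP => // _; apply: rpred0.
- apply: ideal_sum => // i _; rewrite /contr /z.
  case: ifP => _; first by rewrite scaler0; apply: (ideal0 idJ).
  case: ifP => _; last by rewrite !scaler0; apply: (ideal0 idJ).
  rewrite scalerA mulrC -scalerA; exact: (idealM _ idJ (Ju i)).
have := vE [set: 'I_n]%SET; rewrite /z eqxx /koszul big1 ?subr0 // => i _.
by rewrite /contr finset.in_setT scaler0.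
Qed.

Lemma koszul_homotopy (a : S) : ordge 1 a ->
  exists H : ({set 'I_n} -> S^o) -> ({set 'I_n} -> S^o),
  [/\ forall p z, extdeg p z -> extdeg p.+1 (H z),
    forall J z A, is_ideal J -> (forall B, J (z B)) -> J (H z A) &
    forall z A, d (H z) A + H (d z) A = a * z A].
Proof.
move=> /ordge1_sum[g ->]; exists (fun z A => \sum_i g i *: extmul i z A); split.
- by move=> p z zp A Ap; rewrite big1 // => i _; rewrite (extdeg_extmul i zp) ?scaler0.
- move=> J z A idJ Jz; apply: ideal_sum => // i _; apply: (idealM _ idJ).
  exact: ideal_extmul.
move=> z A; rewrite koszul_sum -big_split mulr_suml /=; apply: eq_bigr => i _.
rewrite koszulZ -scalerDr koszul_extmul.
by rewrite scalerA [g i * _]mulrC.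
Qed.

Lemma common_denominator J x (w : {set 'I_n} -> S) : is_ideal J ->
    (forall A, exists s g, s@_0 != 0 /\ J (s * w A - x * g)) ->
  exists s, s@_0 != 0 /\ exists g : {set 'I_n} -> S, forall A, J (s * w A - x * g A).
Proof.
move=> idJ /choice[s /choice[g sg]]; exists (\prod_A s A); split.
  by rewrite rmorph_prod; apply/prodf_neq0 => A _; have [] := sg A.
exists (fun A => (\prod_(B | B != A) s B) * g A) => A.
rewrite (bigD1 A) //=; have [_ /(idealM (\prod_(B | B != A) s B) idJ)] := sg A.
have e (a b c y : S) : a * (b * y - x * c) = (b * a) * y - x * (a * c) by ring.
by rewrite e.
Qed.

(** Depth sensitivity, by descending induction on j. With H the homotopy for a_j, d (H z) = a_j z
    modulo Q_j, so H z is a cycle modulo Q_(j+1) and equals some d v there. As Q_(j+1) is (Q_j, a_j)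
    only up to denominators, this reads s (H z - d v) = a_j g modulo Q_j; applying d and cancelling
    a_j leaves s z = d g. At j = e the exterior degree exceeds n and z is zero. *)
Lemma depth_koszul_vanish (Q : nat -> set S) (a : nat -> S) e :
    (forall j, is_ideal (Q j)) ->
    (forall j, (j < e)%N -> [/\ ordge 1 (a j), forall f, Q j (a j * f) -> Q j f,
      Q j `<=` Q j.+1, Q j.+1 (a j) & forall f, Q j.+1 f ->
        exists s g, s@_0 != 0 /\ Q j (s * f - a j * g)]) ->
  forall j p z, (j <= e)%N -> (n + j < p + e)%N -> extdeg p z ->
    (forall A, Q j (d z A)) ->
  exists2 v, extdeg p.+1 v & forall A, Q j (z A - d v A).
Proof.
move=> idQ regQ j p z je; move: {2}(e - j)%N (erefl (e - j)%N) => m.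
elim: m j p z je => [|m IHm] j p z je jm pn zp dz.
  exists (fun=> 0) => // A; rewrite zp ?koszul0 ?subr0; first exact: (ideal0 (idQ j)).
  apply: contraTneq (subset_leq_card (finset.subsetT A)) => ->.
  by rewrite cardsT card_ord; lia.
have [|a1 areg QS Qa Qf] := regQ j; first lia.
have [H [Hp HJ HE]] := koszul_homotopy a1.
have dw A : Q j (d (H z) A - a j * z A).
  rewrite -HE opprD addrA subrr add0r; apply: (idealN (idQ j)).
  exact: HJ.
have dHz A : Q j.+1 (d (H z) A).
  by apply: (idealBr (idQ _) _ (QS _ (dw A))); apply: (ideal_mulr _ (idQ _)).
have [|||v vp vE] := IHm j.+1 p.+1 (H z) _ _ _ (Hp _ _ zp) dHz; [lia..|].
have [s [s0 [g1 sg]]] := common_denominator (idQ j) (fun A => Qf _ (vE A)).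
pose g := extcomp p.+1 (g1 : _ -> S^o).
have gE A : Q j (s * (H z A - d v A) - a j * g A).
  rewrite /g /extcomp; case: eqP => [_|/eqP pA]; first exact: sg.
  rewrite (Hp _ _ zp) // (extdeg_koszul _ vp) // subrr !mulr0 subrr.
  exact: (ideal0 (idQ j)).
have sz A : Q j (s * z A - d g A).
  apply: areg.
  have : Q j (d (fun B => s *: (H z B - d v B) - a j *: g B) A).
    exact: ideal_koszul.
  rewrite koszulB !koszulZ koszulB koszul_koszul subr0.
  move=> /(idealB (idQ j)) /(_ (idealM s (idQ j) (dw A))).
  have Es (x y u v' : S) : s * x - y * u - s * (x - y * v') = y * (s * v' - u) by ring.
  by rewrite Es.
(* Because s - s(0) is null-homotopic, s acts on homology as the nonzero scalar s(0), which can be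
   divided out. *)
have [|H' [Hp' HJ' HE']] := @koszul_homotopy (s - (s@_0)%:MP).
  by apply/ordge1P; rewrite mcoeffB mcoeffC eqxx mulr1 subrr.
pose b := (s@_0)^-1.
exists (fun A => b%:MP *: (g A - H' z A)).
  by move=> A Ap; rewrite /g (extcompP _ Ap) (Hp' _ _ zp) // subrr scaler0.
move=> A; rewrite koszulZ koszulB.
have e1 : d (H' z) A = (s - (s@_0)%:MP) * z A - H' (d z) A by rewrite -HE' addrK.
have b1 : b%:MP * (s@_0)%:MP = 1 :> S by rewrite -mpolyCM mulVf.
have JH : Q j (H' (d z) A) by exact: (HJ' _ _ _ (idQ j) dz).
have := idealM b%:MP (idQ j) (idealB (idQ j) (sz A) JH).
rewrite e1; set c := (s@_0)%:MP in b1 *.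
have Eb (x y u : S) : b%:MP * (s * x - y - u) = b%:MP * c * x - b%:MP * (y - ((s - c) * x - u)).
  by ring.
by rewrite Eb b1 mul1r.
Qed.

End KoszulVanishing.

(** * Regular linear forms *)

Section GenericLinearForms.
Variables (k : fieldType) (n : nat).
Local Notation S := {mpoly k[n]}.
Implicit Types (J P : set S) (f g u : S).

Definition annihilator J u : set S := [set f | J (f * u)].

Lemma annihilator_ideal J u : is_ideal J -> is_ideal (annihilator J u).
Proof.
move=> idJ; split=> [|f g|a f] /=; first by rewrite /annihilator /= mul0r; apply: ideal0.
  by rewrite /annihilator /= mulrDl; apply: idealD.
by rewrite /annihilator /= -mulrA; apply: idealM.
Qed.

Lemma prod_notin_prime P (I : eqType) (r : seq I) (F : I -> S) : prime_ideal P ->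
  (forall i, i \in r -> ~ P (F i)) -> ~ P (\prod_(i <- r) F i).
Proof.
move=> [_ P1 PM]; elim: r => [|i r IHr] nP; first by rewrite big_nil.
rewrite big_cons => /PM[]; first by apply: nP; rewrite mem_head.
by apply: IHr => j jr; apply: nP; rewrite inE jr orbT.
Qed.

(** Linear forms on the moment curve: any n of them with distinct parameters span all linear forms,
    by the Vandermonde determinant, so a pigeonhole argument can play the role of a general
    choice. *)
Definition moment_form (c : k) : S := \sum_(i < n) (c ^+ i)%:MP * 'X_i.

Lemma infinite_injective_seq : infinite_set [set: k] -> exists c : nat -> k, injective c.
Proof.
move=> kinf; pose Q i (c : nat -> k) t := forall j, (j < i)%N -> c j <> t.
have [|i f|c cP] := @dependent_choice_prefix _ 0 Q.
- by move=> i f g fg t Qt j ji; rewrite -fg //; apply: Qt.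
- apply: contrapT => nt; apply: kinf.
  apply: (@sub_finite_set _ _ (f @` `I_i)); last exact/finite_image/finite_II.
  move=> t _; apply: contrapT => ft; apply: nt; exists t => j ji ej.
  by apply: ft; exists j.
exists c => i j eij; case: (ltngtP i j) => // [ij|ji]; first by case: (cP j i).
by case: (cP i j).
Qed.

Lemma moment_form_homog c : moment_form c \is 1.-homog.
Proof.
apply: rpred_sum => i _; rewrite mul_mpolyC; apply: rpredZ.
by rewrite dhomogX /= mdeg1.
Qed.

Lemma moment_forms_span P (c : 'I_n -> k) : is_ideal P -> injective c ->
  (forall j, P (moment_form (c j))) -> forall i, P 'X_i.
Proof.
move=> idP cinj Pc i; pose V := Vandermonde n (\row_j c j).
have Vu : V \in unitmx.
  rewrite unitmxE det_Vandermonde unitfE.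
  apply/prodf_neq0 => a _; apply/prodf_neq0 => b ab; rewrite !mxE subr_eq0.
  by apply: contraTneq ab => /cinj->; rewrite ltnn.
have -> : 'X_i = \sum_j (invmx V j i)%:MP * moment_form (c j).
  transitivity (\sum_l ((V *m invmx V) l i)%:MP * ('X_l : S)).
    rewrite mulmxV // (bigD1 i) //= mxE eqxx mul1r big1 ?addr0 // => l li.
    by rewrite mxE (negbTE li) mul0r.
  under [RHS]eq_bigr do rewrite mulr_sumr.
  rewrite exchange_big; apply: eq_bigr => l _; rewrite mxE raddf_sum mulr_suml.
  by apply: eq_bigr => j _; rewrite !mxE /= mpolyCM mulrA [in RHS](mulrC (_%:MP)).
by apply: ideal_sum => // j _; apply: idealM.
Qed.

(* The ideals (J : u), u notin J, that are maximal among those are prime, and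
   finitely many by noetherianity; none of them contains all the linear
   forms, so that each contains fewer than n of the forms
   [moment_form c]. *)
Lemma regular_linear_form J : infinite_set [set: k] -> is_ideal J ->
    (forall u, (forall i, J ('X_i * u)) -> J u) ->
  exists2 l : S, l \is 1.-homog & forall f, J (l * f) -> J f.
Proof.
move=> /infinite_injective_seq[c cinj] idJ socJ; apply: contrapT => nl.
have noeS := @mpoly_noetherian k n.
pose F P := exists2 u, ~ J u & P = annihilator J u.
have Fid P : F P -> is_ideal P by case=> u _ ->; apply: annihilator_ideal.
(* With no regular linear form at hand, every [moment_form (c a)] annihilates something nonzero
   modulo J, hence lies in a maximal annihilator (J : u a). *)
have /choice[u uP] a : exists u, [/\ ~ J u, annihilator J u (moment_form (c a)) &
    forall u', ~ J u' -> annihilator J u `<=` annihilator J u' ->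
      annihilator J u' `<=` annihilator J u].
  have [v Jv nJv] : exists2 v, J (moment_form (c a) * v) & ~ J v.
    apply: contrapT => nv; apply: nl; exists (moment_form (c a)).
      exact: moment_form_homog.
    by move=> f Jf; apply: contrapT => nf; apply: nv; exists f.
  have [|M [[w nw ->] vM maxM]] := noetherian_maximal noeS Fid (J := annihilator J v).
    by exists v.
  exists w; split=> // [|u' nu']; first exact: vM.
  by apply: maxM; exists u'.
have primeP a : prime_ideal (annihilator J (u a)).
  have [nJ _ maxu] := uP a; split; first exact: annihilator_ideal.
    by rewrite /annihilator /= mul1r.
  move=> x y Pxy; have [Px|nPx] := pselect (annihilator J (u a) x); first by left.
  right; apply: (maxu (x * u a)) => //.
    by move=> f Pf; rewrite /annihilator /= mulrCA; apply: idealM.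
  by move: Pxy; rewrite /annihilator /= mulrCA mulrA.
have [x Ex] := noeS _ idJ.
(* The generators of J followed by all the [u a]: when the ideals they generate stabilize at N,
   every [u a] lies in J plus the ideal of the [u b] with b < N. *)
pose gs i := if (i < size x)%N then x`_i else u (i - size x)%N.
have [N gsN] := noetherian_stable gs noeS.
have /choice[phi phiP] a : exists b : 'I_N, annihilator J (u b) = annihilator J (u a).
  apply: contrapT => nb.
  have /choice[h hP] b : exists h, b \in iota 0 N ->
      annihilator J (u b) h /\ ~ annihilator J (u a) h.
    have [bN'|bN'] := boolP (b \in iota 0 N); last by exists 0.
    suff [h hh] : exists h, annihilator J (u b) h /\ ~ annihilator J (u a) h by exists h.
    apply: contrapT => nh; rewrite mem_iota /= in bN'; apply: nb; exists (Ordinal bN').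
    have ba : annihilator J (u b) `<=` annihilator J (u a).
      by move=> f Pf; apply: contrapT => nf; apply: nh; exists f.
    apply/seteqP; split=> //; have [_ _] := uP b; apply=> //.
    by case: (uP a).
  (* Each factor kills one [u b] modulo J, so f kills [u a] as well, although the prime (J : u a)
     contains none of the factors. *)
  pose f := \prod_(b <- iota 0 N) h b.
  have : ~ annihilator J (u a) f by apply: prod_notin_prime => // j jN; case: (hP j jN).
  apply; rewrite /annihilator /= mulrC.
  have -> : u a = gs (size x + a)%N by rewrite /gs ltnNge leq_addr /= addKn.
  move: (gsN (size x + a)%N); set y := gs _.
  suff sub : ideal_gen [set gs j | j in [set j | (j < N)%N]] `<=` annihilator J f.
    by move=> /sub.
  apply: ideal_gen_sub; first exact: annihilator_ideal.
  move=> _ [j /= jN <-]; rewrite /annihilator /= /gs; case: ltnP => jx.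
    by apply: ideal_mulr => //; rewrite Ex; apply: sub_ideal_gen; apply: mem_nth.
  have jN' : (j - size x)%N \in iota 0 N by rewrite mem_iota /=; lia.
  rewrite /f (bigD1_seq _ jN' (iota_uniq _ _)) /= mulrA; apply: ideal_mulr => //.
  by rewrite mulrC; case: (hP _ jN').
(* With more than N * n parameters and N annihilators, some annihilator contains n of the forms,
   hence every variable. *)
pose psi (i : 'I_(N * n).+1) := phi i.
have [q qn] : exists q : 'I_N, (n <= #|[set i | psi i == q]%SET|)%N.
  apply: contrapT => nq; suff : ((N * n).+1 <= N * n)%N by rewrite ltnn.
  rewrite -[X in (X <= _)%N](card_ord (N * n).+1) -cardsT.
  have -> : #|[set: 'I_(N * n).+1]%SET| = (\sum_(q : 'I_N) #|[set i | psi i == q]%SET|)%N.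
    under eq_bigr do rewrite -sum1_card.
    rewrite -sum1_card (partition_big psi predT) //=; apply: eq_bigr => q _.
    by apply: eq_bigl => i; rewrite !inE.
  rewrite -[N in (_ <= N * _)%N]card_ord -sum_nat_const; apply: leq_sum => q _.
  by rewrite leqNgt; apply/negP => qn; apply: nq; exists q; apply: ltnW.
pose e (j : 'I_n) := enum_val (widen_ord qn j).
have Pe j : annihilator J (u q) (moment_form (c (e j))).
  have : e j \in [set i | psi i == q]%SET by apply: enum_valP.
  rewrite inE => /eqP <-; rewrite /psi phiP.
  by case: (uP (e j)).
have [nJu _ _] := uP q; apply: nJu; apply: socJ => i.
apply: (@moment_forms_span (annihilator J (u q)) (fun j => c (e j))) => //.
  exact: annihilator_ideal.
by move=> j1 j2 /cinj/val_inj/enum_val_inj/(congr1 val)/= e12; apply: val_inj.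
Qed.

End GenericLinearForms.

(** * Ideals containing a power of the irrelevant ideal *)

Section PrimaryIdeals.
Variables (k : fieldType) (n : nat).
Local Notation S := {mpoly k[n]}.
Implicit Types (J P : set S) (f g u : S).

(** The products of a power of l with an element outside P avoid J, because l can be cancelled
    modulo J; a prime avoiding them lies in P and omits l. *)
Lemma prime_below J P l : is_ideal J -> prime_ideal P -> J `<=` P ->
    (forall f, J (l * f) -> J f) ->
  exists P', [/\ prime_ideal P', J `<=` P', P' `<=` P & ~ P' l].
Proof.
move=> idJ [idP P1 PM] JP lreg.
pose W f := exists i s, ~ P s /\ f = l ^+ i * s.
have WM : mul_closed W.
  split; first by exists 0%N, 1; rewrite expr0 mulr1.
  move=> _ _ [i [s [Ps ->]]] [j [t [Pt ->]]]; exists (i + j)%N, (s * t).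
  split; first by case/PM.
  by rewrite exprD mulrACA.
have JW f : J f -> ~ W f.
  move=> Jf [i [s [Ps ef]]]; apply: Ps; apply: JP; move: Jf; rewrite {}ef.
  elim: i => [|i IHi]; first by rewrite mul1r.
  by rewrite exprS -mulrA => /lreg.
have [P' [pP' JP' PW]] := prime_avoiding (@mpoly_noetherian k n) idJ WM JW.
exists P'; split=> // [f P'f|P'l].
  apply: contrapT => Pf; apply: (PW _ P'f).
  by exists 0%N, f; rewrite mul1r.
by apply: (PW _ P'l); exists 1%N, 1; rewrite expr1 mulr1.
Qed.

(** Every variable has a power in J: otherwise the products X_i^e s with s(0) nonzero avoid J, and a
    prime over J avoiding them lies in the irrelevant ideal but omits X_i. *)
Lemma primary_of_unique_prime J : homogeneous_ideal J ->
    (forall P, prime_ideal P -> J `<=` P -> P `<=` ordge 1 -> @ordge k n 1 `<=` P) ->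
  exists N, forall f, ordge N f -> J f.
Proof.
move=> [idJ hJ] uniqP.
have /choice[e eP] (i : 'I_n) : exists e, J ('X_i ^+ e).
  apply: contrapT => ne.
  pose W f := exists e s, (s : S)@_0 != 0 /\ f = 'X_i ^+ e * s.
  have WM : mul_closed W.
    split; first by exists 0%N, 1; rewrite expr0 mulr1 mcoeff1 eqxx oner_eq0.
    move=> _ _ [a [s [s0 ->]]] [b [t [t0 ->]]]; exists (a + b)%N, (s * t).
    by rewrite rmorphM mulf_neq0 // exprD mulrACA.
  have JW f : J f -> ~ W f.
    move=> Jf [q [s [s0 ef]]]; apply: ne; exists q.
    have Xq : ('X_i : S) ^+ q \is q.-homog.
      by have := @dhomogMn _ _ mdeg 1 'X_i q; rewrite mul1n; apply; rewrite dhomogX /= mdeg1.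
    (* The component of degree q of X_i^q s is s(0) X_i^q, so homogeneity puts X_i^q into J. *)
    have := hJ _ (q + 0)%N Jf; rewrite ef (pihomog_homogM 0 s Xq).
    rewrite pihomog0_const.
    move=> /(ideal_mulr ((s@_0)^-1)%:MP idJ).
    by rewrite -mulrA -mpolyCM mulfV // mulr1.
  have [P [pP JP PW]] := prime_avoiding (@mpoly_noetherian k n) idJ WM JW.
  have Pm : P `<=` ordge 1.
    move=> f Pf; apply/ordge1P; apply: contrapT => /eqP f0; apply: (PW _ Pf).
    by exists 0%N, f; rewrite mul1r.
  apply: (PW 'X_i); first by apply: (uniqP P) => //; apply: ordgeXU.
  by exists 1%N, 1; rewrite mulr1 mcoeff1 eqxx oner_eq0.
exists (\sum_i e i).+1%N => f; apply: ordge_ind => // m mN.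
have [i im] : exists i, (e i <= m i)%N.
  apply: contrapT => ni; move: mN; rewrite mdegE ltnNge; case/negP.
  apply: leq_sum => i _; rewrite leqNgt; apply/negP => mi; apply: ni.
  by exists i; apply: ltnW.
have -> : m = (U_(i) *+ e i + (m - U_(i) *+ e i))%MM.
  rewrite addmC submK //; apply/mnm_lepP => j; rewrite mulmnE mnm1E.
  by case: eqP => [<-|]; rewrite ?mul1n.
rewrite mpolyXD; apply: ideal_mulr => //.
by rewrite -mpolyXn; apply: eP.
Qed.

(** Once all monomials of degree N + 1 are in J, those of degree N are socle elements modulo J; as
    long as N >= T they are therefore in J too. *)
Lemma ordge_sub_of_socle J T N : is_ideal J ->
    (forall c u, (T <= c)%N -> u \is c.-homog -> (forall i, J ('X_i * u)) -> J u) ->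
    (forall f, @ordge k n N f -> J f) ->
  forall f, ordge T f -> J f.
Proof.
move=> idJ socJ; elim: N => [JN f _|N IHN JN]; first exact: JN.
have [NT f|TN] := ltnP N T; first by move=> fT; apply: JN; apply: ordge_le fT.
apply: IHN => f; apply: ordge_ind => // m; rewrite leq_eqVlt => /orP[/eqP mN|Nm].
  apply: (socJ N) => // [|i]; first by rewrite dhomogX /= mN.
  apply: JN; rewrite -[N.+1]/(1 + N)%N mN; apply: ordgeM; first exact: ordgeXU.
  exact: ordgeX.
by apply: JN; apply: ordge_le Nm _; apply: ordgeX.
Qed.

End PrimaryIdeals.

(** * Localization at the irrelevant ideal *)

Section HomogeneousIdeals.
Variables (k : fieldType) (n : nat) (I : set {mpoly k[n]}).
Hypotheses (hI : homogeneous_ideal I) (I1 : ~ I 1).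
Local Notation S := {mpoly k[n]}.
Implicit Types (f g s : S).

Lemma ideal_mpolyC_unit (J : set S) c f : is_ideal J -> c != 0 -> J (c%:MP * f) -> J f.
Proof.
move=> idJ c0 /(idealM (c^-1)%:MP idJ).
by rewrite mulrA -mpolyCM mulVf // mul1r.
Qed.

Lemma proper_homogeneous_ordge1 f : I f -> ordge 1 f.
Proof.
case: hI => idI IH If; apply/ordge1P; apply: contrapT => /eqP f0; apply: I1.
apply: (ideal_mpolyC_unit idI f0); rewrite mulr1 -pihomog0_const.
exact: IH.
Qed.

Lemma ordge1_const f : ordge 1 (f - (f@_0)%:MP).
Proof. by apply/ordge1P; rewrite mcoeffB mcoeffC eqxx mulr1 subrr. Qed.

(** If the components of f up to degree d are in I, the component of degree d + 1 of s f is, modulo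
    I, that of f times s(0). This makes S/I embed in its localization. *)
Lemma homogeneous_saturated s f : s@_0 != 0 -> I (s * f) -> I f.
Proof.
case: (hI) => idI IH s0 Isf; apply: (homogeneousP hI) => d.
elim: d {-2}d (leqnn d) => [|d IHd] e; rewrite ?leqn0.
  move=> /eqP->; have := IH _ 0%N Isf; rewrite !pihomog0_const rmorphM mpolyCM.
  exact: ideal_mpolyC_unit.
rewrite leq_eqVlt => /orP[/eqP->|]; last exact: IHd.
pose g := f - truncp d.+1 f.
have Isg : I (s * g).
  rewrite mulrBr; apply: idealB => //; apply: idealM => //.
  by apply: ideal_sum => // j _; apply: IHd; rewrite -ltnS.
apply: (ideal_mpolyC_unit idI s0); have := IH _ d.+1 Isg.
have -> : s * g = (s@_0)%:MP * g + (s - (s@_0)%:MP) * g by rewrite -mulrDl addrC subrK.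
rewrite pihomogD [X in _ + X](@pihomog_ordge _ _ d.+2) ?addr0 //; last first.
  rewrite -[d.+2]/(1 + d.+1)%N; apply: ordgeM; first exact: ordge1_const.
  exact: ordge_truncp.
have C0 : ((s@_0)%:MP : S) \is 0.-homog.
  by rewrite -[X in X \is _]mulr1 mul_mpolyC rpredZ // dhomog1.
rewrite -[d.+1]add0n (pihomog_homogM d.+1 g C0) /g pihomogB.
suff -> : pihomog mdeg d.+1 (truncp d.+1 f) = 0 by rewrite subr0.
apply/mpolyP => m; rewrite mcoeff_pihomog mcoeff_truncp mcoeff0.
by case: eqP => // ->; rewrite ltnn.
Qed.

End HomogeneousIdeals.

Section ConcreteLocalization.
Variables (k : fieldType) (n : nat) (I : set {mpoly k[n]}).
Hypotheses (hI : homogeneous_ideal I) (I1 : ~ I 1).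
Local Notation S := {mpoly k[n]}.
Local Notation mB := (quot_pi I @` irrelevant_ideal k n).
Local Notation R := (localization_at mB).
Implicit Types (f g s : S).

Let idI : is_ideal I. Proof. by case: hI. Qed.

Lemma quot_irrelevantP f : mB (quot_pi I f) <-> f@_0 = 0.
Proof.
split=> [[g /irrelevantP g0 /quot_piP]|f0]; last first.
  by exists f => //; apply/irrelevantP.
rewrite (ideal_gen_id idI) => /(proper_homogeneous_ordge1 hI I1)/ordge1P.
by rewrite mcoeffB g0 sub0r => /eqP; rewrite oppr_eq0 => /eqP.
Qed.

Lemma denomP s : mul_gen (~` mB) (quot_pi I s) <-> s@_0 != 0.
Proof.
have mc : mul_closed (~` mB).
  split; first by rewrite -(rmorph1 (quot_pi I)) => /quot_irrelevantP/eqP;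
    rewrite mcoeff1 eqxx oner_eq0.
  elim/quot_ind=> x; elim/quot_ind=> y nx ny; rewrite -rmorphM => /quot_irrelevantP.
  by rewrite rmorphM => /eqP; rewrite mulf_eq0 => /orP[]/eqP/quot_irrelevantP.
split=> [|s0]; last by move=> W [_]; apply; move=> /quot_irrelevantP/eqP; apply/negP.
by move=> /(_ (~` mB)) /(_ (conj mc (fun _ => id))) ns; apply/eqP => /quot_irrelevantP.
Qed.

Definition lam f : R := loc_frac (quot_pi I f) (denom1 (~` mB)).

Lemma lamB : zmod_morphism lam.
Proof.
move=> f g; apply: (@addIr _ (lam g)); rewrite subrK /lam loc_fracD.
by apply/loc_fracP; exists (denom1 _); rewrite !val_denomM !val_denom1 rmorphB; ring.
Qed.

Lemma lamM : monoid_morphism lam.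
Proof.
split=> [|f g]; first by rewrite /lam rmorph1.
rewrite /lam loc_fracM; apply/loc_fracP; exists (denom1 _).
by rewrite !val_denomM !val_denom1 rmorphM; ring.
Qed.

HB.instance Definition _ := GRing.isZmodMorphism.Build S R lam lamB.
HB.instance Definition _ := GRing.isMonoidMorphism.Build S R lam lamM.

Lemma lam_frac (x : R) : exists f s, s@_0 != 0 /\ lam s * x = lam f.
Proof.
elim/loc_ind: x => q [d dP]; elim/quot_ind: q => f; elim/quot_ind: d dP => s dP.
have /asboolP/denomP s0 := dP.
exists f, s; split=> //; rewrite /lam loc_fracM; apply/loc_fracP.
by exists (denom1 _); rewrite !val_denomM !val_denom1 /=; ring.
Qed.

Lemma lam_eq0 f : lam f = 0 <-> I f.
Proof.
rewrite -[0](rmorph0 lam); split=> [/loc_fracP[[u uP]]|If].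
  rewrite /= rmorph0 mul0r subr0 mulr1.
  elim/quot_ind: u uP => s /asboolP/denomP s0; rewrite -rmorphM => /quot_pi_eq0.
  rewrite (ideal_gen_id idI).
  exact: homogeneous_saturated.
by congr loc_frac; rewrite rmorph0; apply/quot_pi_eq0; rewrite (ideal_gen_id idI).
Qed.

Lemma lam_unit s : s@_0 != 0 -> exists r, r * lam s = 1.
Proof.
move=> /denomP/asboolP sP; pose d : denom (~` mB) := exist _ (quot_pi I s) sP.
exists (loc_frac 1 d).
rewrite /lam loc_fracM -[RHS]/(loc_frac 1 (denom1 (~` mB))); apply/loc_fracP.
by exists (denom1 _); rewrite !val_denomM !val_denom1 /=; ring.
Qed.

Lemma quot_irrelevant_maximal : maximal_ideal mB.
Proof.
have id0 := @ordge_ideal k n 1.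
split=> [|/[dup]|J idJ J1 mJ].
- split=> [|_ _ [f f0 <-] [g g0 <-]|x _ [f f0 <-]].
  + by exists 0; rewrite ?rmorph0 //; apply/irrelevantP; rewrite mcoeff0.
  + exists (f + g); last by rewrite rmorphD.
    exact: (idealD (irrelevant_is_ideal k n)).
  + elim/quot_ind: x => a; exists (a * f); last by rewrite rmorphM.
    exact: (idealM _ (irrelevant_is_ideal k n)).
- by rewrite -(rmorph1 (quot_pi I)) => _ /quot_irrelevantP/eqP; rewrite mcoeff1 eqxx oner_eq0.
elim/quot_ind=> f Jf; apply/quot_irrelevantP; apply: contrapT => /eqP f0; apply: J1.
have mf : mB (quot_pi I (f - (f@_0)%:MP)) by apply/quot_irrelevantP/ordge1P/ordge1_const.
have := idealB idJ Jf (mJ _ mf); rewrite -rmorphB subKr.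
move=> /(idealM (quot_pi I ((f@_0)^-1)%:MP) idJ).
by rewrite -rmorphM -mpolyCM mulVf // rmorph1.
Qed.

End ConcreteLocalization.

(** * Ideals, primes and regular sequences in the localization *)

Section LocalModel.
Variables (k : fieldType) (n : nat) (I : set {mpoly k[n]}).
Local Notation S := {mpoly k[n]}.
Variables (R : comPzRingType) (lam : {rmorphism S -> R}).
Implicit Types (f g s t : S) (x y r : R) (J P : set S) (K : set R).

(* R is the localization of S/I at the irrelevant ideal, with structure map lam. *)
Definition local_model :=
  [/\ homogeneous_ideal I, ~ I 1,
    forall x, exists f s, s@_0 != 0 /\ lam s * x = lam f,
    forall f, lam f = 0 <-> I f &
    forall s, s@_0 != 0 -> exists r, r * lam s = 1].

Hypothesis lamR : local_model.

Let hI : homogeneous_ideal I. Proof. by case: lamR. Qed.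
Let idI : is_ideal I. Proof. by case: hI. Qed.
Let I1 : ~ I 1. Proof. by case: lamR. Qed.
Let frac x : exists f s, s@_0 != 0 /\ lam s * x = lam f.
Proof. by case: lamR. Qed.
Let lam0 f : lam f = 0 <-> I f. Proof. by case: lamR. Qed.
Let unit s : s@_0 != 0 -> exists r, r * lam s = 1.
Proof. by case: lamR => _ _ _ _; apply. Qed.

Let mcoeff0M s t : (s * t)@_0 != 0 <-> s@_0 != 0 /\ t@_0 != 0.
Proof. by rewrite rmorphM mulf_eq0 negb_or; split=> [/andP[]|[-> ->]]. Qed.

Lemma ideal_lam_unit K s x : is_ideal K -> s@_0 != 0 -> K (lam s * x) -> K x.
Proof.
move=> idK /unit[r rs] /(idealM r idK).
by rewrite mulrA rs mul1r.
Qed.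

(** The extended ideal JR; for an ideal J, single fractions suffice because denominators can be made
    common. *)
Definition extension J : set R := [set x | exists f s, [/\ s@_0 != 0, lam s * x = lam f & J f]].

Lemma extension_lam J f : J f -> extension J (lam f).
Proof.
by move=> Jf; exists f, 1; rewrite !rmorph1 mul1r oner_eq0.
Qed.

Lemma extension_ideal J : is_ideal J -> is_ideal (extension J).
Proof.
move=> idJ; split=> [|x y [f [s [s0 sx Jf]]] [g [t [t0 ty Jg]]]|y x [f [s [s0 sx Jf]]]].
- by rewrite -(rmorph0 lam); exact: (extension_lam (ideal0 idJ)).
- exists (t * f + s * g), (s * t); split; first exact/mcoeff0M.
    rewrite rmorphD !rmorphM -sx -ty.
    have e (a b : R) : a * b * (x + y) = b * (a * x) + a * (b * y) by ring.
    exact: e.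
  by apply: idealD => //; apply: idealM.
have [g [t [t0 ty]]] := frac y.
exists (g * f), (t * s); split; first exact/mcoeff0M.
  by rewrite !rmorphM -ty -sx mulrACA.
exact: idealM.
Qed.

Lemma extension_contract J f : extension J (lam f) ->
  exists s g, [/\ s@_0 != 0, J g & I (s * f - g)].
Proof.
move=> [g [s [s0 sf Jg]]]; exists s, g; split=> //; apply/lam0.
by rewrite rmorphB rmorphM sf subrr.
Qed.

Lemma extension_sub J J' : J `<=` J' -> extension J `<=` extension J'.
Proof. by move=> JJ' x [f [s [? ? /JJ']]]; exists f, s. Qed.

Lemma extension_contract_homogeneous J f : homogeneous_ideal J -> I `<=` J ->
  extension J (lam f) -> J f.
Proof.
move=> [idJ hJ] IJ /extension_contract[s [g [s0 Jg /IJ Isf]]].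
exact: (homogeneous_saturated (conj idJ hJ) s0 (idealBr idJ Jg Isf)).
Qed.

Local Notation mR := (extension (ordge 1)).

Lemma proper_sub_max K : is_ideal K -> ~ K 1 -> K `<=` mR.
Proof.
move=> idK K1 x Kx; have [f [s [s0 sx]]] := frac x; exists f, s; split=> //.
apply/ordge1P; apply: contrapT => /eqP f0; apply: K1.
have [r <-] := unit f0; rewrite -sx.
by apply: idealM => //; apply: idealM.
Qed.

Lemma max_proper : ~ mR 1.
Proof.
rewrite -(rmorph1 lam) => /extension_contract[s [g [s0 /ordge1P g0]]].
move=> /(proper_homogeneous_ordge1 hI I1)/ordge1P/eqP.
by rewrite mulr1 mcoeffB g0 subr0 (negbTE s0).
Qed.

Lemma local_max m : maximal_ideal m -> m = mR.
Proof.
move=> [idm m1 maxm]; have sub := proper_sub_max idm m1.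
apply/seteqP; split=> //; apply: maxm => //; last exact: max_proper.
exact/extension_ideal/ordge_ideal.
Qed.

Lemma model_noetherian : noetherian R.
Proof.
move=> K idK.
have idJ : is_ideal [set f | K (lam f)].
  split=> [|f g|f g] /=; first by rewrite rmorph0; apply: ideal0.
    by rewrite rmorphD; apply: idealD.
  by rewrite rmorphM; apply: idealM.
have [x Ex] := @mpoly_noetherian k n _ idJ.
exists (map lam x); apply/seteqP; split=> [y Ky|].
  have [f [s [s0 sy]]] := frac y.
  apply: (ideal_lam_unit (ideal_genP _) s0); rewrite sy.
  have : [set f | K (lam f)] f by rewrite /= -sy; apply: idealM.
  rewrite Ex; apply: (@ideal_gen_sub _ _ [set f | ideal_gen [set` map lam x] (lam f)]).
    have idg := ideal_genP [set` map lam x].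
    split=> [|g h|g h] /=; first by rewrite rmorph0; exact: (ideal0 idg).
      by rewrite rmorphD; apply: (idealD idg).
    by rewrite rmorphM; apply: (idealM _ idg).
  by move=> v /= vx; apply: sub_ideal_gen; apply: map_f.
apply: ideal_gen_sub => // _ /= /mapP[f fx ->].
have : ideal_gen [set` x] f by apply: sub_ideal_gen.
by rewrite -Ex.
Qed.

Lemma model_local : local_ring mR.
Proof.
have idm : is_ideal mR by exact/extension_ideal/ordge_ideal.
split; [exact: model_noetherian| |exact: local_max].
split=> // [|K idK K1 mK]; first exact: max_proper.
exact: proper_sub_max.
Qed.

Lemma model_max_gen : mR = ideal_gen [set` [seq lam 'X_i | i <- enum 'I_n]].
Proof.
have idg := ideal_genP [set` [seq lam 'X_i | i <- enum 'I_n]].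
apply/seteqP; split=> [x [f [s [s0 sx fm]]]|].
  apply: (ideal_lam_unit idg s0); rewrite sx.
  have [g ->] := ordge1_sum fm; rewrite rmorph_sum; apply: (ideal_sum _ idg) => i _.
  rewrite rmorphM; apply: (ideal_mulr _ idg); apply: sub_ideal_gen.
  by apply/mapP; exists i; rewrite // mem_enum.
apply: ideal_gen_sub => [|_ /= /mapP[i _ ->]].
  exact/extension_ideal/ordge_ideal.
by apply: extension_lam; apply: ordgeXU.
Qed.

Lemma model_max_exp i : ideal_exp mR i = extension (ordge i).
Proof.
elim: i => [|i IHi] /=.
  apply/seteqP; split=> // x _; have [f [s [s0 sx]]] := frac x.
  by exists f, s.
have idx := extension_ideal (@ordge_ideal k n i.+1).
apply/seteqP; split.
  apply: ideal_gen_sub => // _ [x [f [s [s0 sx f1]]] [y + <-]].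
  rewrite IHi => -[g [t [t0 ty gi]]]; exists (f * g), (s * t); split.
  - exact/mcoeff0M.
  - by rewrite !rmorphM mulrACA sx ty.
  - exact: (@ordgeM _ _ 1).
move=> x [f [s [s0 sx fi]]].
have idm := ideal_genP [set x * y | x in mR & y in ideal_exp mR i].
apply: (ideal_lam_unit idm s0); rewrite {}sx; move: fi.
apply: (@ordge_ind _ _ [set f | ideal_mul mR (ideal_exp mR i) (lam f)]).
  split=> [|g h|g h] /=; first by rewrite rmorph0; exact: (ideal0 idm).
    by rewrite rmorphD; exact: (idealD idm).
  by rewrite rmorphM; exact: (idealM _ idm).
move=> m /(@mpolyXS k n i)[j [m' [-> im']]] /=; rewrite rmorphM.
apply: sub_ideal_gen; exists (lam 'X_j); first exact/extension_lam/ordgeXU.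
exists (lam 'X_[m']) => //; rewrite IHi; apply: extension_lam.
by apply: ordge_le im' _; apply: ordgeX.
Qed.

Lemma extension_prime P : prime_ideal P -> I `<=` P -> P `<=` ordge 1 ->
  prime_ideal (extension P) /\ forall f, extension P (lam f) <-> P f.
Proof.
move=> [idP P1 PM] IP Pm.
have contr f : extension P (lam f) <-> P f.
  split=> [/extension_contract[s [g [s0 Pg /IP Isf]]]|]; last exact: extension_lam.
  have /PM[/Pm/ordge1P/eqP|//] := idealBr idP Pg Isf.
  by rewrite (negbTE s0).
have idE := extension_ideal idP.
split=> //; split=> // [|x y Exy].
  by rewrite -(rmorph1 lam) contr.
have [f [s [s0 sx]]] := frac x; have [g [t [t0 ty]]] := frac y.
have : P (f * g).
  apply/contr; rewrite rmorphM -sx -ty mulrACA.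
  exact: (idealM _ idE).
move=> /PM[Pf|Pg]; [left; exists f, s|right; exists g, t]; by [].
Qed.

Lemma model_prime_chain l (C : nat -> set S) :
    (forall i, (i <= l)%N -> prime_ideal (C i)) ->
    (forall i, (i < l)%N -> C i `<` C i.+1) ->
    I `<=` C 0%N -> C l `<=` ordge 1 -> prime_chain R l.
Proof.
move=> Cp Clt IC Cm.
have mono i j : (i <= j)%N -> (j <= l)%N -> C i `<=` C j.
  move=> + jl; elim: j jl => [|j IHj] jl; first by rewrite leqn0 => /eqP->.
  rewrite leq_eqVlt => /orP[/eqP-> //|ij].
  by apply: subset_trans (IHj (ltnW jl) ij) _; case: (Clt j jl).
have ext i : (i <= l)%N -> prime_ideal (extension (C i)) /\
    forall f, extension (C i) (lam f) <-> C i f.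
  move=> il; apply: extension_prime; first exact: Cp.
    by apply: subset_trans IC _; apply: mono.
  by apply: subset_trans Cm; apply: mono.
exists (fun i => extension (C i)); split=> i il; first by case: (ext i il).
split; first by apply: extension_sub; case: (Clt i il).
move=> sub; case: (Clt i il) => _; apply=> f Cf.
by apply/(ext i (ltnW il)).2/sub/(ext i.+1 il).2.
Qed.

Lemma model_prime_chain_contract l : prime_chain R l -> prime_chain S l.
Proof.
move=> [P [Pp Plt]]; exists (fun i => [set f | P i (lam f)]); split=> i il.
  have [idP P1 PM] := Pp i il.
  split=> [||f g] /=; last by rewrite rmorphM => /PM.
    split=> [|f g|f g] /=; first by rewrite rmorph0; apply: ideal0.
      by rewrite rmorphD; apply: idealD.
    by rewrite rmorphM; apply: idealM.
  by rewrite rmorph1.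
have [sub nsub] := Plt i il; split=> [f /=|nsub']; first exact: sub.
apply: nsub => x Px; have [f [s [s0 sx]]] := frac x.
have [idP _ _] := Pp i (ltnW il); have [idP' _ _] := Pp i.+1 il.
apply: (ideal_lam_unit idP s0); rewrite sx; apply: nsub'.
by rewrite /= -sx; apply: idealM.
Qed.

(** [depth_koszul_vanish] for the contractions to S of the ideals generated by the initial segments
    of a. The numerators [al j] differ from the terms of a by units, and one with nonzero constant
    term would make a generate the unit ideal. *)
Lemma regular_seq_koszul_vanish (a : seq R) p (z : {set 'I_n} -> S^o) :
    regular_seq a -> (n < p + size a)%N -> extdeg p z ->
    (forall A, I (koszul (fun i => 'X_i : S) z A)) ->
  exists2 v, extdeg p.+1 v & forall A, I (z A - koszul (fun i => 'X_i : S) v A).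
Proof.
move=> [areg a1] np zp dz.
have [al alP] := choice (fun j => frac a`_j).
have [s sP] := choice alP.
pose Q j f := ideal_gen [set` take j a] (lam f).
have idQ j : is_ideal (Q j).
  have idg := ideal_genP [set` take j a].
  split=> [|f g|f g]; rewrite /Q; first by rewrite rmorph0; exact: (ideal0 idg).
    by rewrite rmorphD; exact: (idealD idg).
  by rewrite rmorphM; exact: (idealM _ idg).
have Q0 f : Q 0%N f <-> I f by rewrite /Q take0 ideal_gen_nil; apply: lam0.
rewrite -[n]addn0 in np.
have [j je|A|v vp vE] := @depth_koszul_vanish k n Q al (size a) idQ _ 0 p z isT np zp.
- have [sj0 sj] := sP j; have tj := take_nth 0 je.
  have idg := ideal_genP [set` take j a].
  have idg1 := ideal_genP [set` take j.+1 a].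
  have sub : ideal_gen [set` take j a] `<=` ideal_gen [set` take j.+1 a].
    apply: ideal_gen_mono => y /=; rewrite tj mem_rcons inE => ->.
    by rewrite orbT.
  split=> [|f|f|/=|f].
  + apply/ordge1P; apply: contrapT => /eqP al0; apply: a1.
    have idga := ideal_genP [set` a]; have [r <-] := unit al0.
    rewrite -sj; apply: (idealM _ idga); apply: (idealM _ idga).
    by apply: sub_ideal_gen; apply: mem_nth.
  + rewrite /Q rmorphM -sj -mulrA => /(ideal_lam_unit idg sj0).
    exact: areg.
  + exact: sub.
  + rewrite /Q -sj; apply: (idealM _ idg1); apply: sub_ideal_gen.
    by rewrite /= tj mem_rcons mem_head.
  + rewrite /Q tj ideal_gen_rcons => -[y gy].
    have [g [t [t0 ty]]] := frac y.
    exists (s j * t), g; split; first exact/mcoeff0M.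
    have := idealM (lam (s j) * lam t) idg gy; congr (ideal_gen _ _).
    rewrite rmorphB !rmorphM -ty -sj.
    have e (b c u w v : R) : b * c * (u - v * w) = b * c * u - b * v * (c * w) by ring.
    exact: e.
- exact/Q0.
by exists v => // A; apply/Q0.
Qed.

End LocalModel.

Lemma concrete_local_model (k : fieldType) n (I : set {mpoly k[n]}) :
  homogeneous_ideal I -> ~ I 1 -> local_model I (@lam k n I).
Proof.
move=> hI I1; split=> //; first exact: lam_frac.
  exact: lam_eq0.
exact: lam_unit.
Qed.

(** * Completion *)

Section OrderSums.
Variables (k : fieldType) (n : nat).
Local Notation S := {mpoly k[n]}.
Implicit Types (f g s l : S) (J : set S).

Lemma inverse_mod_order s i : s@_0 != 0 -> exists h, ordge i (s * h - 1).
Proof.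
move=> s0; elim: i => [|i [h hi]]; first by exists 0.
(* The correction multiplies the error s h - 1 by 1 - s / s(0), which has order at least 1. *)
exists (h - ((s@_0)^-1)%:MP * (s * h - 1)).
have e (c r : S) : s * (h - c * r) - 1 = (s * h - 1) - s * c * r by ring.
rewrite e -[X in X - _]mul1r -mulrBl -[i.+1]/(1 + i)%N; apply: ordgeM => //.
by apply/ordge1P; rewrite mcoeffB rmorphM rmorph1 /= mcoeffC eqxx mulr1 mulfV // subrr.
Qed.

(** The ideal J + m^i, in a form that exhibits the summand of order i. *)
Definition ideal_order J i : set S := [set g | exists2 a, ordge i a & J (g - a)].

Lemma ideal_order_ideal J i : is_ideal J -> is_ideal (ideal_order J i).
Proof.
move=> idJ; have ido := @ordge_ideal k n i.
split=> [|f g [a ai Jf] [b bi Jg]|c f [a ai Jf]].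
- by exists 0; [apply: ideal0|rewrite subrr; apply: ideal0].
- exists (a + b); first exact: (idealD ido).
  by rewrite opprD addrACA; apply: idealD.
- by exists (c * a); [exact: (idealM _ ido)|rewrite -mulrBr; apply: idealM].
Qed.

Lemma ordge_ideal_order J i f : is_ideal J -> ordge i f -> ideal_order J i f.
Proof. by move=> idJ fi; exists f; rewrite // subrr; apply: ideal0. Qed.

Lemma sub_ideal_order J i f : J f -> ideal_order J i f.
Proof. by move=> Jf; exists 0; rewrite ?subr0 //; exact: (ideal0 (@ordge_ideal k n i)). Qed.

Lemma ideal_order_mono J J' i : J `<=` J' -> ideal_order J i `<=` ideal_order J' i.
Proof. by move=> JJ' f [a ai /JJ']; exists a. Qed.

Lemma ideal_order_absorb J i : is_ideal J -> @ordge k n i `<=` J -> ideal_order J i `<=` J.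
Proof. by move=> idJ oJ f [a /oJ Ja]; apply: (idealBr idJ Ja). Qed.

Lemma ideal_order_pihomog J i d f : homogeneous_ideal J -> (d < i)%N ->
  ideal_order J i f -> J (pihomog mdeg d f).
Proof.
move=> [_ hJ] di [a ai Ja]; have := hJ _ d Ja.
by rewrite pihomogB (pihomog_ordge ai di) subr0.
Qed.

Lemma ideal_order_homogeneous J i : homogeneous_ideal J ->
  homogeneous_ideal (ideal_order J i).
Proof.
move=> [idJ hJ]; split=> [|f d [a ai Jf]]; first exact: ideal_order_ideal.
exists (pihomog mdeg d a); first exact: ordge_pihomog.
by rewrite -pihomogB; apply: hJ.
Qed.

Lemma ideal_adjoin_homogeneous J e l : homogeneous_ideal J -> l \is e.-homog ->
  homogeneous_ideal (ideal_adjoin J l).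
Proof.
move=> [idJ hJ] le; split=> [|f d [y Jf]]; first exact: ideal_adjoinP.
have := hJ _ d Jf; rewrite pihomogB; have [de|ed] := ltnP d e.
  rewrite (@pihomog_ordge _ _ e d (l * y)) ?subr0 //; first exact: sub_ideal_adjoin.
  by apply: (ideal_mulr _ (@ordge_ideal k n e)); apply: ordge_homog.
rewrite -{2}(subnKC ed) (pihomog_homogM _ _ le) => Jd.
by exists (pihomog mdeg (d - e) y).
Qed.

Lemma pihomog0_linearM l f : l \is 1.-homog -> pihomog mdeg 0 (l * f) = 0.
Proof.
move=> l1; apply: (@pihomog_ordge _ _ 1) => //.
by apply: (ideal_mulr _ (@ordge_ideal k n 1)); apply: ordge_homog.
Qed.

Lemma truncp_linearM l f i : l \is 1.-homog -> truncp i.+1 (l * f) = l * truncp i f.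
Proof.
move=> l1; rewrite /truncp big_ord_recl pihomog0_linearM // add0r mulr_sumr.
by apply: eq_bigr => j _; rewrite -(pihomog_homogM j f l1).
Qed.

End OrderSums.

Section CompletedModel.
Variables (k : fieldType) (n : nat) (I : set {mpoly k[n]}).
Local Notation S := {mpoly k[n]}.
Variables (R : comPzRingType) (lam : {rmorphism S -> R}).
Hypothesis lamR : local_model I lam.
Implicit Types (f g h s l : S) (J : set S).

Let hI : homogeneous_ideal I. Proof. by case: lamR. Qed.
Let idI : is_ideal I. Proof. by case: hI. Qed.
Let I1 : ~ I 1. Proof. by case: lamR. Qed.

Local Notation mR := (extension lam (@ordge k n 1)).
Local Notation E := (ideal_exp mR).
Local Notation C := (completion mR).
Let idE i : is_ideal (E i). Proof. exact: ideal_expP. Qed.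

(** The quotient of R by the i-th power of its maximal ideal is thereby S/(I + m^i), the first step
    in describing the completion by polynomials. *)
Lemma exp_lam i g : E i (lam g) <-> ideal_order I i g.
Proof.
rewrite (model_max_exp lamR); split=> [Ei|[a ai Ia]].
  apply: (extension_contract_homogeneous lamR (ideal_order_homogeneous i hI)).
    by move=> f If; apply: sub_ideal_order.
  by apply: extension_sub Ei => f fi; apply: ordge_ideal_order.
have -> : lam g = lam a.
  by apply/eqP; rewrite -subr_eq0 -rmorphB; apply/eqP; case: lamR => _ _ _ -> _.
exact: extension_lam.
Qed.

Lemma exp_le i j : (i <= j)%N -> E j `<=` E i.
Proof.
move=> ij; rewrite !(model_max_exp lamR); apply: extension_sub => f.
exact: ordge_le.
Qed.

Lemma exp_approx i (x : R) : exists g, E i (x - lam g).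
Proof.
have [_ _ frac _ _] := lamR; have [f [s [s0 sx]]] := frac x.
have [h hi] := inverse_mod_order i s0; exists (h * f).
apply: (ideal_lam_unit lamR (idE i) s0); rewrite mulrBr sx -!rmorphM -rmorphB.
apply/exp_lam/ordge_ideal_order => //.
have -> : f - s * (h * f) = - f * (s * h - 1) by rewrite mulrBr mulr1 opprK mulNr; ring.
by apply: (idealM _ (@ordge_ideal k n i)).
Qed.

Implicit Types (u v : coherent_seq mR) (c : C).

Let val0 i : (val (0 : coherent_seq mR)) i = 0. Proof. by []. Qed.
Let valB u v i : (val (u - v)) i = val u i - val v i. Proof. by []. Qed.
Let valD u v i : (val (u + v)) i = val u i + val v i. Proof. by []. Qed.
Let valM u v i : (val (u * v)) i = val u i * val v i. Proof. by []. Qed.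

Lemma coherentP u i j : (i <= j)%N -> E i (val u j - val u i).
Proof.
elim: j => [|j IHj]; first by rewrite leqn0 => /eqP->; rewrite subrr; apply: ideal0.
rewrite leq_eqVlt => /orP[/eqP->|ij]; first by rewrite subrr; apply: ideal0.
have e (x y z : R) : x - z = (x - y) + (y - z) by ring.
rewrite (e _ (val u j)); apply: (idealD (idE i)); last exact: IHj.
by apply: (exp_le (ij : (i <= j)%N)); case: u {IHj} => w /= /asboolP; apply.
Qed.

Let nullset : set (coherent_seq mR) := [set u | forall i, E i (val u i)].

Let nullset_ideal : is_ideal nullset.
Proof.
split=> [i|u v u0 v0 i|u v v0 i].
- by rewrite val0; apply: (ideal0 (idE i)).
- by rewrite valD; apply: (idealD (idE i)).
- by rewrite valM; apply: (idealM _ (idE i)).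
Qed.

Definition cpi u : C := quot_pi nullset u.

Lemma cpiP u v : cpi u = cpi v <-> forall i, E i (val u i - val v i).
Proof.
split=> [/quot_piP|uv]; first by rewrite (ideal_gen_id nullset_ideal).
by apply/quot_piP; rewrite (ideal_gen_id nullset_ideal).
Qed.

Lemma completion_ind (P : C -> Prop) : (forall u, P (cpi u)) -> forall c, P c.
Proof. by move=> Pu; elim/quot_ind. Qed.

(** g represents the residue of c modulo the i-th power of the maximal ideal; [approx_cpi] shows
    that the choice of u is immaterial. *)
Definition approx c i g := exists2 u, c = cpi u & E i (val u i - lam g).

Lemma approx_cpi u i g : approx (cpi u) i g <-> E i (val u i - lam g).
Proof.
split=> [[v /cpiP/(_ i) uv vg]|ug]; last by exists u.
have e (x y z : R) : x - z = (x - y) + (y - z) by ring.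
by rewrite (e _ (val v i)); apply: (idealD (idE i)).
Qed.

Lemma approx_ex c i : exists g, approx c i g.
Proof.
elim/completion_ind: c => u; have [g ug] := exp_approx i (val u i).
by exists g; apply/approx_cpi.
Qed.

Lemma approx_eqmod c i g h : approx c i g -> (approx c i h <-> ideal_order I i (g - h)).
Proof.
elim/completion_ind: c => u /approx_cpi ug; rewrite approx_cpi -exp_lam rmorphB.
have e (x y z : R) : y - z = (x - z) - (x - y) by ring.
have e' (x y z : R) : x - z = (x - y) + (y - z) by ring.
split=> H; first by rewrite (e (val u i)); apply: (idealB (idE i)).
by rewrite (e' _ (lam g)); apply: (idealD (idE i)).
Qed.

Lemma approxB c c' i g h : approx c i g -> approx c' i h -> approx (c - c') i (g - h).
Proof.
elim/completion_ind: c => u; elim/completion_ind: c' => v /approx_cpi ug /approx_cpi vh.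
rewrite -[cpi u - cpi v]/(quot_pi nullset u - quot_pi nullset v) -rmorphB.
apply/approx_cpi; rewrite valB rmorphB.
have e (x y z w : R) : x - z - (y - w) = (x - y) - (z - w) by ring.
by rewrite e; apply: (idealB (idE i)).
Qed.

Lemma approxM c c' i g h : approx c i g -> approx c' i h -> approx (c * c') i (g * h).
Proof.
elim/completion_ind: c => u; elim/completion_ind: c' => v /approx_cpi ug /approx_cpi vh.
rewrite -[cpi u * cpi v]/(quot_pi nullset u * quot_pi nullset v) -rmorphM.
apply/approx_cpi; rewrite valM rmorphM.
have e (x y z w : R) : x * z - y * w = (x - y) * z + y * (z - w) by ring.
rewrite e; apply: (idealD (idE i)); last exact: (idealM _ (idE i)).
exact: (ideal_mulr _ (idE i)).
Qed.

Lemma approx_le c i j g : (i <= j)%N -> approx c j g -> approx c i g.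
Proof.
move=> ij; elim/completion_ind: c => u /approx_cpi ug; apply/approx_cpi.
have e (x y z : R) : x - z = (y - z) - (y - x) by ring.
rewrite (e _ (val u j)); apply: (idealB (idE i)); first exact: exp_le ug.
exact: coherentP.
Qed.

Lemma approx_eq0 c : (forall i, approx c i 0) -> c = 0.
Proof.
elim/completion_ind: c => u u0; rewrite -[0](rmorph0 (quot_pi nullset)).
by apply/cpiP => i; have /approx_cpi := u0 i; rewrite rmorph0.
Qed.

Lemma approx_limit (g : nat -> S) : (forall i, ideal_order I i (g i.+1 - g i)) ->
  exists c, forall i, approx c i (g i).
Proof.
move=> gc; have gP : coherent mR (fun i => lam (g i)).
  by apply/asboolP => i; rewrite -rmorphB; apply/exp_lam.
pose u : coherent_seq mR := exist _ (fun i => lam (g i)) gP.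
exists (cpi u) => i; apply/approx_cpi => /=.
by rewrite subrr; apply: (ideal0 (idE i)).
Qed.

Lemma coherent_const f : coherent mR (fun=> lam f).
Proof. by apply/asboolP => i; rewrite subrr; apply: (ideal0 (idE i)). Qed.

Definition const_seq f : coherent_seq mR := exist _ (fun=> lam f) (coherent_const f).

Definition to_completion f : C := cpi (const_seq f).

Lemma to_completionB : zmod_morphism to_completion.
Proof.
move=> f g; rewrite /to_completion -[RHS]/(quot_pi nullset _ - quot_pi nullset _) -rmorphB.
congr cpi; apply: val_inj; apply: functional_extensionality_dep => i.
by rewrite valB /= rmorphB.
Qed.

Lemma to_completionM : monoid_morphism to_completion.
Proof.
split=> [|f g].
  rewrite /to_completion -[RHS](rmorph1 (quot_pi nullset)); congr cpi; apply: val_inj.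
  by apply: functional_extensionality_dep => i; rewrite /= rmorph1.
rewrite /to_completion -[RHS]/(quot_pi nullset _ * quot_pi nullset _) -rmorphM.
congr cpi; apply: val_inj; apply: functional_extensionality_dep => i.
by rewrite valM /= rmorphM.
Qed.

HB.instance Definition _ := GRing.isZmodMorphism.Build S C to_completion to_completionB.
HB.instance Definition _ := GRing.isMonoidMorphism.Build S C to_completion to_completionM.

Lemma approx_const f i : approx (to_completion f) i f.
Proof. by apply/approx_cpi; rewrite /= subrr; apply: (ideal0 (idE i)). Qed.

Lemma approx1 i : approx 1 i 1.
Proof. by have := approx_const 1 i; rewrite rmorph1. Qed.

(** The closure of J in the completion. [ideal_gen_completed] identifies it with the ideal generated
    by the linear forms when J is I with these forms adjoined. *)
Definition completed_ideal J : set C :=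
  [set c | forall i g, approx c i g -> ideal_order J i g].

Lemma completed_ideal_lim J c : is_ideal J -> I `<=` J ->
  (forall i, exists2 g, approx c i g & ideal_order J i g) -> completed_ideal J c.
Proof.
move=> idJ IJ cJ i h ch; have [g cg Jg] := cJ i.
have idJi := ideal_order_ideal i idJ.
have := (approx_eqmod h cg).1 ch => /(ideal_order_mono IJ).
exact: (idealBl idJi).
Qed.

Lemma completed_ideal_ideal J : is_ideal J -> I `<=` J -> is_ideal (completed_ideal J).
Proof.
move=> idJ IJ; have idJi i := ideal_order_ideal i idJ.
have sub c c' : completed_ideal J c -> completed_ideal J c' -> completed_ideal J (c - c').
  move=> Jc Jc'; apply: completed_ideal_lim => // i.
  have [g cg] := approx_ex c i; have [h ch] := approx_ex c' i.
  by exists (g - h); [apply: approxB|apply: (idealB (idJi i)); [apply: Jc|apply: Jc']].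
have z0 : completed_ideal J 0.
  apply: completed_ideal_lim => // i; exists 0; last exact: (ideal0 (idJi i)).
  by have := approx_const 0 i; rewrite rmorph0.
split=> // [c c' Jc Jc'|a c Jc].
  by rewrite -[c']opprK -[- c']sub0r; apply: (sub) => //; exact: sub.
apply: completed_ideal_lim => // i.
have [g cg] := approx_ex c i; have [h ah] := approx_ex a i.
by exists (h * g); [apply: approxM|apply: (idealM _ (idJi i)); apply: Jc].
Qed.

Lemma completed_ideal_base : completed_ideal I = [set 0].
Proof.
apply/seteqP; split=> [c Ic|_ ->]; last exact: (ideal0 (completed_ideal_ideal idI _)).
apply: approx_eq0 => i; have [g cg] := approx_ex c i.
by apply/(approx_eqmod 0 cg); rewrite subr0; apply: Ic.
Qed.

(** The quotient by l is built degree by degree: the component of degree i of an approximation of c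
    is l b_i modulo J, with b_i of degree i - 1, and the series of the b_i converges to the required
    y. *)
Lemma completed_ideal_adjoin J l : homogeneous_ideal J -> I `<=` J -> l \is 1.-homog ->
  completed_ideal (ideal_adjoin J l) = ideal_adjoin (completed_ideal J) (to_completion l).
Proof.
move=> hJ IJ l1; have [idJ HJ] := hJ.
have hA := ideal_adjoin_homogeneous hJ l1; have [idA HA] := hA.
have JA : J `<=` ideal_adjoin J l by apply: sub_ideal_adjoin.
have IA : I `<=` ideal_adjoin J l by apply: subset_trans JA.
apply/seteqP; split=> c; last first.
  move=> [y Jy]; apply: completed_ideal_lim => // i.
  have [g cg] := approx_ex c i; have [h yh] := approx_ex y i; exists g => //.
  have := Jy _ _ (approxB cg (approxM (approx_const l i) yh)).
  move=> [a ai Ja]; exists a => //; exists h.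
  by rewrite -addrA (addrC (- a)) addrA.
move=> Ac; have [G GP] := choice (approx_ex c).
have /choice[b0 b0P] i : exists b, J (pihomog mdeg i (G i.+1) - l * b).
  exact: (ideal_order_pihomog hA (ltnSn i) (Ac _ _ (GP i.+1))).
pose b i : S := if i is i'.+1 then pihomog mdeg i' (b0 i) else 0.
have bP i : J (pihomog mdeg i (G i.+1) - l * b i).
  have := HJ _ i (b0P i); rewrite pihomogB pihomog_id; congr (J (_ - _)).
  case: i => [|i] /=; first by rewrite mulr0 pihomog0_linearM.
  by rewrite -(pihomog_homogM i _ l1).
(* As [b i] has degree i - 1, the term of index N is included so that the differences [b N.+1] have
   order exactly what [approx_limit] asks at N. *)
pose B N := \sum_(i < N.+1) b i.
have [y yB] : exists y, forall N, approx y N (B N).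
  apply: approx_limit => N; have -> : B N.+1 = B N + b N.+1 by rewrite /B big_ord_recr.
  rewrite [B N + _]addrC addrK.
  by apply: ordge_ideal_order => //; apply: ordge_homog (pihomogP _ _ _).
exists y; apply: completed_ideal_lim => // N.
exists (G N - l * B N); first exact: approxB (GP N) (approxM (approx_const l N) (yB N)).
have idJN := ideal_order_ideal N idJ.
have e (x z w : S) : x - w = (x - z) + (z - w) by ring.
rewrite (e _ (truncp N (G N))); apply: (idealD idJN).
  by apply: ordge_ideal_order => //; apply: ordge_truncp.
rewrite mulr_sumr big_ord_recr /= opprD addrA; apply: (idealB idJN).
  apply: sub_ideal_order; rewrite /truncp -sumrB; apply: ideal_sum => // i _.
  apply: (idealBr idJ (bP i)); rewrite opprB addrA subrK -pihomogB; apply: IJ.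
  apply: (ideal_order_pihomog hI (ltnSn i)).
  by apply/(approx_eqmod _ (approx_le (ltn_ord i) (GP N))); apply: GP.
apply: (idealBl idJN _ (sub_ideal_order N (bP N))).
by apply: ordge_ideal_order => //; apply: ordge_homog (pihomogP _ _ _).
Qed.

(** Approximating to order i + 1 makes up for the degree of l: truncating l g below degree i + 1
    gives l times the truncation of g below degree i, and l cancels modulo J. *)
Lemma completed_ideal_regular J l c : homogeneous_ideal J -> I `<=` J ->
    l \is 1.-homog -> (forall f, J (l * f) -> J f) ->
  completed_ideal J (to_completion l * c) -> completed_ideal J c.
Proof.
move=> hJ IJ l1 lreg Jlc; have [idJ _] := hJ.
apply: completed_ideal_lim => // i; have [g cg] := approx_ex c i.+1.
exists g; first exact: approx_le cg.
have [a ai Ja] := Jlc _ _ (approxM (approx_const l i.+1) cg).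
have := truncp_homogeneous i.+1 hJ Ja.
have -> : truncp i.+1 (l * g - a) = truncp i.+1 (l * g).
  apply: eq_bigr => j _; rewrite pihomogB (pihomog_ordge ai) ?subr0 //.
rewrite truncp_linearM // => /lreg Jt.
exists (g - truncp i g); first exact: ordge_truncp.
by rewrite opprB addrC subrK.
Qed.

Lemma completed_ideal_approx J T c g : is_ideal J -> I `<=` J -> @ordge k n T `<=` J ->
  approx c T g -> (completed_ideal J c <-> J g).
Proof.
move=> idJ IJ TJ cg; split=> [Jc|Jg].
  exact: (ideal_order_absorb idJ TJ (Jc _ _ cg)).
apply: completed_ideal_lim => // i; have [iT|Ti] := leqP i T.
  by exists g; [apply: approx_le cg|apply: sub_ideal_order].
have [h ch] := approx_ex c i; exists h => //; apply: sub_ideal_order.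
have := (approx_eqmod h cg).1 (approx_le (ltnW Ti) ch).
move=> /(ideal_order_mono IJ)/(ideal_order_absorb idJ TJ).
exact: (idealBl idJ).
Qed.

Lemma completed_ideal_proper J : homogeneous_ideal J -> I `<=` J -> ~ J 1 ->
  ~ completed_ideal J 1.
Proof.
move=> hJ IJ J1 /(_ 1%N 1 (approx1 1)) [a a1 Ja]; have [idJ _] := hJ.
have /ordge1P := proper_homogeneous_ordge1 hJ J1 Ja.
by move: a1 => /ordge1P; rewrite mcoeffB => ->; rewrite subr0 rmorph1 => /eqP; rewrite oner_eq0.
Qed.

End CompletedModel.

(** * Regular sequences of linear forms and reduction to dimension zero *)

Section LinearSequences.
Variables (k : fieldType) (n : nat) (I : set {mpoly k[n]}).
Local Notation S := {mpoly k[n]}.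
Implicit Types (f g l : S) (ls : seq S) (P : set S).

Definition adjoin_seq ls : set S := foldl (@ideal_adjoin S) I ls.

Lemma adjoin_seq_rcons ls l : adjoin_seq (rcons ls l) = ideal_adjoin (adjoin_seq ls) l.
Proof. exact: foldl_rcons. Qed.

Definition linear_regular_seq ls := forall j, (j < size ls)%N ->
  ls`_j \is 1.-homog /\
  forall f, adjoin_seq (take j ls) (ls`_j * f) -> adjoin_seq (take j ls) f.

Lemma linear_regular_seq_rcons ls l : linear_regular_seq (rcons ls l) <->
  [/\ linear_regular_seq ls, l \is 1.-homog &
    forall f, adjoin_seq ls (l * f) -> adjoin_seq ls f].
Proof.
split=> [reg|[reg l1 lreg] j].
  have [] := reg (size ls); first by rewrite size_rcons.
  rewrite nth_rcons ltnn eqxx -cats1 take_size_cat // => l1 lreg; split=> // j js.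
  have [] := reg j; first by rewrite size_rcons ltnW.
  by rewrite nth_rcons js -cats1 takel_cat // ltnW.
rewrite size_rcons ltnS leq_eqVlt nth_rcons => /orP[/eqP->|js].
  by rewrite ltnn eqxx -cats1 take_size_cat.
rewrite js -cats1 takel_cat; last exact: ltnW.
exact: reg.
Qed.

Hypothesis hI : homogeneous_ideal I.
Hypothesis I1 : ~ I 1.

Lemma adjoin_seq_homogeneous ls : {in ls, forall l, l \is 1.-homog} ->
  homogeneous_ideal (adjoin_seq ls).
Proof.
elim/last_ind: ls => [|ls l IHls] lsh; first exact: hI.
rewrite adjoin_seq_rcons; apply: (ideal_adjoin_homogeneous (e := 1)).
  by apply: IHls => l' l'ls; apply: lsh; rewrite mem_rcons inE l'ls orbT.
by apply: lsh; rewrite mem_rcons mem_head.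
Qed.

Lemma linear_regular_seq_homog ls : linear_regular_seq ls ->
  {in ls, forall l, l \is 1.-homog}.
Proof. by move=> reg l /(nthP 0)[j js <-]; case: (reg j js). Qed.

Lemma sub_adjoin_seq ls : {in ls, forall l, l \is 1.-homog} -> I `<=` adjoin_seq ls.
Proof.
elim/last_ind: ls => [|ls l IHls] lsh; first exact: subset_refl.
rewrite adjoin_seq_rcons; have lsh' : {in ls, forall l, l \is 1.-homog}.
  by move=> l' l'ls; apply: lsh; rewrite mem_rcons inE l'ls orbT.
by apply: subset_trans (IHls lsh') (sub_ideal_adjoin _ _); case: (adjoin_seq_homogeneous lsh').
Qed.

Lemma adjoin_seq_min ls P : is_ideal P -> I `<=` P -> {in ls, forall l, P l} ->
  adjoin_seq ls `<=` P.
Proof.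
move=> idP IP; elim/last_ind: ls => [|ls l IHls] lsP; first exact: IP.
rewrite adjoin_seq_rcons; apply: ideal_adjoin_min => //; last by apply: lsP; rewrite mem_rcons mem_head.
by apply: IHls => l' l'ls; apply: lsP; rewrite mem_rcons inE l'ls orbT.
Qed.

Lemma mem_adjoin_seq ls l : {in ls, forall l, l \is 1.-homog} -> l \in ls -> adjoin_seq ls l.
Proof.
elim/last_ind: ls => // ls l' IHls lsh.
have lsh' : {in ls, forall l, l \is 1.-homog}.
  by move=> a als; apply: lsh; rewrite mem_rcons inE als orbT.
have [idJ _] := adjoin_seq_homogeneous lsh'.
rewrite adjoin_seq_rcons mem_rcons inE => /orP[/eqP->|lls].
  exact: mem_ideal_adjoin.
by apply: sub_ideal_adjoin => //; apply: IHls.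
Qed.

Lemma adjoin_seq_proper ls : {in ls, forall l, l \is 1.-homog} -> ~ adjoin_seq ls 1.
Proof.
move=> lsh J1; suff /(_ 1 J1)/ordge1P/eqP : adjoin_seq ls `<=` @ordge k n 1.
  by rewrite rmorph1 oner_eq0.
apply: adjoin_seq_min; first exact: ordge_ideal.
  exact: proper_homogeneous_ordge1.
by move=> l /lsh; apply: ordge_homog.
Qed.

(** Built downwards from P: for the last form l, [prime_below] yields a prime inside P that omits l,
    hence a strictly smaller one, to which the shorter sequence applies. *)
Lemma regular_prime_chain ls P : linear_regular_seq ls -> prime_ideal P ->
    adjoin_seq ls `<=` P ->
  exists C : nat -> set S, [/\ forall i, (i <= size ls)%N -> prime_ideal (C i),
    forall i, (i < size ls)%N -> C i `<` C i.+1, C (size ls) = P & I `<=` C 0%N].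
Proof.
elim/last_ind: ls P => [|ls l IHls] P.
  by move=> _ pP IP; exists (fun=> P); split=> // i _.
move=> /linear_regular_seq_rcons[reg l1 lreg] pP; rewrite adjoin_seq_rcons => JP.
have [idJ _] := adjoin_seq_homogeneous (linear_regular_seq_homog reg).
have JP' : adjoin_seq ls `<=` P by apply: subset_trans JP; apply: sub_ideal_adjoin.
have [P' [pP' JP'' P'P P'l]] := prime_below idJ pP JP' lreg.
have [C [Cp Clt CP IC]] := IHls P' reg pP' JP''.
exists (fun i => if (i <= size ls)%N then C i else P); rewrite size_rcons; split.
- by move=> i _; case: ifP => // il; apply: Cp.
- move=> i; rewrite ltnS leq_eqVlt => /orP[/eqP->|il]; last by rewrite il orbT; apply: Clt.
  rewrite eqxx ltnn /= CP; split=> // /(_ l) PP'; apply/P'l/PP'/JP.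
  exact: mem_ideal_adjoin.
- by rewrite ltnn.
- by [].
Qed.

Variables (R : comPzRingType) (lam : {rmorphism S -> R}).
Hypothesis lamR : local_model I lam.

Lemma ordge1_prime : prime_ideal (@ordge k n 1).
Proof.
split; first exact: ordge_ideal.
  by move=> /ordge1P/eqP; rewrite rmorph1 oner_eq0.
by move=> f g /ordge1P/eqP; rewrite rmorphM mulf_eq0 => /orP[]/eqP/ordge1P; [left|right].
Qed.

Lemma socle_homogeneous (J : set S) : homogeneous_ideal J ->
    (forall c u, u \is c.-homog -> (forall i, J ('X_i * u)) -> J u) ->
  forall u, (forall i, J ('X_i * u)) -> J u.
Proof.
move=> hJ soc u Ju; apply: (homogeneousP hJ) => c; have [_ HJ] := hJ.
apply: (soc c) => [|i]; first exact: pihomogP.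
have X1 : ('X_i : S) \is 1.-homog by rewrite dhomogX /= mdeg1.
by rewrite -(pihomog_homogM c u X1); apply: HJ.
Qed.

Variable t : nat.
Variable F : minimal_graded_resolution I.
Hypothesis F_linear : forall i (j : 'I_(rank F i)), deg j = (t + i)%N.
Hypothesis k_infinite : infinite_set [set: k].
Variable d : nat.
Hypothesis R_depth : exists2 a : seq R, size a = d & regular_seq a.
Hypothesis R_dim : forall m, prime_chain R m -> (m <= d)%N.

Lemma linear_regular_seq_ex j : (j <= d)%N ->
  exists ls, [/\ size ls = j, linear_regular_seq ls,
    forall p c, (n + j < p + d)%N -> koszul_vanish (adjoin_seq ls) p c &
    forall p c, (maxn t 1 <= c)%N -> koszul_vanish (adjoin_seq ls) p c].
Proof.
have [idI _] := hI; elim: j => [_|j IHj jd].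
  exists [::]; split=> //.
    move=> p c; rewrite addn0 => npd z zp _ dz; have [a sa areg] := R_depth.
    by apply: (regular_seq_koszul_vanish lamR areg) => //; rewrite sa.
  move=> p c; rewrite geq_max => /andP[tc c0] z zp zc dz.
  exact: (linear_resolution_koszul F_linear idI c0 tc zp zc dz).
have [ls [sj reg van1 van2]] := IHj (ltnW jd).
have hJ := adjoin_seq_homogeneous (linear_regular_seq_homog reg); have [idJ _] := hJ.
(* In exterior degree n the first bound n + j < n + d is the assumption j < d. *)
have soc u : (forall i, adjoin_seq ls ('X_i * u)) -> adjoin_seq ls u.
  apply: (socle_homogeneous hJ) => c v vc; apply: (koszul_vanish_socle idJ _ vc).
  by apply: van1; lia.
have [l l1 lreg] := regular_linear_form k_infinite idJ soc.
exists (rcons ls l); rewrite size_rcons sj adjoin_seq_rcons; split=> //.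
- exact/linear_regular_seq_rcons.
- case=> [|p] c npd; first by apply: koszul_vanish_adjoin0 => //; apply: van1; lia.
  by apply: koszul_vanish_adjoin => //; apply: van1; lia.
- case=> [|p] c Tc; first by apply: koszul_vanish_adjoin0 => //; apply: van2.
  by apply: koszul_vanish_adjoin => //; apply: van2.
Qed.

Lemma linear_reduction : exists ls, [/\ size ls = d, linear_regular_seq ls &
  @ordge k n (maxn t 1) `<=` adjoin_seq ls].
Proof.
have [ls [sd reg _ van]] := linear_regular_seq_ex (leqnn d).
have hJ := adjoin_seq_homogeneous (linear_regular_seq_homog reg); have [idJ _] := hJ.
exists ls; split=> //.
have [|N JN] := primary_of_unique_prime hJ.
  move=> P pP JP Pm; apply: contrapT => mP.
  have [C [Cp Clt CP IC]] := regular_prime_chain reg pP JP.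
  suff /R_dim : prime_chain R d.+1 by rewrite ltnn.
  (* The chain of length d ending at P, prolonged by the irrelevant ideal, has length d + 1. *)
  apply: (model_prime_chain lamR (C := fun i => if (i <= d)%N then C i else ordge 1)).
  - move=> i _; case: ifP => [id|_]; last exact: ordge1_prime.
    by apply: Cp; rewrite sd.
  - move=> i; rewrite ltnS leq_eqVlt => /orP[/eqP->|id].
      by rewrite eqxx ltnn /= -sd CP; split.
    by rewrite id orbT; apply: Clt; rewrite sd.
  - by [].
  - by rewrite ltnn.
apply: (ordge_sub_of_socle idJ _ JN) => c u Tc uc.
exact: (koszul_vanish_socle idJ (van _ _ Tc) uc).
Qed.

End LinearSequences.

Lemma ring_isomorphic_of_kernels (S Q Q' : comPzRingType)
    (f : {rmorphism S -> Q}) (g : {rmorphism S -> Q'}) :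
    (forall y, exists x, f x = y) -> (forall y, exists x, g x = y) ->
    (forall x, f x = 0 <-> g x = 0) -> ring_isomorphic Q Q'.
Proof.
move=> /choice[s sK] /choice[r rK] ker.
have fg x y : f x = f y <-> g x = g y.
  by split=> /eqP; rewrite -subr_eq0 -rmorphB => /eqP/ker/eqP;
    rewrite rmorphB subr_eq0 => /eqP.
pose h y := g (s y).
have hf x : h (f x) = g x by apply/fg; rewrite sK.
have hB : zmod_morphism h.
  by move=> y z; rewrite -[y]sK -[z]sK -rmorphB !hf rmorphB.
have hM : monoid_morphism h.
  split=> [|y z]; first by rewrite -(rmorph1 f) hf rmorph1.
  by rewrite -[y]sK -[z]sK -rmorphM !hf rmorphM.
pose Ah := GRing.isZmodMorphism.Build _ _ h hB.
pose Mh := GRing.isMonoidMorphism.Build _ _ h hM.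
pose H : {rmorphism Q -> Q'} := HB.pack h Ah Mh.
exists H; exists (fun z => f (r z)) => [y|z] /=.
  by rewrite -[RHS]sK; apply/fg; rewrite rK.
by rewrite -[LHS]/(h _) hf rK.
Qed.

(** * The maximal regular sequence of linear forms in the completion *)

Section CompletionRegularSequence.
Variables (k : fieldType) (n : nat) (I : set {mpoly k[n]}).
Local Notation S := {mpoly k[n]}.
Variables (R : comPzRingType) (lam : {rmorphism S -> R}).
Hypothesis lamR : local_model I lam.
Local Notation C := (completion (extension lam (@ordge k n 1))).
Local Notation iota := (@to_completion k n R lam).

Let hI : homogeneous_ideal I. Proof. by case: lamR. Qed.
Let idI : is_ideal I. Proof. by case: hI. Qed.
Let I1 : ~ I 1. Proof. by case: lamR. Qed.

Lemma ideal_gen_completed (ls : seq S) : {in ls, forall l, l \is 1.-homog} ->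
  ideal_gen [set` map iota ls] = @completed_ideal k n R lam (adjoin_seq I ls).
Proof.
elim/last_ind: ls => [|ls l IHls] lsh.
  by rewrite ideal_gen_nil /adjoin_seq /= (completed_ideal_base lamR).
have lsh' : {in ls, forall l, l \is 1.-homog}.
  by move=> l' l'ls; apply: lsh; rewrite mem_rcons inE l'ls orbT.
rewrite map_rcons ideal_gen_rcons IHls // adjoin_seq_rcons.
rewrite -(completed_ideal_adjoin lamR) //.
- exact: adjoin_seq_homogeneous.
- exact: sub_adjoin_seq.
- by apply: lsh; rewrite mem_rcons mem_head.
Qed.

Variables (ls : seq S) (T : nat).
Hypothesis ls_regular : linear_regular_seq I ls.
Hypothesis ls_primary : @ordge k n T `<=` adjoin_seq I ls.
Local Notation J := (adjoin_seq I ls).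

Let lsh : {in ls, forall l, l \is 1.-homog}.
Proof. exact: linear_regular_seq_homog ls_regular. Qed.
Let hJ : homogeneous_ideal J. Proof. exact: adjoin_seq_homogeneous. Qed.
Let idJ : is_ideal J. Proof. by case: hJ. Qed.
Let IJ : I `<=` J. Proof. exact: sub_adjoin_seq. Qed.
Let J1 : ~ J 1. Proof. exact: (adjoin_seq_proper hI I1 lsh). Qed.

Let JE := ideal_gen_completed lsh.
Let approxE c g := completed_ideal_approx lamR idJ IJ ls_primary (c := c) (g := g).

Lemma completion_regular : regular_seq (map iota ls).
Proof.
split=> [j|]; last by rewrite JE; apply: (completed_ideal_proper hJ IJ J1).
rewrite size_map => js c; have [l1 lreg] := ls_regular js.
have lshj : {in take j ls, forall l, l \is 1.-homog} by move=> l /mem_take/lsh.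
rewrite -map_take (nth_map 0) // ideal_gen_completed //.
apply: (completed_ideal_regular lamR) => //.
  exact: adjoin_seq_homogeneous.
exact: sub_adjoin_seq.
Qed.

Lemma socle_ex : exists u, ~ J u /\ forall g, ordge 1 g -> J (g * u).
Proof.
have ex : exists N, `[< @ordge k n N `<=` J >] by exists T; apply/asboolP.
case: (ex_minnP ex) => -[|N] /asboolP JN minN.
  by case: J1; apply: JN.
have [u Nu Ju] : exists2 u, @ordge k n N u & ~ J u.
  apply: contrapT => nu; suff : (N.+1 <= N)%N by rewrite ltnn.
  apply: minN; apply/asboolP => u uN; apply: contrapT => Ju.
  by apply: nu; exists u.
by exists u; split=> // g g1; apply: JN; apply: (@ordgeM _ _ 1).
Qed.

(** A further y either has an approximation with nonzero constant term, and is then a unit modulo J,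
    or has one in the irrelevant ideal, and then kills a nonzero socle element of S/J. *)
Lemma completion_maximal_regular : maximal_regular_seq (map iota ls).
Proof.
split=> [|y [reg]]; first exact: completion_regular.
rewrite ideal_gen_rcons JE => proper; have [g yg] := approx_ex lamR y T.
have [g0|g0] := eqVneq g@_0 0; last first.
  apply: proper; have [h gh] := inverse_mod_order T g0; exists (iota h).
  apply/(approxE (approxB (approx1 _ T) (approxM yg (approx_const _ h T)))).
  by apply: ls_primary; rewrite -opprB; apply: (idealN (@ordge_ideal k n T)).
have [u [Ju mu]] := socle_ex; apply: Ju.
apply/(approxE (approx_const lam u T)).
have := reg (size ls); rewrite size_rcons size_map ltnSn nth_rcons size_map ltnn eqxx.
rewrite -cats1 take_size_cat ?size_map // JE => /(_ isT); apply.
apply/(approxE (approxM yg (approx_const lam u T))).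
exact/mu/ordge1P.
Qed.

Lemma completion_quot_isomorphic (Q : comPzRingType) (psi : {rmorphism S -> Q}) :
    (forall y, exists x, psi x = y) -> (forall f, psi f = 0 <-> J f) ->
  ring_isomorphic (quot [set` map iota ls]) Q.
Proof.
move=> psi_surj psi0; pose q := quot_pi [set` map iota ls].
have q0 c : q c = 0 <-> completed_ideal J c by rewrite -JE; apply: quot_pi_eq0.
pose f := (quot_pi [set` map iota ls] \o iota : {rmorphism S -> _}).
apply: (@ring_isomorphic_of_kernels _ _ _ f psi) => //.
  elim/quot_ind=> c; have [g cg] := approx_ex lamR c T; exists g.
  apply/esym/eqP; rewrite -subr_eq0 -rmorphB; apply/eqP/q0.
  apply/(approxE (approxB cg (approx_const lam g T))).
  by rewrite subrr; apply: (ideal0 idJ).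
by move=> x; rewrite psi0 -(approxE (approx_const lam x T)); apply: q0.
Qed.

End CompletionRegularSequence.

(** * Regular local rings and Burch ideals *)

Section KrullBound.
Variables (k : fieldType) (n : nat).
Local Notation S := {mpoly k[n]}.
Implicit Types (f g : S) (P : set S) (s : seq nat) (b : seq S).

Definition degle d f := forall m, (d < mdeg m)%N -> f@_m = 0.

Lemma degleM c d f g : degle c f -> degle d g -> degle (c + d) (f * g).
Proof.
move=> fc gd m mcd; rewrite mcoeffM big1 // => -[m1 m2] /= /eqP/(congr1 (@mdeg n)).
rewrite mdegD => e; have [m1c|cm1] := leqP (mdeg m1) c; last by rewrite fc ?mul0r.
by rewrite gd ?mulr0 //; lia.
Qed.

Lemma degle1 : degle 0 1.
Proof.
move=> m m0; rewrite mcoeff1; case: eqP m0 => // ->.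
by rewrite mdeg0.
Qed.

Lemma degle_le c d f : (c <= d)%N -> degle c f -> degle d f.
Proof. by move=> cd fc m dm; apply: fc; apply: leq_ltn_trans dm. Qed.

Lemma degle_exp d f e : degle d f -> degle (e * d) (f ^+ e).
Proof.
move=> fd; elim: e => [|e IHe]; first exact: degle1.
by rewrite exprS mulSn; apply: degleM.
Qed.

Lemma degle_ex f : exists d, degle d f.
Proof.
exists (msize f) => m fm; apply: memN_msupp_eq0; apply/negP => /msize_mdeg_lt.
by rewrite ltnNge ltnW.
Qed.

Fixpoint powers_below (N m : nat) : seq (seq nat) :=
  if m is m'.+1 then [seq e :: s | e <- iota 0 N, s <- powers_below N m'] else [:: [::]].

Fixpoint monomial b s : S :=
  match b, s with a :: b', e :: s' => a ^+ e * monomial b' s' | _, _ => 1 end.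

Definition combination N b (c : seq nat -> k) : S :=
  \sum_(s <- powers_below N (size b)) (c s)%:MP * monomial b s.

Lemma size_powers_below N m : size (powers_below N m) = (N ^ m)%N.
Proof. by elim: m => //= m IHm; rewrite size_allpairs size_iota IHm expnS. Qed.

Lemma powers_below_uniq N m : uniq (powers_below N m).
Proof.
elim: m => //= m IHm; apply: allpairs_uniq => //; first exact: iota_uniq.
by move=> [e s] [e' s'] _ _ [-> ->].
Qed.

Lemma combination_cons N a b c :
  combination N (a :: b) c =
  \sum_(e <- iota 0 N) a ^+ e * combination N b (fun s => c (e :: s)).
Proof.
rewrite /combination /= big_allpairs_dep; apply: eq_bigr => e _.
by rewrite mulr_sumr; apply: eq_bigr => s _; rewrite mulrCA.
Qed.

Lemma degle_combination N D b c : {in b, forall a, degle D a} ->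
  degle (size b * (N * D)) (combination N b c).
Proof.
elim: b c => [|a b IHb] c bD.
  by move=> m m0; rewrite /combination /= big_seq1 /= mulr1 mcoeffC; case: eqP m0 => [->|];
    rewrite ?mdeg0 // mulr0.
rewrite combination_cons big_seq => m mB; rewrite raddf_sum /= big1 // => e.
rewrite mem_iota /= => eN; move: m mB; apply: (@degle_le (e * D + size b * (N * D))).
  by rewrite mulSn leq_add2r leq_mul2r (ltnW eN) orbT.
apply: degleM; first by apply: degle_exp; apply: bD; rewrite mem_head.
by apply: IHb => a' a'b; apply: bD; rewrite inE a'b orbT.
Qed.

(* More monomials in b than coefficients to kill. *)
Lemma algebraic_dependence b : (n < size b)%N ->
  exists N c, combination N b c = 0 /\ exists2 s, s \in powers_below N (size b) & c s != 0.
Proof.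
move=> nb; have [D bD] : exists D, {in b, forall a, degle D a}.
  elim: (b) => [|a b' [D bD]]; first by exists 0%N.
  have [D' aD'] := degle_ex a; exists (maxn D D') => a'.
  rewrite inE => /orP[/eqP->|/bD]; first exact/degle_le/aD'/leq_maxr.
  exact/degle_le/leq_maxl.
(* There are N ^ size b, hence at least N ^ n.+1, monomials in b, of degree below B <= N * (size b *
   D).+1. They involve at most B ^ n coefficients, fewer than N ^ n.+1 since N exceeds (size b *
   D).+1 ^ n. *)
pose N := ((size b * D).+1 ^ n).+1; pose B := (size b * (N * D)).+1.
pose rows := powers_below N (size b).
pose mon (f : {ffun 'I_n -> 'I_B}) : 'X_{1..n} := [multinom (f i : nat) | i < n].
pose M : 'M[k]_(size rows, #|{ffun 'I_n -> 'I_B}|) :=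
  \matrix_(i, j) (monomial b (nth [::] rows i))@_(mon (enum_val j)).
have leX p q e : (p <= q -> p ^ e <= q ^ e)%N.
  by move=> pq; elim: e => // e IHe; rewrite !expnS leq_mul.
have ltM : (#|{ffun 'I_n -> 'I_B}| < size rows)%N.
  rewrite card_ffun !card_ord size_powers_below.
  apply: (@leq_trans (N ^ n.+1)); last by apply: leq_pexp2l.
  rewrite expnS (@leq_ltn_trans ((N * (size b * D).+1) ^ n)) //.
    by apply: leX; rewrite /B mulnCA mulnS -add1n leq_add2r.
  by rewrite expnMn mulnC ltn_pmul2r // expn_gt0.
have [v v0 vM] : exists2 v : 'rV_(size rows), v != 0 & v *m M = 0.
  have : kermx M != 0.
    rewrite kermx_eq0 /row_free neq_ltn; apply/orP; left.
    exact: leq_ltn_trans (rank_leq_col _) ltM.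
  move=> /rowV0Pn[v /sub_kermxP vM v0]; by exists v.
pose c s : k := if insub (index s rows) is Some i then v 0 i else 0.
have cE (i : 'I_(size rows)) : c (nth [::] rows i) = v 0 i.
  by rewrite /c index_uniq ?powers_below_uniq // valK.
have combE : combination N b c = \sum_i (v 0 i)%:MP * monomial b (nth [::] rows i).
  rewrite /combination (big_nth [::]) big_mkord; apply: eq_bigr => i _.
  by rewrite cE.
exists N, c; split.
  apply/mpolyP => m; rewrite mcoeff0; have [Bm|mB] := leqP B (mdeg m).
    exact: (degle_combination c bD Bm).
  have mi i : (m i < B)%N.
    by apply: leq_ltn_trans mB; rewrite mdegE (bigD1 i) //= leq_addr.
  have -> : m = mon [ffun i => Ordinal (mi i)] by apply/mnmP => i; rewrite mnmE ffunE.
  rewrite -[[ffun i => _]]enum_rankK; have /rowP/(_ (enum_rank [ffun i => Ordinal (mi i)])) := vM.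
  rewrite !mxE => <-; rewrite combE raddf_sum; apply: eq_bigr => i _.
  by rewrite /= mcoeffCM mxE.
have [i vi] : exists i, v 0 i != 0.
  apply: contrapT => nv; move: v0; rewrite -subr_eq0 subr0 => /eqP; apply.
  by apply/rowP => i; rewrite mxE; apply: contrapT => /eqP vi; apply: nv; exists i.
by exists (nth [::] rows i); [apply: mem_nth|rewrite cE].
Qed.

Lemma combination0 N b c : {in powers_below N (size b), forall s, c s = 0} ->
  combination N b c = 0.
Proof. by move=> c0; rewrite /combination big_seq big1 // => s /c0->; rewrite mul0r. Qed.

(* In a polynomial relation between the elements [b`_i] of [P i.+1] outside
   [P i], the lexicographically lowest term must vanish. *)
Lemma chain_independent N b c (P : nat -> set S) :
    (forall i, (i <= size b)%N -> prime_ideal (P i)) ->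
    (forall i, (i < size b)%N -> [/\ P i `<=` P i.+1, P i.+1 b`_i & ~ P i b`_i]) ->
    P 0%N (combination N b c) ->
  {in powers_below N (size b), forall s, c s = 0}.
Proof.
elim: b c P => [|a b IHb] c P Pp Pb Pc s.
  rewrite /= inE => /eqP->; apply: contrapT => /eqP c0; have [idP P1 _] := Pp 0%N isT.
  apply: P1; apply: (ideal_mpolyC_unit idP c0); move: Pc.
  by rewrite /combination /= big_seq1.
move=> /allpairsP[[e s'] [/= eN s'N ->]]; apply: contrapT => /eqP ces.
have [idP P1 PM] := Pp 0%N isT; have [P01 Pa nPa] := Pb 0%N isT.
have ex : exists e, `[< (e < N)%N /\
    exists2 s, s \in powers_below N (size b) & c (e :: s) != 0 >].
  by exists e; apply/asboolP; rewrite mem_iota in eN; split=> //; exists s'.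
case: (ex_minnP ex) => e0 /asboolP[e0N [s0 s0N ce0]] mine0.
suff : c (e0 :: s0) = 0 by move=> /eqP; rewrite (negbTE ce0).
apply: (IHb (fun s => c (e0 :: s)) (fun i => P i.+1)) => //.
- by move=> i ib; apply: Pp.
- by move=> i ib; apply: (Pb i.+1).
have [idP1 _ _] := Pp 1%N isT.
pose V e := combination N b (fun s => c (e :: s)).
pose W := \sum_(e <- iota e0.+1 (N - e0.+1)) a ^+ (e - e0.+1) * V e.
have CE : combination N (a :: b) c = a ^+ e0 * (V e0 + a * W).
  have iotaE : iota 0 N = iota 0 e0 ++ e0 :: iota e0.+1 (N - e0.+1).
    have {1}-> : N = (e0 + (N - e0.+1).+1)%N by lia.
    by rewrite iotaD add0n.
  rewrite combination_cons iotaE big_cat /= big_cons big_seq big1 ?add0r; last first.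
    move=> e1; rewrite mem_iota /= => e10; rewrite combination0 ?mulr0 // => s1 s1N.
    apply: contrapT => /eqP ce1; suff : (e0 <= e1)%N by rewrite leqNgt e10.
    apply: mine0; apply/asboolP; split; last by exists s1.
    exact: ltn_trans e10 e0N.
  rewrite mulrDr /W mulr_sumr mulr_sumr; congr (_ + _).
  rewrite big_seq [RHS]big_seq; apply: eq_bigr => e1; rewrite mem_iota => /andP[e01 _].
  by rewrite !mulrA -exprSr -exprD; congr (_ ^+ _ * _); lia.
have nPae e1 : ~ P 0%N (a ^+ e1).
  elim: e1 => [|e1 IHe]; first by rewrite expr0.
  by rewrite exprS => /PM[].
move: Pc; rewrite CE => /PM[/nPae//|/P01 PVW].
by have := idealB idP1 PVW (ideal_mulr W idP1 Pa); rewrite addrK.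
Qed.

(** Elements chosen in the successive differences of a chain are algebraically independent by
    [chain_independent], and more than n polynomials are not. *)
Lemma mpoly_prime_chain_le l : prime_chain S l -> (l <= n)%N.
Proof.
move=> [P [Pp Plt]]; rewrite leqNgt; apply/negP => nl.
have /choice[a aP] i : exists x, (i < l)%N -> P i.+1 x /\ ~ P i x.
  have [il|il] := ltnP i l; last by exists 0.
  have [_ /existsNP[x /not_implyP Px]] := Plt i il.
  by exists x.
pose b := mkseq a l; have sb : size b = l by rewrite size_mkseq.
have [|N [c [c0 [s sN cs]]]] := @algebraic_dependence b; first by rewrite sb.
move: cs; rewrite (@chain_independent N b c P) ?eqxx //.
- by move=> i; rewrite sb; apply: Pp.
- move=> i; rewrite sb => il; rewrite nth_mkseq //; have [Px nPx] := aP i il.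
  by split=> //; case: (Plt i il).
by rewrite c0; have [[]] := Pp 0%N isT.
Qed.

Lemma mpoly_hom_ext (R : comPzRingType) (f g : {rmorphism S -> R}) :
  (forall c, f c%:MP = g c%:MP) -> (forall i, f 'X_i = g 'X_i) -> f =1 g.
Proof.
move=> fgC fgX p; elim/mpolyind: p => [|c m p _ _ IHp]; first by rewrite !rmorph0.
rewrite !rmorphD IHp -mul_mpolyC !rmorphM fgC; congr (_ * _ + _).
rewrite mpolyXE_id !rmorph_prod; apply: eq_bigr => i _.
by rewrite !rmorphXn fgX.
Qed.

Definition kill_variables (i : nat) : S -> S :=
  comp_mpoly [tuple if (j < i)%N then 0 else 'X_j | j < n].

HB.instance Definition _ i := GRing.RMorphism.on (kill_variables i).

Lemma kill_variablesC i c : kill_variables i c%:MP = c%:MP.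
Proof. exact: comp_mpolyC. Qed.

Lemma kill_variablesX i j : kill_variables i 'X_j = if (j < i)%N then 0 else 'X_j.
Proof. by rewrite /kill_variables comp_mpolyXU -tnth_nth tnth_mktuple. Qed.

(** The ideal of the first i variables, given as a kernel so that primality comes from S being a
    domain. *)
Definition variable_prime i : set S := [set f | kill_variables i f = 0].

Lemma variable_prime_prime i : prime_ideal (variable_prime i).
Proof.
split=> [||f g] /=; last first.
- by rewrite /variable_prime /= rmorphM => /eqP; rewrite mulf_eq0 => /orP[]/eqP; [left|right].
- by rewrite /variable_prime /= rmorph1 => /eqP; rewrite oner_eq0.
split=> [|f g|a f]; rewrite /variable_prime /= ?rmorph0 // ?rmorphD ?rmorphM.
  by move=> /= -> ->; rewrite addr0.
by move=> /= ->; rewrite mulr0.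
Qed.

Lemma variable_prime_lt i : (i < n)%N -> variable_prime i `<` variable_prime i.+1.
Proof.
move=> il; split=> [f /= f0|/(_ 'X_(Ordinal il))].
  rewrite /variable_prime /=; suff <- : kill_variables i.+1 (kill_variables i f) = kill_variables i.+1 f.
    by rewrite (f0 : kill_variables i f = 0) rmorph0.
  apply: (@mpoly_hom_ext _ (kill_variables i.+1 \o kill_variables i) (kill_variables i.+1)).
    by move=> c /=; rewrite !kill_variablesC.
  move=> j /=; rewrite kill_variablesX; case: ifP => ji; rewrite ?rmorph0 //.
  by rewrite kill_variablesX ltnW.
rewrite /variable_prime /= !kill_variablesX /= ltnSn ltnn => /(_ erefl)/(congr1 (mcoeff U_(Ordinal il))).
by rewrite mcoeffX eqxx mcoeff0 => /eqP; rewrite oner_eq0.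
Qed.

Lemma variable_prime_ordge1 i : variable_prime i `<=` ordge 1.
Proof.
move=> f /(congr1 (mcoeff 0)); rewrite rmorph0 => f0; apply/ordge1P; rewrite -{}f0.
apply: (@mpoly_hom_ext _ (mcoeff 0) (mcoeff 0 \o kill_variables i)) => [c|j] /=.
  by rewrite kill_variablesC.
rewrite kill_variablesX; case: ifP => // _; rewrite mcoeffX mcoeff0.
by case: eqP => // /(congr1 (@mdeg n)); rewrite mdeg1 mdeg0.
Qed.

End KrullBound.

Section RegularModel.
Variables (k : fieldType) (n : nat).
Local Notation S := {mpoly k[n]}.
Variables (A : comPzRingType) (lam : {rmorphism S -> A}).
Hypothesis lamA : local_model [set 0] lam.
Local Notation mA := (extension lam (@ordge k n 1)).

Lemma model_regular : regular_local_ring mA.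
Proof.
split; first exact: model_local lamA.
exists [seq lam 'X_i | i <- enum 'I_n]; first exact: model_max_gen lamA.
rewrite size_map -cardE card_ord; split=> [|l /(model_prime_chain_contract lamA)].
  apply: (model_prime_chain lamA (C := @variable_prime k n)).
  - by move=> i _; apply: variable_prime_prime.
  - exact: variable_prime_lt.
  - by move=> _ ->; rewrite /variable_prime /= rmorph0.
  - exact: variable_prime_ordge1.
exact: mpoly_prime_chain_le.
Qed.

Lemma model_power_burch T : (0 < n)%N -> (0 < T)%N -> burch_ideal mA (ideal_exp mA T).
Proof.
move=> n0; case: T => // T _; split; first exact: ideal_expP.
pose x := lam 'X_(Ordinal n0).
have xm : mA x by apply: extension_lam; apply: ordgeXU.
have Xe i : @ordge k n i ('X_(Ordinal n0) ^+ i).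
  elim: i => // i IHi; rewrite exprS -[i.+1]/(1 + i)%N.
  by apply: ordgeM => //; apply: ordgeXU.
have exm i : ideal_exp mA i (x ^+ i).
  by rewrite (model_max_exp lamA) -rmorphXn; apply: extension_lam.
have xT : ideal_mul mA (ideal_colon (ideal_exp mA T.+1) mA) (x ^+ T.+1).
  apply: sub_ideal_gen; exists x => //; exists (x ^+ T); last by rewrite -exprS.
  move=> y my; rewrite mulrC; apply: sub_ideal_gen; exists y => //.
  by exists (x ^+ T); [exact: exm|by []].
move=> e; move: xT; rewrite -e -[ideal_mul _ _]/(ideal_exp mA T.+2).
(* If the power of the variable lay in the next power of the maximal ideal, some s with s(0) nonzero
   would carry it to order T + 2; its component of degree T + 1, s(0) times the power, would then
   vanish. *)
rewrite (model_max_exp lamA) -rmorphXn => /(extension_contract lamA)[s [g [s0 gT /= e0]]].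
have /eqP : s * 'X_(Ordinal n0) ^+ T.+1 = g by apply/eqP; rewrite -subr_eq0; apply/eqP.
have XT : ('X_(Ordinal n0) : S) ^+ T.+1 \is T.+1.-homog.
  by have := @dhomogMn _ _ mdeg 1 'X_(Ordinal n0) T.+1; rewrite mul1n; apply;
    rewrite dhomogX /= mdeg1.
move=> /eqP/(congr1 (pihomog mdeg (T.+1 + 0))).
rewrite mulrC (pihomog_homogM 0 s XT) (pihomog_ordge gT) ?addn0 // pihomog0_const.
move/eqP; rewrite mulf_eq0 mpolyC_eq0 (negbTE s0) orbF expf_eq0 /= => /eqP.
by move=> /(congr1 (mcoeff U_(Ordinal n0))); rewrite mcoeffX eqxx mcoeff0 => /eqP; rewrite oner_eq0.
Qed.

End RegularModel.

(** * The theorem *)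

Section LinearSubstitution.
Variables (k : fieldType) (n r : nat).
Local Notation S := {mpoly k[n]}.
Local Notation S' := {mpoly k[r]}.
Variable M : 'M[k]_(n, r).

Definition linear_subst : S -> S' :=
  comp_mpoly [tuple \sum_j (M i j)%:MP * ('X_j : S') | i < n].

HB.instance Definition _ := GRing.RMorphism.on linear_subst.

Lemma linear_substC c : linear_subst c%:MP = c%:MP.
Proof. exact: comp_mpolyC. Qed.

Lemma linear_substX i : linear_subst 'X_i = \sum_j (M i j)%:MP * 'X_j.
Proof. by rewrite /linear_subst comp_mpolyXU -tnth_nth tnth_mktuple. Qed.

Lemma linear_subst_const f : (linear_subst f)@_0 = f@_0.
Proof.
apply: (@mpoly_hom_ext _ _ _ (mcoeff 0 \o linear_subst) (mcoeff 0)) => [c|i] /=.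
  by rewrite linear_substC !mcoeffC !eqxx.
have X0 m (j : 'I_m) : ('X_j : {mpoly k[m]})@_0 = 0 by apply/ordge1P/ordgeXU.
rewrite linear_substX X0 raddf_sum big1 //= => j _.
by rewrite mcoeffCM X0 mulr0.
Qed.

Lemma ordge_linear_subst T f : ordge T f -> ordge T (linear_subst f).
Proof.
have ido := @ordge_ideal k r T.
apply: (@ordge_ind _ _ [set f | ordge T (linear_subst f)]).
  split=> [|f1 f2|a f1] /=; first by rewrite rmorph0; exact: (ideal0 ido).
    by rewrite rmorphD; exact: (idealD ido).
  by rewrite rmorphM; exact: (idealM _ ido).
move=> m Tm /=; apply: (ordge_le Tm).
rewrite mdegE mpolyXE_id rmorph_prod.
elim/big_ind2: _ => // [a f1 b f2|i _]; first exact: ordgeM.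
rewrite rmorphXn /=; elim: (m i) => // e IHe; rewrite exprS -[e.+1]/(1 + e)%N.
apply: ordgeM => //; rewrite linear_substX; apply: ideal_sum => [|j _].
  exact: ordge_ideal.
exact: (idealM _ (@ordge_ideal k r 1) (@ordgeXU k r j)).
Qed.

End LinearSubstitution.

Lemma linear_form_sum (k : fieldType) n (l : {mpoly k[n]}) : l \is 1.-homog ->
  l = \sum_i (l@_U_(i))%:MP * 'X_i.
Proof.
move=> /dhomogP l1; apply/mpolyP => m; rewrite raddf_sum /=.
under eq_bigr do rewrite mcoeffCM mcoeffX.
have [/mdeg1P[i /eqP->]|m1] := boolP (mdeg m == 1%N).
  rewrite (bigD1 i) //= eqxx mulr1 big1 ?addr0 // => j ji.
  case: eqP => [/mnmP/(_ j)|_]; last by rewrite mulr0.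
  by rewrite !mnm1E eqxx eq_sym (negbTE ji).
rewrite memN_msupp_eq0; last by apply: contra m1 => /l1/eqP.
rewrite big1 // => j _; case: eqP => [e|_]; last by rewrite mulr0.
by move: m1; rewrite -e mdeg1.
Qed.

Lemma zero_homogeneous (k : fieldType) n : homogeneous_ideal [set 0 : {mpoly k[n]}].
Proof. by split=> [|_ d ->]; [apply: ideal_zero|rewrite pihomog0]. Qed.

(** * The reduced quotient as a truncated polynomial ring *)

Section Truncation.
Variables (k : fieldType) (n : nat) (ls : seq {mpoly k[n]}).
Local Notation S := {mpoly k[n]}.
Hypothesis lsh : {in ls, forall l, l \is 1.-homog}.

(** The rows of L are the coefficient vectors of the forms. A row is killed by [cokermx L],
    equivalently by its column basis [Cb], exactly when it lies in their span, so substitution along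
    [Cb] eliminates precisely these forms and leaves [\rank K] variables. *)
Let L : 'M[k]_(size ls, n) := \matrix_(a, i) (ls`_a)@_U_(i).
Let K := cokermx L.
Let Cb := col_base K.

Let LCb : L *m Cb = 0.
Proof.
apply/eqP; rewrite -(mulmx_free_eq0 _ (row_base_free K)) -mulmxA mulmx_base.
by rewrite mulmx_coker.
Qed.

Local Notation sigma := (linear_subst Cb).
Let Lid := adjoin_seq [set 0] ls.

Let Lid_homogeneous : homogeneous_ideal Lid.
Proof. exact: (adjoin_seq_homogeneous (@zero_homogeneous k n) lsh). Qed.
Let Lid_ideal : is_ideal Lid. Proof. by case: Lid_homogeneous. Qed.
Let Lid_mem l : l \in ls -> Lid l.
Proof. exact: (mem_adjoin_seq (@zero_homogeneous k n) lsh). Qed.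

Let sigma_Lid f : Lid f -> sigma f = 0.
Proof.
apply: (@adjoin_seq_min _ _ [set 0] ls [set f | sigma f = 0]) => [|_ ->|l lls] /=.
- split=> [|f1 f2|a f1] /=; first exact: rmorph0.
    by rewrite rmorphD /= => -> ->; rewrite addr0.
  by rewrite rmorphM /= => ->; rewrite mulr0.
- exact: rmorph0.
have al : (index l ls < size ls)%N by rewrite index_mem.
rewrite (linear_form_sum (lsh lls)) rmorph_sum /=.
under eq_bigr do rewrite rmorphM /= linear_substC linear_substX mulr_sumr.
rewrite exchange_big big1 // => j _.
have /matrixP/(_ (Ordinal al) j) := LCb; rewrite !mxE => e.
transitivity ((\sum_i L (Ordinal al) i * Cb i j)%:MP * ('X_j : {mpoly k[_]})).
  rewrite raddf_sum mulr_suml; apply: eq_bigr => i _.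
  by rewrite /= mpolyCM mulrA !mxE /= nth_index.
by rewrite e mpolyC0 mul0r.
Qed.

(** A left inverse D of [Cb] gives the section. The rows of Cb *m D - 1 are killed by [cokermx L],
    hence are combinations of the forms, so [tau (sigma f)] and f agree modulo them. *)
Let sectionE : exists tau : {rmorphism {mpoly k[\rank K]} -> S},
  [/\ forall g, sigma (tau g) = g, forall f, Lid (tau (sigma f) - f) &
    forall T g, ordge T g -> ordge T (tau g)].
Proof.
have /row_fullP[D DCb] := col_base_full K.
exists (linear_subst D); split; last exact: ordge_linear_subst.
- apply: (@mpoly_hom_ext _ _ _ (sigma \o linear_subst D) idfun) => [c|j] /=.
    by rewrite !linear_substC.
  rewrite linear_substX rmorph_sum /=.
  under eq_bigr do rewrite rmorphM /= linear_substC linear_substX mulr_sumr.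
  rewrite exchange_big (bigD1 j) //= [X in _ + X]big1 ?addr0 => [|i ij].
    have /matrixP/(_ j j) := DCb; rewrite !mxE eqxx => e.
    under eq_bigr do rewrite mulrA -mpolyCM.
    by rewrite -mulr_suml -raddf_sum /= e mul1r.
  have /matrixP/(_ j i) := DCb; rewrite !mxE eq_sym (negbTE ij) => e.
  under eq_bigr do rewrite mulrA -mpolyCM.
  by rewrite -mulr_suml -raddf_sum /= e mpolyC0 mul0r.
move=> f; rewrite -[Lid](ideal_gen_id Lid_ideal); apply/quot_piP; move: f.
apply: (@mpoly_hom_ext _ _ _ (quot_pi Lid \o (linear_subst D \o sigma)) (quot_pi Lid)) => [c|i] /=.
  by rewrite !linear_substC.
apply/quot_piP; rewrite (ideal_gen_id Lid_ideal).
have /submxP[W WL] : (Cb *m D - 1%:M <= L)%MS.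
  rewrite submxE -[cokermx L](mulmx_base K) mulmxA mulmxBl mul1mx -mulmxA DCb mulmx1.
  by rewrite subrr mul0mx.
have -> : linear_subst D (sigma 'X_i) - 'X_i =
    \sum_l ((Cb *m D - 1%:M) i l)%:MP * ('X_l : S).
  transitivity (\sum_l ((Cb *m D) i l)%:MP * ('X_l : S) - \sum_l ((i == l)%:R)%:MP * ('X_l : S)).
    congr (_ - _); last first.
      rewrite (bigD1 i) //= eqxx mul1r big1 ?addr0 // => l li.
      by rewrite eq_sym (negbTE li) mul0r.
    rewrite linear_substX rmorph_sum /=.
    under eq_bigr do rewrite rmorphM /= linear_substC linear_substX mulr_sumr.
    rewrite exchange_big; apply: eq_bigr => l _; rewrite mxE raddf_sum mulr_suml.
    by apply: eq_bigr => j _; rewrite /= mpolyCM mulrA.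
  rewrite -sumrB; apply: eq_bigr => l _; rewrite -mulrBl -mpolyCB.
  by rewrite [in RHS]mxE [(- 1%:M) _ _]mxE [1%:M _ _]mxE.
rewrite WL.
have -> : \sum_l ((W *m L) i l)%:MP * ('X_l : S) = \sum_a (W i a)%:MP * ls`_a.
  under [RHS]eq_bigr => a _ do rewrite (linear_form_sum (lsh (mem_nth 0 (ltn_ord a)))) mulr_sumr.
  rewrite exchange_big; apply: eq_bigr => l _; rewrite mxE raddf_sum mulr_suml.
  by apply: eq_bigr => a _; rewrite /= mpolyCM mulrA [L a l]mxE.
apply: ideal_sum => // a _; apply: idealM => //.
by apply: Lid_mem; apply: mem_nth.
Qed.

Lemma truncation_model (J : set S) T : is_ideal J -> (0 < T)%N ->
    {in ls, forall l, J l} -> @ordge k n T `<=` J -> J `<=` ideal_order Lid T ->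
  exists r T' (sig : {rmorphism S -> {mpoly k[r]}}), [/\ (0 < r)%N, (0 < T')%N,
    forall f, J f <-> ordge T' (sig f) & forall g, exists f, ordge T' (g - sig f)].
Proof.
move=> idJ T0 lsJ TJ JL; have [tau [sigmaK Ltau tauT]] := sectionE.
have LJ : Lid `<=` J.
  by apply: adjoin_seq_min => // _ ->; apply: ideal0.
have JE f : J f <-> ordge T (sigma f).
  split=> [/JL[a aT /sigma_Lid]|sT].
    rewrite rmorphB => /eqP; rewrite subr_eq0 => /eqP->.
    exact: ordge_linear_subst.
  by apply: (idealBl idJ (TJ _ (tauT _ _ sT))); apply: LJ.
case: (posnP (\rank K)) => [r0|r0]; last first.
  exists (\rank K), T, sigma; split=> // g; exists (tau g).
  by rewrite /= sigmaK subrr; exact: (ideal0 (@ordge_ideal k _ T)).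
(* No variable is left and J is the irrelevant ideal; all variables are sent to 0 in k[y], where
   order at least 1 then tests only the constant term. *)
exists 1%N, 1%N, (linear_subst (0 : 'M[k]_(n, 1))); split=> // [f|g].
  rewrite JE; split=> [fT|/ordge1P].
    by apply/ordge1P; rewrite linear_subst_const -(linear_subst_const Cb); apply/ordge1P/(ordge_le T0).
  rewrite linear_subst_const -(linear_subst_const Cb) => f0 m _.
  suff -> : m = 0%MM by [].
  by apply/mnmP => -[i im]; exfalso; rewrite r0 in im.
exists (g@_0)%:MP; apply/ordge1P.
by rewrite mcoeffB linear_subst_const mcoeffC eqxx mulr1 subrr.
Qed.

End Truncation.

Theorem proposition5p5 (k : fieldType) (n : nat) (I : set {mpoly k[n]})
  (k_infinite : infinite_set [set: k])
  (I_homogeneous : homogeneous_ideal I)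
  (I_proper : ~ I 1)
  (S_I_CM : cohen_macaulay (quot I))
  (I_linear : has_linear_resolution I) :
  burch_ring (localization_at (quot_pi I @` irrelevant_ideal k n)).
Proof.
have lamR := concrete_local_model I_homogeneous I_proper.
have [_ /(_ _ (quot_irrelevant_maximal I_homogeneous I_proper))] := S_I_CM.
move=> [m [m_local [d R_depth [_ R_dim]]]].
have mE : m = extension (@lam k n I) (ordge 1).
  by case: m_local => _ m_max _; exact: (local_max lamR m_max).
have [t [F F_linear]] := I_linear.
have [ls [sd reg primary]] := linear_reduction I_homogeneous lamR
  F_linear k_infinite R_depth.1 R_dim.
set T := maxn t 1 in primary.
have lsh := linear_regular_seq_homog reg.
have [idJ _] := adjoin_seq_homogeneous I_homogeneous lsh.
(* The two values of the maximum come from different sources: t from the degrees of the generators,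
   1 from the properness of I. *)
have IT : I `<=` ordge T.
  move=> f If; rewrite /T /maxn; case: ifP => _.
    exact: (proper_homogeneous_ordge1 I_homogeneous).
  exact (linear_resolution_ordge F_linear If).
have lsJ l : l \in ls -> adjoin_seq I ls l by apply: mem_adjoin_seq.
have [idL _] := adjoin_seq_homogeneous (@zero_homogeneous k n) lsh.
have [||r [T' [sig [r0 T'0 sigJ sig_surj]]]] := truncation_model lsh idJ _ lsJ primary.
- by rewrite leq_max orbT.
- apply: adjoin_seq_min; first exact: ideal_order_ideal.
    by move=> f /IT fT; apply: ordge_ideal_order.
  move=> l lls; apply: sub_ideal_order.
  exact: (mem_adjoin_seq (@zero_homogeneous k n) lsh).
have z1 : ~ [set 0 : {mpoly k[r]}] 1 by move=> /eqP; rewrite oner_eq0.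
have lamA := concrete_local_model (@zero_homogeneous k r) z1.
pose A := localization_at (quot_pi [set 0] @` irrelevant_ideal k r).
pose nA := extension (@lam k r [set 0]) (ordge 1).
subst m; exists (extension (@lam k n I) (ordge 1)), d; split=> //.
exists (map (@to_completion k n _ (@lam k n I)) ls); split.
- by rewrite size_map.
- exact: (completion_maximal_regular lamR reg primary).
exists A, nA, (ideal_exp nA T'); split.
- exact: model_regular lamA.
- exact: model_power_burch.
have idE := ideal_expP nA T'.
pose psi := (quot_pi (ideal_exp nA T') \o (@lam k r [set 0] \o sig)
  : {rmorphism {mpoly k[n]} -> quot (ideal_exp nA T')}).
have q0 x : quot_pi (ideal_exp nA T') x = 0 <-> ideal_exp nA T' x.
  by rewrite -[X in _ <-> X x](ideal_gen_id idE); apply: quot_pi_eq0.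
apply: (completion_quot_isomorphic lamR reg primary (psi := psi)) => [|f].
  elim/quot_ind=> x; have [g xg] := exp_approx lamA T' x; have [f gf] := sig_surj g.
  exists f; apply/(quot_piP _ _ x); rewrite (ideal_gen_id idE).
  have e : lam [set 0] (sig f) - x = - (x - lam [set 0] g) - lam [set 0] (g - sig f).
    by rewrite rmorphB; ring.
  rewrite /= e; apply: (idealB idE); first exact: (idealN idE).
  by apply/(exp_lam lamA); apply: ordge_ideal_order => //; apply: ideal_zero.
rewrite sigJ /= q0 (exp_lam lamA); split=> [[a aT /eqP]|fT].
  by rewrite subr_eq0 => /eqP->.
by apply: ordge_ideal_order => //; apply: ideal_zero.
Qed.
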